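(* Let $1\le p\le\infty$ and $0<\alpha<\infty$. No nontrivial semigroup of analytic functions induces a strongly continuous semigroup of weighted composition operators on $H(p,\infty,\alpha)$. In other words, if $\{\varphi_t\}$ is a nontrivial semigroup of analytic functions for which the operators $T_tf=\varphi_t'\,(f\circ\varphi_t)$ are bounded on $H(p,\infty,\alpha)$ with $\sup_{0\le t\le1}\|T_t\|<\infty$, then $$[\varphi_t',H(p,\infty,\alpha)]\subsetneq H(p,\infty,\alpha).$$
   Context: A semigroup of analytic functions is a family $\{\varphi_t:t\ge 0\}$ of analytic self-maps of the unit disk $\mathbb{D}$ such that $\varphi_0$ is the identity, $\varphi_{t+s}=\varphi_t\circ\varphi_s$ for all $t,s\ge0$, and $\varphi_t\to\varphi_0$ uniformly on compact subsets of $\mathbb{D}$ as $t\to0$; it is nontrivial if some $\varphi_t$ is not the identity. $\varphi_t'=\partial\varphi_t/\partial z$. For $f$ analytic in $\mathbb{D}$ and $0\le r<1$, $M_p(r,f)=\left(\int_0^{2\pi}|f(re^{i\theta})|^p\frac{d\theta}{2\pi}\right)^{1/p}$ for $p<\infty$ and $M_\infty(r,f)=\max_\theta|f(re^{i\theta})|$. $H(p,\infty,\alpha)$ is the space of analytic $f$ on $\mathbb{D}$ with $\|f\|_{p,\infty,\alpha}=\sup_{0\le r<1}(1-r)^\alpha M_p(r,f)<\infty$. For a Banach space $X$ of analytic functions on $\mathbb{D}$ on which the $T_t$ are bounded, $[\varphi_t',X]=\{f\in X:\lim_{t\to0^+}\|\varphi_t'(f\circ\varphi_t)-f\|_X=0\}$.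 The semigroup $\{T_t\}$ is strongly continuous on $X$ if $\lim_{t\to0^+}\|T_tf-f\|_X=0$ for every $f\in X$, that is, if $[\varphi_t',X]=X$. *)

(* Defs.v *)
From Stdlib Require Import Reals List.
From Coquelicot Require Import Coquelicot.
Open Scope R_scope.

(* Functions on the open unit disk D are represented by total functions C -> C;
   every notion below depends only on their values in D. *)
Definition disk (z : C) : Prop := Cmod z < 1.

Definition analytic_on_disk (f : C -> C) : Prop :=
  forall z : C, disk z ->
    ex_derive (K := C_AbsRing) (V := C_NormedModule) f z.

Definition compact_set (K : C -> Prop) : Prop :=
  forall (I : Type) (U : I -> C -> Prop),
    (forall i, open (U i)) ->
    (forall z, K z -> exists i, U i z) ->
    exists l : list I, forall z, K z -> exists i, In i l /\ U i z.

(* Only the values phi t z with 0 <= t and z in D are meaningful. *)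
Record analytic_semigroup (phi : R -> C -> C) : Prop := {
  semigroup_analytic : forall t, 0 <= t -> analytic_on_disk (phi t);
  semigroup_self_map : forall t z, 0 <= t -> disk z -> disk (phi t z);
  semigroup_id : forall z, disk z -> phi 0 z = z;
  semigroup_comp : forall t s z, 0 <= t -> 0 <= s -> disk z ->
    phi (t + s) z = phi t (phi s z);
  semigroup_cont : forall K : C -> Prop,
    compact_set K -> (forall z, K z -> disk z) ->
    forall eps : posreal, exists delta : posreal,
      forall t, 0 <= t < delta ->
      forall z, K z -> Cmod (phi t z - phi 0 z)%C < eps
}.

Definition nontrivial (phi : R -> C -> C) : Prop :=
  exists t z, 0 <= t /\ disk z /\ phi t z <> z.

(* x ^ q for x >= 0 and q > 0; Rpower alone would give Rpower 0 q = 1. *)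
Definition rpow (x q : R) : R :=
  if Req_EM_T x 0 then 0 else Rpower x q.

Definition circle_pt (r theta : R) : C := (r * cos theta, r * sin theta).

(* For f analytic in D the integrand is continuous, and the least upper bound
   in the case p = infinity is a maximum. The case m_infty is junk. *)
Definition Mp (p : Rbar) (r : R) (f : C -> C) : R :=
  match p with
  | Finite q =>
      rpow (RInt (fun theta => rpow (Cmod (f (circle_pt r theta))) q / (2 * PI))
                 0 (2 * PI))
           (/ q)
  | p_infty =>
      real (Lub_Rbar (fun y => exists theta, y = Cmod (f (circle_pt r theta))))
  | m_infty => 0
  end.

Definition Hnorm (p : Rbar) (alpha : R) (f : C -> C) : Rbar :=
  Lub_Rbar (fun y => exists r, 0 <= r < 1 /\
                       y = Rpower (1 - r) alpha * Mp p r f).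

Definition Hspace (p : Rbar) (alpha : R) (f : C -> C) : Prop :=
  analytic_on_disk f /\ Rbar_lt (Hnorm p alpha f) p_infty.

Definition wcomp (phi : R -> C -> C) (t : R) (f : C -> C) : C -> C :=
  fun z => (C_derive (phi t) z * f (phi t z))%C.

Definition bounded_op (p : Rbar) (alpha : R) (T : (C -> C) -> C -> C) : Prop :=
  (forall f, Hspace p alpha f -> Hspace p alpha (T f)) /\
  exists M : R, forall f, Hspace p alpha f ->
    real (Hnorm p alpha (T f)) <= M * real (Hnorm p alpha f).

Definition op_norm (p : Rbar) (alpha : R) (T : (C -> C) -> C -> C) : Rbar :=
  Lub_Rbar (fun y => exists f, Hspace p alpha f /\
                       Rbar_le (Hnorm p alpha f) 1 /\
                       y = real (Hnorm p alpha (T f))).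

(* The set [phi_t', H(p,infty,alpha)]. *)
Definition cont_subspace (phi : R -> C -> C) (p : Rbar) (alpha : R)
    (f : C -> C) : Prop :=
  Hspace p alpha f /\
  forall eps : posreal,
    at_right 0 (fun t =>
      Rbar_lt (Hnorm p alpha (fun z => (wcomp phi t f z - f z)%C)) eps).

Definition strongly_continuous (phi : R -> C -> C) (p : Rbar) (alpha : R)
    : Prop :=
  (forall t, 0 <= t -> bounded_op p alpha (wcomp phi t)) /\
  (forall f, Hspace p alpha f -> cont_subspace phi p alpha f).

Definition proper_subset (A B : (C -> C) -> Prop) : Prop :=
  (forall f, A f -> B f) /\ exists f, B f /\ ~ A f.

(* Main.v *)
Require Import Defs.
From Stdlib Require Import Reals Lra Lia Psatz ZArith List Classical IndefiniteDescription.
From Coquelicot Require Import Coquelicot.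
Open Scope R_scope.

(** The Taylor coefficient of index N of a function of norm 1 in H(p,infty,alpha)
    is O(N^alpha) for every p, so it suffices to disturb a coefficient.  For a
    self-map phi of the disk close to the identity, positivity of
    1 - Re (phi(z)/z) near the unit circle bounds all coefficients of phi - id by
    delta = |phi(0)| + |phi'(0) - 1|.  Taking N of order 1/delta, the expansion
    (z + d)^N = z^N + N z^(N-1) d + ... then shows that the coefficient of index N
    or N - 1 of phi^N - z^N is bounded below by an absolute constant.  As the
    phi_t that differ from the identity occur for arbitrarily small t, this
    happens for a sequence of t tending to 0, and a gliding hump along a lacunary
    series F with coefficients N^(alpha-1) yields f = F' in H(infty,infty,alpha)
    for which T_t f - f = (F o phi_t - F)' stays away from 0.  No Goursat theorem is
    needed: T_t 1 = phi_t' belongs to the space, hence phi_t is C^1. *)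

(** The choice of N balances two terms. The linear term N z^(N-1) d has coefficient N phi(0) at
    index N - 1 and N (phi'(0) - 1) at index N, and one of |phi(0)|, |phi'(0) - 1| is at least
    delta/2; so it has size N delta, while the remainder has size (N |d|)^2. As |d| = O(delta) on
    |z| = 1/2, a small fixed value of N delta makes the linear term win. A bound |d| = O(sqrt delta)
    would not do: the remainder would then be of order 1/delta. Passing to the primitive F turns the
    weighted composition into F o phi_t, whose coefficients are sums over the monomials of F. The
    obstacle is that every monomial contributes to the coefficient where the k-th hump is read.
    Earlier ones could cancel the hump, so each term of F gets a factor 0 or 1, chosen in turn.
    Later ones are small because phi_(t_k) maps the circle |z| = 1/2 into a disk of radius rho < 1
    that is known before the next exponent is chosen. All coefficients are read on |z| = 1/2. *)

(** * Complex derivatives in terms of the modulus *)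

(* Epsilon-delta form, free of the two different uniform structures on C. *)
Definition has_Cderiv (f : C -> C) (z l : C) : Prop :=
  forall eps, 0 < eps -> exists delta, 0 < delta /\
    forall h, Cmod h < delta -> Cmod (f (z + h) - f z - l * h)%C <= eps * Cmod h.

Lemma has_Cderiv_is_derive (f : C -> C) (z l : C) :
  has_Cderiv f z l <-> is_derive (K := C_AbsRing) (V := C_NormedModule) f z l.
Proof.
  split.
  - intros H. split.
    + apply @is_linear_scal_l.
    + intros x Hx. apply (is_filter_lim_locally_unique (V := AbsRing_NormedModule C_AbsRing)) in Hx. subst x.
      intros eps.
      destruct (H eps (cond_pos eps)) as [d [Hd Hf]].
      exists (mkposreal d Hd). intros y Hy.
      specialize (Hf (y - z)%C Hy).
      assert (E : forall a b : C, (a + (b - a))%C = b) by (intros; ring).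
      rewrite E in Hf.
      rewrite Cmult_comm in Hf. exact Hf.
  - intros [_ H] eps Heps.
    destruct (H z (fun P HP => HP) (mkposreal eps Heps)) as [d Hd].
    exists d. split. { apply cond_pos. }
    intros h Hh.
    assert (E : (z + h - z)%C = h) by ring.
    assert (B : ball (M := AbsRing_UniformSpace C_AbsRing) z d (z + h)%C).
    { change (Cmod (z + h - z)%C < d). rewrite E. exact Hh. }
    specialize (Hd _ B).
    change (Cmod (f (z + h)%C - f z - (z + h - z) * l)%C <= eps * Cmod (z + h - z)%C) in Hd.
    rewrite E in Hd. rewrite (Cmult_comm l h). exact Hd.
Qed.

Lemma has_Cderiv_C_derive (f : C -> C) (z l : C) :
  has_Cderiv f z l -> C_derive f z = l.
Proof.
  intros H. apply is_C_derive_unique. apply has_Cderiv_is_derive, H.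
Qed.

Lemma analytic_has_Cderiv (f : C -> C) :
  analytic_on_disk f <-> forall z, disk z -> exists l, has_Cderiv f z l.
Proof.
  split.
  - intros H z Hz. destruct (H z Hz) as [l Hl]. exists l. apply has_Cderiv_is_derive, Hl.
  - intros H z Hz. destruct (H z Hz) as [l Hl]. exists l. apply has_Cderiv_is_derive, Hl.
Qed.

Lemma analytic_C_derive (f : C -> C) (z : C) :
  analytic_on_disk f -> disk z -> has_Cderiv f z (C_derive f z).
Proof.
  intros H Hz. destruct (proj1 (analytic_has_Cderiv f) H z Hz) as [l Hl].
  rewrite (has_Cderiv_C_derive _ _ _ Hl). exact Hl.
Qed.

Lemma Cmod_le_abs (z : C) : Cmod z <= Rabs (Re z) + Rabs (Im z).
Proof.
  destruct z as [x y]. simpl.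
  replace (x, y) with (RtoC x + Ci * RtoC y)%C.
  - eapply Rle_trans. { apply Cmod_triangle. }
    rewrite Cmod_mult, Cmod_Ci, !Cmod_R. simpl. lra.
  - unfold Cplus, Cmult, RtoC, Ci; simpl. f_equal; ring.
Qed.

Lemma im_le_Cmod (z : C) : Rabs (Im z) <= Cmod z.
Proof.
  eapply Rle_trans. 2: apply Rmax_Cmod. apply Rmax_r.
Qed.

Lemma Cmod_minus_sym (a b : C) : Cmod (a - b)%C = Cmod (b - a)%C.
Proof. rewrite <- Cmod_opp. f_equal. ring. Qed.

Lemma Cmod_triangle_minus (a b : C) : Cmod a - Cmod b <= Cmod (a - b)%C.
Proof.
  assert (H := Cmod_triangle (a - b)%C b).
  replace (a - b + b)%C with a in H by ring. lra.
Qed.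

Lemma Cmod_minus_le (a b : C) : Cmod (a - b)%C <= Cmod a + Cmod b.
Proof. unfold Cminus. rewrite <- (Cmod_opp b). apply Cmod_triangle. Qed.

Lemma Cmod_reverse_triangle (a b : C) : Cmod a - Cmod b <= Cmod (a + b)%C.
Proof.
  assert (H := Cmod_minus_le (a + b)%C b).
  replace (a + b - b)%C with a in H by ring. lra.
Qed.

(** * Continuity of complex-valued functions *)

(** Componentwise, to match the real integrals and derivatives used below. The domain is a general
    uniform space because both R and R x R occur, the latter for integrals with a parameter. *)
Definition Ccontinuous {U : UniformSpace} (h : U -> C) (p : U) : Prop :=
  continuous (fun x => Re (h x)) p /\ continuous (fun x => Im (h x)) p.

Lemma Ccontinuous_eps {U : UniformSpace} (h : U -> C) (p : U) :
  Ccontinuous h p <->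
  forall eps, 0 < eps -> locally p (fun x => Cmod (h x - h p)%C < eps).
Proof.
  split.
  - intros [H1 H2] eps Heps.
    assert (He2 : 0 < eps / 2) by lra.
    assert (L1 := H1 _ (locally_ball (Re (h p)) (mkposreal _ He2))).
    assert (L2 := H2 _ (locally_ball (Im (h p)) (mkposreal _ He2))).
    unfold filtermap in L1, L2.
    generalize (filter_and _ _ L1 L2). apply filter_imp. intros x [B1 B2].
    change (Rabs (Re (h x) - Re (h p)) < eps / 2) in B1.
    change (Rabs (Im (h x) - Im (h p)) < eps / 2) in B2.
    eapply Rle_lt_trans. { apply Cmod_le_abs. }
    change (Rabs (Re (h x) - Re (h p)) + Rabs (Im (h x) - Im (h p)) < eps). lra.
  - intros H. split; apply filterlim_locally; intros eps;
      generalize (H eps (cond_pos eps)); apply filter_imp; intros x Hx.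
    + change (Rabs (Re (h x - h p)%C) < eps). eapply Rle_lt_trans; [apply re_le_Cmod|exact Hx].
    + change (Rabs (Im (h x - h p)%C) < eps). eapply Rle_lt_trans; [apply im_le_Cmod|exact Hx].
Qed.

Lemma Ccontinuous_const {U : UniformSpace} (c : C) (p : U) : Ccontinuous (fun _ => c) p.
Proof. split; apply continuous_const. Qed.

Lemma Ccontinuous_RtoC {U : UniformSpace} (x : U -> R) (p : U) :
  continuous x p -> Ccontinuous (fun q => RtoC (x q)) p.
Proof. intros H. split; simpl. { exact H. } apply continuous_const. Qed.

Lemma Ccontinuous_plus {U : UniformSpace} (h k : U -> C) (p : U) :
  Ccontinuous h p -> Ccontinuous k p -> Ccontinuous (fun x => (h x + k x)%C) p.
Proof.
  intros [H1 H2] [K1 K2]. split.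
  - exact (continuous_plus (V := R_NormedModule) _ _ _ H1 K1).
  - exact (continuous_plus (V := R_NormedModule) _ _ _ H2 K2).
Qed.

Lemma Ccontinuous_opp {U : UniformSpace} (h : U -> C) (p : U) :
  Ccontinuous h p -> Ccontinuous (fun x => (- h x)%C) p.
Proof.
  intros [H1 H2]. split.
  - exact (continuous_opp (V := R_NormedModule) _ _ H1).
  - exact (continuous_opp (V := R_NormedModule) _ _ H2).
Qed.

Lemma Ccontinuous_minus {U : UniformSpace} (h k : U -> C) (p : U) :
  Ccontinuous h p -> Ccontinuous k p -> Ccontinuous (fun x => (h x - k x)%C) p.
Proof. intros H K. apply Ccontinuous_plus, Ccontinuous_opp; assumption. Qed.

Lemma Ccontinuous_mult {U : UniformSpace} (h k : U -> C) (p : U) :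
  Ccontinuous h p -> Ccontinuous k p -> Ccontinuous (fun x => (h x * k x)%C) p.
Proof.
  intros [H1 H2] [K1 K2]. split.
  - apply (continuous_minus (V := R_NormedModule) (fun x => Re (h x) * Re (k x)) (fun x => Im (h x) * Im (k x)));
      apply (continuous_mult (K := R_AbsRing)); assumption.
  - apply (continuous_plus (V := R_NormedModule) (fun x => Re (h x) * Im (k x)) (fun x => Im (h x) * Re (k x)));
      apply (continuous_mult (K := R_AbsRing)); assumption.
Qed.

Lemma Ccontinuous_pow {U : UniformSpace} (h : U -> C) (n : nat) (p : U) :
  Ccontinuous h p -> Ccontinuous (fun x => (h x ^ n)%C) p.
Proof.
  intros H. induction n as [|n IH].
  - apply (Ccontinuous_const 1%C).
  - apply (Ccontinuous_mult h (fun x => (h x ^ n)%C)); assumption.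
Qed.

Lemma Ccontinuous_conj {U : UniformSpace} (h : U -> C) (p : U) :
  Ccontinuous h p -> Ccontinuous (fun x => Cconj (h x)) p.
Proof.
  intros [H1 H2]. split. { exact H1. }
  exact (continuous_opp (V := R_NormedModule) _ _ H2).
Qed.

Lemma Ccontinuous_inv {U : UniformSpace} (h : U -> C) (p : U) :
  h p <> 0%C -> Ccontinuous h p -> Ccontinuous (fun x => / h x)%C p.
Proof.
  intros N [H1 H2].
  assert (Cm : continuous (fun x => / (Re (h x) ^ 2 + Im (h x) ^ 2)) p).
  { apply (continuous_comp (fun x => Re (h x) ^ 2 + Im (h x) ^ 2) Rinv).
    - apply (continuous_plus (V := R_NormedModule) (fun x => Re (h x) ^ 2) (fun x => Im (h x) ^ 2));
        [apply (continuous_comp (fun x => Re (h x)) (fun y => y ^ 2))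
        |apply (continuous_comp (fun x => Im (h x)) (fun y => y ^ 2))];
        try assumption; apply (ex_derive_continuous (K := R_AbsRing) (V := R_NormedModule));
        auto_derive; trivial.
    - apply continuous_Rinv. rewrite <- Cmod2_alt. apply pow_nonzero, Rgt_not_eq, Cmod_gt_0, N. }
  split.
  - apply (continuous_mult (K := R_AbsRing) (fun x => Re (h x)) (fun x => / (Re (h x) ^ 2 + Im (h x) ^ 2)));
      assumption.
  - apply (continuous_mult (K := R_AbsRing) (fun x => - Im (h x)) (fun x => / (Re (h x) ^ 2 + Im (h x) ^ 2)));
      [apply (continuous_opp (V := R_NormedModule))|]; assumption.
Qed.

Lemma continuous_Cmod {U : UniformSpace} (h : U -> C) (p : U) :
  Ccontinuous h p -> continuous (fun x => Cmod (h x)) p.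
Proof.
  intros H. rewrite Ccontinuous_eps in H. apply filterlim_locally. intros eps.
  generalize (H eps (cond_pos eps)); apply filter_imp; intros x Hx.
  change (Rabs (Cmod (h x) - Cmod (h p)) < eps).
  assert (A1 := Cmod_triangle_minus (h x) (h p)).
  assert (A2 := Cmod_triangle_minus (h p) (h x)).
  rewrite Cmod_minus_sym in A2.
  apply Rabs_def1; lra.
Qed.

Definition Ccontinuous_at (f : C -> C) (z : C) : Prop :=
  forall eps, 0 < eps -> exists delta, 0 < delta /\
    forall w, Cmod (w - z)%C < delta -> Cmod (f w - f z)%C < eps.

Lemma Ccontinuous_comp {U : UniformSpace} (f : C -> C) (h : U -> C) (p : U) :
  Ccontinuous_at f (h p) -> Ccontinuous h p -> Ccontinuous (fun x => f (h x)) p.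
Proof.
  intros Hf Hh. rewrite Ccontinuous_eps in Hh |- *. intros eps Heps.
  destruct (Hf eps Heps) as [d [Hd H]].
  generalize (Hh d Hd). apply filter_imp. intros x. apply H.
Qed.

Lemma has_Cderiv_continuous (f : C -> C) (z l : C) :
  has_Cderiv f z l -> Ccontinuous_at f z.
Proof.
  intros H eps Heps. destruct (H 1 Rlt_0_1) as [d [Hd Hf]].
  assert (L := Cmod_ge_0 l).
  exists (Rmin d (eps / (2 + Cmod l))). split.
  { apply Rmin_glb_lt; [exact Hd|]. apply Rdiv_lt_0_compat; lra. }
  intros w Hw.
  assert (H1 := Rlt_le_trans _ _ _ Hw (Rmin_l _ _)).
  assert (H2 := Rlt_le_trans _ _ _ Hw (Rmin_r _ _)).
  specialize (Hf _ H1).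
  replace (z + (w - z))%C with w in Hf by ring.
  replace (f w - f z)%C with ((f w - f z - l * (w - z)) + l * (w - z))%C by ring.
  eapply Rle_lt_trans. { apply Cmod_triangle. }
  rewrite Cmod_mult.
  apply Rle_lt_trans with ((1 + Cmod l) * Cmod (w - z)%C). { lra. }
  apply Rle_lt_trans with ((1 + Cmod l) * (eps / (2 + Cmod l))).
  { apply Rmult_le_compat_l; lra. }
  apply Rmult_lt_reg_r with (2 + Cmod l). { lra. }
  field_simplify; nra.
Qed.

Lemma analytic_continuous (f : C -> C) (z : C) :
  analytic_on_disk f -> disk z -> Ccontinuous_at f z.
Proof.
  intros H Hz. eapply has_Cderiv_continuous, analytic_C_derive; assumption.
Qed.

(** * Derivatives of curves *)

Definition has_Rderiv (h : R -> C) (t : R) (l : C) : Prop :=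
  is_derive (fun s => Re (h s)) t (Re l) /\ is_derive (fun s => Im (h s)) t (Im l).

Lemma is_derive_eps (f : R -> R) (t l : R) :
  is_derive f t l <-> forall eps, 0 < eps -> exists delta, 0 < delta /\
    forall s, Rabs s < delta -> Rabs (f (t + s) - f t - l * s) <= eps * Rabs s.
Proof.
  split.
  - intros [_ H] eps Heps.
    destruct (H t (fun P HP => HP) (mkposreal eps Heps)) as [d Hd].
    exists d. split. { apply cond_pos. }
    intros s Hs.
    assert (B : ball t d (t + s)).
    { change (Rabs (t + s - t) < d). replace (t + s - t) with s by ring. exact Hs. }
    specialize (Hd _ B).
    change (Rabs (f (t + s) - f t - (t + s - t) * l) <= eps * Rabs (t + s - t)) in Hd.
    replace (t + s - t) with s in Hd by ring. rewrite (Rmult_comm l). exact Hd.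
  - intros H. split.
    + apply @is_linear_scal_l.
    + intros x Hx. apply (is_filter_lim_locally_unique (V := R_NormedModule)) in Hx. subst x.
      intros eps. destruct (H eps (cond_pos eps)) as [d [Hd Hf]].
      exists (mkposreal d Hd). intros y Hy.
      specialize (Hf (y - t) Hy).
      assert (E : forall a b : R, a + (b - a) = b) by (intros; ring).
      rewrite E in Hf.
      rewrite Rmult_comm in Hf. exact Hf.
Qed.

Lemma has_Rderiv_eps (h : R -> C) (t : R) (l : C) :
  has_Rderiv h t l <-> forall eps, 0 < eps -> exists delta, 0 < delta /\
    forall s, Rabs s < delta -> Cmod (h (t + s)%R - h t - l * RtoC s)%C <= eps * Rabs s.
Proof.
  unfold has_Rderiv. rewrite !is_derive_eps. split.
  - intros [H1 H2] eps Heps.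
    assert (He : 0 < eps / 2) by lra.
    destruct (H1 _ He) as [d1 [P1 Q1]]. destruct (H2 _ He) as [d2 [P2 Q2]].
    exists (Rmin d1 d2). split. { apply Rmin_glb_lt; assumption. }
    intros s Hs.
    specialize (Q1 s (Rlt_le_trans _ _ _ Hs (Rmin_l _ _))).
    specialize (Q2 s (Rlt_le_trans _ _ _ Hs (Rmin_r _ _))).
    eapply Rle_trans. { apply Cmod_le_abs. }
    destruct l as [l1 l2]. simpl in Q1, Q2 |- *. unfold Re, Im in *.
    replace (fst (h (t + s)%R) + - fst (h t) + - (l1 * s - l2 * 0)) with
      (fst (h (t + s)%R) - fst (h t) - l1 * s) by ring.
    replace (snd (h (t + s)%R) + - snd (h t) + - (l1 * 0 + l2 * s)) with
      (snd (h (t + s)%R) - snd (h t) - l2 * s) by ring.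
    lra.
  - intros H. split; intros eps Heps; destruct (H eps Heps) as [d [Hd Q]];
      exists d; (split; [exact Hd|]); intros s Hs; specialize (Q s Hs);
      (eapply Rle_trans; [|exact Q]).
    + eapply Rle_trans; [|apply re_le_Cmod]. apply Req_le. f_equal.
      destruct l as [l1 l2]. simpl. unfold Re. ring.
    + eapply Rle_trans; [|apply im_le_Cmod]. apply Req_le. f_equal.
      destruct l as [l1 l2]. simpl. unfold Im. ring.
Qed.

Lemma has_Rderiv_const (c : C) (t : R) : has_Rderiv (fun _ => c) t 0%C.
Proof. split; simpl; apply (is_derive_const (K := R_AbsRing) (V := R_NormedModule)). Qed.

Lemma has_Rderiv_plus (h k : R -> C) (t : R) (l m : C) :
  has_Rderiv h t l -> has_Rderiv k t m -> has_Rderiv (fun s => (h s + k s)%C) t (l + m)%C.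
Proof.
  intros [H1 H2] [K1 K2]. split.
  - exact (is_derive_plus (V := R_NormedModule) _ _ _ _ _ H1 K1).
  - exact (is_derive_plus (V := R_NormedModule) _ _ _ _ _ H2 K2).
Qed.

Lemma has_Rderiv_mult (h k : R -> C) (t : R) (l m : C) :
  has_Rderiv h t l -> has_Rderiv k t m ->
  has_Rderiv (fun s => (h s * k s)%C) t (l * k t + h t * m)%C.
Proof.
  intros [H1 H2] [K1 K2].
  assert (M : forall (a b : R -> R) a' b', is_derive a t a' -> is_derive b t b' ->
    is_derive (fun s => a s * b s) t (a' * b t + a t * b')).
  { intros a b a' b' A B.
    exact (is_derive_mult (K := R_AbsRing) a b t a' b' A B Rmult_comm). }
  split.
  - evar_last.
    + exact (is_derive_minus (V := R_NormedModule) _ _ _ _ _ (M _ _ _ _ H1 K1) (M _ _ _ _ H2 K2)).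
    + unfold Re, Im, minus, plus, opp; simpl; unfold Re, Im. ring.
  - evar_last.
    + exact (is_derive_plus (V := R_NormedModule) _ _ _ _ _ (M _ _ _ _ H1 K2) (M _ _ _ _ H2 K1)).
    + unfold Re, Im, plus; simpl; unfold Re, Im. ring.
Qed.

Lemma has_Rderiv_comp (f : C -> C) (h : R -> C) (t : R) (l m : C) :
  has_Cderiv f (h t) l -> has_Rderiv h t m ->
  has_Rderiv (fun s => f (h s)) t (l * m)%C.
Proof.
  intros Hf Hh. rewrite has_Rderiv_eps in Hh |- *. intros eps Heps.
  assert (Lm := Cmod_ge_0 m). assert (Ll := Cmod_ge_0 l).
  (* The error of [f] uses one half of [eps], through e1 (1 + |m|) = eps/2, and that of [h] the
     other half, through |l| e2 <= eps/2. The cap e2 <= 1 gives |dh| <= (1 + |m|) |s|. *)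
  set (e1 := eps / (2 * (1 + Cmod m))).
  set (e2 := Rmin 1 (eps / (2 * (1 + Cmod l)))).
  assert (P1 : 0 < e1) by (apply Rdiv_lt_0_compat; lra).
  assert (P2 : 0 < e2).
  { apply Rmin_glb_lt; [lra|]. apply Rdiv_lt_0_compat; lra. }
  destruct (Hf e1 P1) as [d1 [D1 F]]. destruct (Hh e2 P2) as [d2 [D2 G]].
  exists (Rmin d2 (d1 / (1 + Cmod m))). split.
  { apply Rmin_glb_lt; [exact D2|]. apply Rdiv_lt_0_compat; lra. }
  intros s Hs.
  assert (S1 := Rlt_le_trans _ _ _ Hs (Rmin_l _ _)).
  assert (S2 := Rlt_le_trans _ _ _ Hs (Rmin_r _ _)).
  specialize (G s S1).
  assert (As := Rabs_pos s).
  set (dh := (h (t + s)%R - h t)%C) in *.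
  assert (E21 : e2 <= 1) by apply Rmin_l.
  assert (E22 : (1 + Cmod l) * e2 <= eps / 2).
  { apply Rle_trans with ((1 + Cmod l) * (eps / (2 * (1 + Cmod l)))).
    - apply Rmult_le_compat_l; [lra|apply Rmin_r].
    - apply Req_le. field. lra. }
  assert (E1 : e1 * (1 + Cmod m) = eps / 2) by (unfold e1; field; lra).
  assert (B : Cmod dh <= (1 + Cmod m) * Rabs s).
  { replace dh with ((dh - m * RtoC s) + m * RtoC s)%C by ring.
    eapply Rle_trans. { apply Cmod_triangle. }
    rewrite Cmod_mult, Cmod_R. nra. }
  assert (B1 : Cmod dh < d1).
  { eapply Rle_lt_trans; [exact B|].
    apply Rmult_lt_reg_r with (/ (1 + Cmod m)). { apply Rinv_0_lt_compat; lra. }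
    replace ((1 + Cmod m) * Rabs s * / (1 + Cmod m)) with (Rabs s) by (field; lra).
    exact S2. }
  specialize (F dh B1).
  replace (h t + dh)%C with (h (t + s)%R) in F by (unfold dh; ring).
  replace (f (h (t + s)%R) - f (h t) - l * m * RtoC s)%C with
    ((f (h (t + s)%R) - f (h t) - l * dh) + l * (dh - m * RtoC s))%C by ring.
  eapply Rle_trans. { apply Cmod_triangle. }
  rewrite Cmod_mult.
  assert (Cmod l * Cmod (dh - m * RtoC s)%C <= Cmod l * (e2 * Rabs s)).
  { apply Rmult_le_compat_l; assumption. }
  assert (e1 * Cmod dh <= e1 * ((1 + Cmod m) * Rabs s)).
  { apply Rmult_le_compat_l; [lra|assumption]. }
  nra.
Qed.

(** * Integrals over circles *)

Definition expi (x : R) : C := (cos x, sin x).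

Lemma expi_0 : expi 0 = 1%C.
Proof. unfold expi. rewrite cos_0, sin_0. reflexivity. Qed.

Lemma expi_plus (x y : R) : expi (x + y) = (expi x * expi y)%C.
Proof.
  unfold expi, Cmult; simpl. rewrite cos_plus, sin_plus. f_equal; ring.
Qed.

Lemma expi_opp (x : R) : expi (- x) = Cconj (expi x).
Proof. unfold expi, Cconj; simpl. rewrite cos_neg, sin_neg. reflexivity. Qed.

Lemma Cmod_expi (x : R) : Cmod (expi x) = 1.
Proof.
  unfold Cmod, expi; simpl.
  replace (cos x * (cos x * 1) + sin x * (sin x * 1)) with 1.
  - apply sqrt_1.
  - generalize (sin2_cos2 x). unfold Rsqr. lra.
Qed.

Lemma expi_pow (x : R) (n : nat) : (expi x ^ n)%C = expi (INR n * x).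
Proof.
  induction n as [|n IH].
  - simpl. rewrite Rmult_0_l, expi_0. reflexivity.
  - rewrite S_INR, Rmult_plus_distr_r, Rmult_1_l, Rplus_comm, expi_plus, <- IH. reflexivity.
Qed.

Lemma expi_2PI (n : nat) : expi (INR n * (2 * PI)) = 1%C.
Proof.
  rewrite <- expi_pow.
  replace (expi (2 * PI)) with (RtoC 1).
  - apply Cpow_1_l.
  - unfold expi. rewrite cos_2PI, sin_2PI. reflexivity.
Qed.

Lemma expi_inv (x : R) : (expi x * expi (- x))%C = 1%C.
Proof. rewrite <- expi_plus. replace (x + - x) with 0 by ring. apply expi_0. Qed.

Lemma circle_pt_expi (r x : R) : circle_pt r x = (RtoC r * expi x)%C.
Proof. unfold circle_pt, expi, Cmult, RtoC; simpl. f_equal; ring. Qed.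

Lemma Cmod_circle_pt (r x : R) : 0 <= r -> Cmod (circle_pt r x) = r.
Proof.
  intros Hr. rewrite circle_pt_expi, Cmod_mult, Cmod_expi, Cmod_R, Rabs_pos_eq by exact Hr. ring.
Qed.

Lemma disk_circle_pt (r x : R) : 0 <= r < 1 -> disk (circle_pt r x).
Proof. intros Hr. unfold disk. rewrite Cmod_circle_pt; lra. Qed.

Lemma Ccontinuous_expi {U : UniformSpace} (x : U -> R) (p : U) :
  continuous x p -> Ccontinuous (fun q => expi (x q)) p.
Proof.
  intros H. split; simpl.
  - apply (continuous_comp x cos); [exact H|apply continuous_cos].
  - apply (continuous_comp x sin); [exact H|apply continuous_sin].
Qed.

Lemma has_Rderiv_expi (k t : R) :
  has_Rderiv (fun s => expi (k * s)) t (Ci * RtoC k * expi (k * t))%C.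
Proof. split; simpl; auto_derive; trivial; unfold Re, Im; simpl; ring. Qed.

Definition Ccts (h : R -> C) : Prop := forall t : R, Ccontinuous h t.

Lemma Ccts_expi (k : R) : Ccts (fun t => expi (k * t)).
Proof.
  intros t. apply (Ccontinuous_expi (fun t => k * t)).
  apply (continuous_mult (K := R_AbsRing) (fun _ => k) (fun t => t)).
  - apply continuous_const.
  - apply continuous_id.
Qed.

Lemma Ccts_circle_pt (r : R) : Ccts (circle_pt r).
Proof.
  intros t.
  assert (H := Ccontinuous_mult _ _ t (Ccontinuous_const (RtoC r) t) (Ccts_expi 1 t)).
  destruct H as [H1 H2]; split;
    [generalize H1|generalize H2]; apply continuous_ext; intros x;
    rewrite circle_pt_expi, Rmult_1_l; reflexivity.
Qed.

Definition CInt (h : R -> C) : C :=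
  (RInt (fun t => Re (h t)) 0 (2 * PI), RInt (fun t => Im (h t)) 0 (2 * PI)).

Lemma two_PI_pos : 0 < 2 * PI.
Proof. assert (H := PI_RGT_0). lra. Qed.

Lemma ex_RInt_cts (f : R -> R) (a b : R) :
  (forall t, continuous f t) -> ex_RInt f a b.
Proof.
  intros H. apply (ex_RInt_continuous (V := R_CompleteNormedModule)). intros; apply H.
Qed.

Lemma ex_RInt_Re (h : R -> C) (a b : R) : Ccts h -> ex_RInt (fun t => Re (h t)) a b.
Proof. intros H. apply ex_RInt_cts. intros t. apply (H t). Qed.

Lemma ex_RInt_Im (h : R -> C) (a b : R) : Ccts h -> ex_RInt (fun t => Im (h t)) a b.
Proof. intros H. apply ex_RInt_cts. intros t. apply (H t). Qed.

Lemma CInt_ext (h k : R -> C) : (forall t, h t = k t) -> CInt h = CInt k.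
Proof.
  intros H. unfold CInt. f_equal; apply RInt_ext; intros t _; rewrite H; reflexivity.
Qed.

Lemma CInt_plus (h k : R -> C) : Ccts h -> Ccts k ->
  CInt (fun t => h t + k t)%C = (CInt h + CInt k)%C.
Proof.
  intros H K. unfold CInt, Cplus; simpl. f_equal.
  - apply (RInt_plus (V := R_CompleteNormedModule) (fun t => Re (h t)) (fun t => Re (k t)));
      apply ex_RInt_Re; assumption.
  - apply (RInt_plus (V := R_CompleteNormedModule) (fun t => Im (h t)) (fun t => Im (k t)));
      apply ex_RInt_Im; assumption.
Qed.

Lemma CInt_scal (c : C) (h : R -> C) : Ccts h ->
  CInt (fun t => c * h t)%C = (c * CInt h)%C.
Proof.
  intros H. destruct c as [a b]. unfold CInt, Cmult, Re, Im; simpl.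
  assert (S : forall u (f : R -> R), ex_RInt f 0 (2 * PI) ->
     ex_RInt (fun t => u * f t) 0 (2 * PI) /\
     RInt (fun t => u * f t) 0 (2 * PI) = u * RInt f 0 (2 * PI)).
  { intros u f Hf. split.
    - apply (ex_RInt_scal (V := R_NormedModule)). exact Hf.
    - apply (RInt_scal (V := R_CompleteNormedModule)). exact Hf. }
  assert (HR := ex_RInt_Re h 0 (2 * PI) H). assert (HI := ex_RInt_Im h 0 (2 * PI) H).
  unfold Re, Im in HR, HI. f_equal.
  - rewrite (RInt_minus (V := R_CompleteNormedModule) (fun t => a * fst (h t)) (fun t => b * snd (h t))).
    + unfold minus, plus, opp; simpl. rewrite (proj2 (S a _ HR)), (proj2 (S b _ HI)). ring.
    + apply S, HR.
    + apply S, HI.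
  - rewrite (RInt_plus (V := R_CompleteNormedModule) (fun t => a * snd (h t)) (fun t => b * fst (h t))).
    + unfold plus; simpl. rewrite (proj2 (S a _ HI)), (proj2 (S b _ HR)). ring.
    + apply S, HI.
    + apply S, HR.
Qed.

Lemma CInt_minus (h k : R -> C) : Ccts h -> Ccts k ->
  CInt (fun t => h t - k t)%C = (CInt h - CInt k)%C.
Proof.
  intros H K.
  rewrite (CInt_ext _ (fun t => h t + (- (1)) * k t)%C) by (intros; ring).
  rewrite (CInt_plus h (fun t => (- (1)) * k t)%C), CInt_scal.
  - ring.
  - exact K.
  - exact H.
  - intros t. apply Ccontinuous_mult; [apply Ccontinuous_const|apply K].
Qed.

Lemma CInt_const (c : C) : CInt (fun _ => c) = (RtoC (2 * PI) * c)%C.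
Proof.
  unfold CInt. rewrite !RInt_const. destruct c as [a b].
  unfold Cmult, RtoC, scal; simpl. unfold mult; simpl. f_equal; ring.
Qed.

Lemma CInt_conj (h : R -> C) : Ccts h -> CInt (fun t => Cconj (h t)) = Cconj (CInt h).
Proof.
  intros H. unfold CInt, Cconj; simpl. f_equal.
  apply (RInt_opp (V := R_CompleteNormedModule)). apply ex_RInt_Im, H.
Qed.

Lemma Cmod_CInt (h : R -> C) : Ccts h ->
  Cmod (CInt h) <= RInt (fun t => Cmod (h t)) 0 (2 * PI).
Proof.
  intros H. assert (P := two_PI_pos).
  assert (HM : forall t, continuous (fun t => Cmod (h t)) t).
  { intros t. apply continuous_Cmod, H. }
  set (I := CInt h).
  destruct (Req_dec (Cmod I) 0) as [Z|NZ].
  - rewrite Z. apply RInt_ge_0; [lra| apply ex_RInt_cts, HM |]. intros; apply Cmod_ge_0.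
  - assert (M0 := Cmod_ge_0 I).
    (* The unimodular factor [c] rotates the integral onto its modulus, which then is the integral
       of a real part. *)
    set (c := (Cconj I / RtoC (Cmod I))%C).
    assert (NZ' : RtoC (Cmod I) <> 0%C).
    { intros E. apply NZ. exact (f_equal fst E). }
    assert (Ec : Cmod c = 1).
    { unfold c. rewrite Cmod_div by exact NZ'. rewrite Cmod_conj, Cmod_R, Rabs_pos_eq by exact M0. field. exact NZ. }
    assert (E : (c * I)%C = RtoC (Cmod I)).
    { unfold c. transitivity ((I * Cconj I) / RtoC (Cmod I))%C. { field. exact NZ'. }
      rewrite <- Cmod2_conj, ?RtoC_pow. field. exact NZ'. }
    assert (Hc : Ccts (fun t => c * h t)%C).
    { intros t. apply Ccontinuous_mult; [apply Ccontinuous_const|apply H]. }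
    assert (E2 : Cmod I = RInt (fun t => Re (c * h t)%C) 0 (2 * PI)).
    { change (Cmod I = Re (CInt (fun t => c * h t)%C)). rewrite CInt_scal by exact H.
      fold I. rewrite E. reflexivity. }
    rewrite E2. apply RInt_le; [lra|apply (ex_RInt_Re _ _ _ Hc)|apply ex_RInt_cts, HM|].
    intros t _. eapply Rle_trans; [apply Rle_abs|]. eapply Rle_trans; [apply re_le_Cmod|].
    rewrite Cmod_mult, Ec. lra.
Qed.

Lemma Cmod_CInt_bound (h : R -> C) (B : R) : Ccts h ->
  (forall t, Cmod (h t) <= B) -> Cmod (CInt h) <= 2 * PI * B.
Proof.
  intros H HB. assert (P := two_PI_pos).
  eapply Rle_trans. { apply Cmod_CInt, H. }
  replace (2 * PI * B) with (RInt (fun _ => B) 0 (2 * PI)).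
  - apply RInt_le; [lra| | |].
    + apply ex_RInt_cts. intros t. apply continuous_Cmod, H.
    + apply ex_RInt_const.
    + intros; apply HB.
  - rewrite RInt_const. unfold scal; simpl. unfold mult; simpl. ring.
Qed.

Lemma CInt_deriv (h dh : R -> C) :
  (forall t, has_Rderiv h t (dh t)) -> Ccts dh -> h (2 * PI) = h 0 -> CInt dh = 0%C.
Proof.
  intros Hd Hc E. unfold CInt.
  assert (A : forall f df : R -> R, (forall t, is_derive f t (df t)) ->
    (forall t, continuous df t) -> f (2 * PI) = f 0 -> RInt df 0 (2 * PI) = 0).
  { intros f df D Cn Ef. apply is_RInt_unique.
    replace 0 with (minus (f (2 * PI)) (f 0)) at 2.
    - apply (is_RInt_derive (V := R_CompleteNormedModule)); intros; [apply D|apply Cn].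
    - unfold minus, plus, opp; simpl. rewrite Ef. ring. }
  unfold RtoC. f_equal.
  - apply (A (fun t => Re (h t))); [intros; apply Hd|intros; apply Hc|rewrite E; reflexivity].
  - apply (A (fun t => Im (h t))); [intros; apply Hd|intros; apply Hc|rewrite E; reflexivity].
Qed.

(** Differentiation under the integral sign, reduced to the real theorem for each component. *)
Lemma CInt_param (h dh : R -> R -> C) (x eps : R) :
  0 < eps ->
  (forall y, Rabs (y - x) < eps -> forall t, has_Rderiv (fun y => h y t) y (dh y t)) ->
  (forall t, Ccontinuous (U := prod_UniformSpace R_UniformSpace R_UniformSpace)
     (fun p => dh (fst p) (snd p)) (x, t)) ->
  (forall y, Rabs (y - x) < eps -> Ccts (h y)) ->
  has_Rderiv (fun y => CInt (h y)) x (CInt (dh x)).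
Proof.
  intros Heps Hd Hc Hh.
  assert (A : forall f df : R -> R -> R,
    (forall y, Rabs (y - x) < eps -> forall t, is_derive (fun y => f y t) y (df y t)) ->
    (forall t, continuous (T := prod_UniformSpace R_UniformSpace R_UniformSpace)
      (fun p => df (fst p) (snd p)) (x, t)) ->
    (forall y, Rabs (y - x) < eps -> forall t, continuous (f y) t) ->
    is_derive (fun y => RInt (f y) 0 (2 * PI)) x (RInt (df x) 0 (2 * PI))).
  { intros f df D Cn Cf.
    assert (x_in : Rabs (x - x) < eps) by (rewrite Rminus_diag, Rabs_R0; exact Heps).
    rewrite <- (RInt_ext (fun t => Derive (fun u => f u t) x)).
    - apply is_derive_RInt_param.
      + exists (mkposreal eps Heps). intros y Hy t _. exists (df y t). apply D. exact Hy.
      + intros t _.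
        apply continuity_2d_pt_ext_loc with (f := df).
        * exists (mkposreal eps Heps). intros u v Hu Hv. symmetry. apply is_derive_unique, D, Hu.
        * apply continuity_2d_pt_filterlim. apply (Cn t).
      + exists (mkposreal eps Heps). intros y Hy. apply ex_RInt_cts, Cf. exact Hy.
    - intros t _. apply is_derive_unique, D, x_in. }
  split.
  - apply (A (fun y t => Re (h y t)) (fun y t => Re (dh y t))).
    + intros; apply Hd; assumption.
    + intros t; apply Hc.
    + intros y Hy t; apply (Hh y Hy t).
  - apply (A (fun y t => Im (h y t)) (fun y t => Im (dh y t))).
    + intros; apply Hd; assumption.
    + intros t; apply Hc.
    + intros y Hy t; apply (Hh y Hy t).
Qed.

Lemma has_Rderiv_zero_eq (h : R -> C) (a b : R) : a < b ->
  (forall t, a <= t <= b -> has_Rderiv h t 0%C) -> h a = h b.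
Proof.
  intros Hab H. 
  assert (E1 : Re (h a) = Re (h b)).
  { apply (eq_is_derive (V := R_NormedModule) (fun t => Re (h t))); [|exact Hab]. intros t Ht. apply (H t Ht). }
  assert (E2 : Im (h a) = Im (h b)).
  { apply (eq_is_derive (V := R_NormedModule) (fun t => Im (h t))); [|exact Hab]. intros t Ht. apply (H t Ht). }
  destruct (h a), (h b). unfold Re, Im in *. simpl in *. congruence.
Qed.

Lemma Ccts_const (c : C) : Ccts (fun _ => c).
Proof. intros t. apply Ccontinuous_const. Qed.

Lemma Ccts_plus (h k : R -> C) : Ccts h -> Ccts k -> Ccts (fun t => h t + k t)%C.
Proof. intros H K t. apply Ccontinuous_plus; [apply H|apply K]. Qed.

Lemma Ccts_minus (h k : R -> C) : Ccts h -> Ccts k -> Ccts (fun t => h t - k t)%C.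
Proof. intros H K t. apply Ccontinuous_minus; [apply H|apply K]. Qed.

Lemma Ccts_mult (h k : R -> C) : Ccts h -> Ccts k -> Ccts (fun t => h t * k t)%C.
Proof. intros H K t. apply Ccontinuous_mult; [apply H|apply K]. Qed.

Lemma Ccts_pow (h : R -> C) (n : nat) : Ccts h -> Ccts (fun t => h t ^ n)%C.
Proof. intros H t. apply Ccontinuous_pow, H. Qed.

Lemma Ccts_conj (h : R -> C) : Ccts h -> Ccts (fun t => Cconj (h t)).
Proof. intros H t. apply Ccontinuous_conj, H. Qed.

Lemma Ccts_ext (h k : R -> C) : (forall t, h t = k t) -> Ccts h -> Ccts k.
Proof.
  intros E H t. destruct (H t) as [H1 H2].
  split; [generalize H1|generalize H2]; apply continuous_ext; intros x; rewrite E; reflexivity.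
Qed.

(** * Cauchy's integral formula for continuously differentiable functions *)

Definition continuous_on_disk (f : C -> C) : Prop := forall z, disk z -> Ccontinuous_at f z.

Lemma Ccts_circle (f : C -> C) (r : R) : continuous_on_disk f -> 0 <= r < 1 ->
  Ccts (fun t => f (circle_pt r t)).
Proof.
  intros H Hr t. apply Ccontinuous_comp.
  - apply H, disk_circle_pt, Hr.
  - apply Ccts_circle_pt.
Qed.

Definition C1_disk (f f' : C -> C) : Prop :=
  forall z, disk z -> has_Cderiv f z (f' z) /\ Ccontinuous_at f' z.

Lemma C1_disk_continuous (f f' : C -> C) : C1_disk f f' -> continuous_on_disk f.
Proof. intros H z Hz. eapply has_Cderiv_continuous, H, Hz. Qed.

Lemma C1_disk_continuous' (f f' : C -> C) : C1_disk f f' -> continuous_on_disk f'.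
Proof. intros H z Hz. apply H, Hz. Qed.

Lemma has_Rderiv_ext (h k : R -> C) (t : R) (l : C) :
  (forall s, h s = k s) -> has_Rderiv h t l -> has_Rderiv k t l.
Proof.
  intros E [H1 H2]. split; [generalize H1|generalize H2]; apply is_derive_ext;
    intros s; rewrite E; reflexivity.
Qed.

Lemma has_Rderiv_eq (h : R -> C) (t : R) (l m : C) :
  has_Rderiv h t l -> l = m -> has_Rderiv h t m.
Proof. intros H <-. exact H. Qed.

Lemma has_Rderiv_RtoC (x : R -> R) (t l : R) :
  is_derive x t l -> has_Rderiv (fun s => RtoC (x s)) t (RtoC l).
Proof.
  intros H. split; simpl. { exact H. }
  apply (is_derive_const (K := R_AbsRing) (V := R_NormedModule)).
Qed.

Lemma has_Rderiv_circle_pt (r t : R) :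
  has_Rderiv (circle_pt r) t (Ci * circle_pt r t)%C.
Proof.
  split; unfold circle_pt; simpl; auto_derive; trivial; ring.
Qed.

Lemma is_derive_id_R (s : R) : is_derive (fun x : R => x) s 1.
Proof. apply (is_derive_id (K := R_AbsRing)). Qed.

Lemma segment_in_disk (z w : C) (s : R) :
  Rabs (1 - s) * Cmod z + Rabs s * Cmod w < 1 -> disk (z + RtoC s * (w - z))%C.
Proof.
  intros H. unfold disk.
  replace (z + RtoC s * (w - z))%C with (RtoC (1 - s) * z + RtoC s * w)%C.
  - eapply Rle_lt_trans. { apply Cmod_triangle. } rewrite !Cmod_mult, !Cmod_R. exact H.
  - rewrite RtoC_minus. ring.
Qed.

(** Serves two homotopies: the contraction of a circle to [z] in Cauchy's formula, and the dilation
    of the unit circle about 0, for which r = 1 must be allowed. The condition on [s] is open, so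
    that a two-sided derivative exists also at the ends s = 0 and s = 1. *)
Lemma homotopy_deriv (f f' : C -> C) (k : R -> C) (z : C) (r s : R) :
  C1_disk f f' -> disk z -> 0 <= r <= 1 -> Ccts k ->
  Rabs (1 - s) * Cmod z + Rabs s * r < 1 ->
  has_Rderiv (fun s => CInt (fun t => f (z + RtoC s * (circle_pt r t - z)) * k t)%C) s
    (CInt (fun t => f' (z + RtoC s * (circle_pt r t - z)) * (circle_pt r t - z) * k t)%C).
Proof.
  intros Hf Hz Hr Hk Hs. unfold disk in Hz.
  assert (Z0 := Cmod_ge_0 z).
  set (A := Rabs (1 - s) * Cmod z + Rabs s * r) in *.
  (* Moving the parameter by e raises the bound [A] by at most e (|z| + r) <= 2 e, which is below 1
     - A. *)
  assert (Hin : forall y, Rabs (y - s) < (1 - A) / 2 -> forall t,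
     disk (z + RtoC y * (circle_pt r t - z))%C).
  { intros y Hy t. apply segment_in_disk. rewrite Cmod_circle_pt by lra.
    assert (Rabs (1 - y) <= Rabs (1 - s) + Rabs (y - s)).
    { replace (1 - y) with ((1 - s) - (y - s)) by ring.
      eapply Rle_trans; [apply Rabs_triang|]. rewrite Rabs_Ropp. lra. }
    assert (Rabs y <= Rabs s + Rabs (y - s)).
    { replace y with (s + (y - s)) at 1 by ring. apply Rabs_triang. }
    assert (P := Rabs_pos (y - s)).
    assert (Rabs (1 - y) * Cmod z <= (Rabs (1 - s) + Rabs (y - s)) * Cmod z) by (apply Rmult_le_compat_r; lra).
    assert (Rabs y * r <= (Rabs s + Rabs (y - s)) * r) by (apply Rmult_le_compat_r; lra).
    unfold A in *. nra. }
  apply CInt_param with (h := fun s t => (f (z + RtoC s * (circle_pt r t - z)) * k t)%C)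
    (dh := fun s t => (f' (z + RtoC s * (circle_pt r t - z)) * (circle_pt r t - z) * k t)%C)
    (eps := (1 - A) / 2).
  - lra.
  - intros y Hy t.
    assert (D : has_Rderiv (fun y => (z + RtoC y * (circle_pt r t - z))%C) y (circle_pt r t - z)%C).
    { assert (D0 := has_Rderiv_plus _ _ _ _ _ (has_Rderiv_const z y)
        (has_Rderiv_mult _ _ _ _ _ (has_Rderiv_RtoC _ _ _ (is_derive_id_R y))
           (has_Rderiv_const (circle_pt r t - z)%C y))).
      apply (has_Rderiv_eq _ _ _ _ D0). ring. }
    assert (D1 := has_Rderiv_mult _ _ _ _ _
       (has_Rderiv_comp f _ _ _ _ (proj1 (Hf _ (Hin y Hy t))) D) (has_Rderiv_const (k t) y)).
    apply (has_Rderiv_eq _ _ _ _ D1). ring.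
  - intros t.
    assert (Cw : Ccontinuous (U := prod_UniformSpace R_UniformSpace R_UniformSpace)
       (fun p => (circle_pt r (snd p) - z)%C) (s, t)).
    { apply (Ccontinuous_minus (fun p : prod_UniformSpace R_UniformSpace R_UniformSpace => circle_pt r (snd p)));
        [|apply Ccontinuous_const].
      split.
      - apply (continuous_comp snd (fun t => Re (circle_pt r t))); [apply continuous_snd|apply Ccts_circle_pt].
      - apply (continuous_comp snd (fun t => Im (circle_pt r t))); [apply continuous_snd|apply Ccts_circle_pt]. }
    apply (Ccontinuous_mult (fun p : prod_UniformSpace R_UniformSpace R_UniformSpace =>
       (f' (z + RtoC (fst p) * (circle_pt r (snd p) - z)) * (circle_pt r (snd p) - z))%C)).
    + apply Ccontinuous_mult; [|exact Cw].
      apply Ccontinuous_comp with (h := fun p : prod_UniformSpace R_UniformSpace R_UniformSpace =>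
        (z + RtoC (fst p) * (circle_pt r (snd p) - z))%C).
      * apply Hf. apply Hin. simpl. rewrite Rminus_diag, Rabs_R0. lra.
      * apply Ccontinuous_plus; [apply Ccontinuous_const|].
        apply Ccontinuous_mult; [|exact Cw].
        apply Ccontinuous_RtoC. apply continuous_fst.
    + split.
      * apply (continuous_comp snd (fun t => Re (k t))); [apply continuous_snd|apply Hk].
      * apply (continuous_comp snd (fun t => Im (k t))); [apply continuous_snd|apply Hk].
  - intros y Hy. apply Ccts_mult; [|exact Hk]. intros t.
    apply Ccontinuous_comp with (h := fun t => (z + RtoC y * (circle_pt r t - z))%C).
    + eapply has_Cderiv_continuous, Hf, Hin, Hy.
    + apply Ccontinuous_plus; [apply Ccontinuous_const|].
      apply Ccontinuous_mult; [apply Ccontinuous_const|].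
      apply Ccontinuous_minus; [apply Ccts_circle_pt|apply Ccontinuous_const].
Qed.

Lemma circle_pt_2PI (r : R) : circle_pt r (2 * PI) = circle_pt r 0.
Proof. unfold circle_pt. rewrite cos_2PI, sin_2PI, cos_0, sin_0. reflexivity. Qed.

Lemma Ci_neq_0 : Ci <> 0%C.
Proof. intros E. apply (f_equal snd) in E. simpl in E. lra. Qed.

Lemma RtoC_neq_0 (x : R) : x <> 0 -> RtoC x <> 0%C.
Proof. intros H E. apply H. exact (f_equal fst E). Qed.

(** With w = r e^(it) one has dw = i w dt, so this is the kernel dw / (i (w - z)) of Cauchy's
    formula written in dt. *)
Definition Cauchy_kernel (z : C) (r t : R) : C := (circle_pt r t / (circle_pt r t - z))%C.

Lemma Cauchy_kernel_denom (z : C) (r t : R) : Cmod z < r -> (circle_pt r t - z)%C <> 0%C.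
Proof.
  intros H E. assert (Z0 := Cmod_ge_0 z). assert (T := Cmod_triangle_minus (circle_pt r t) z).
  rewrite E, Cmod_0, Cmod_circle_pt in T; lra.
Qed.

Lemma Ccts_Cauchy_kernel (z : C) (r : R) : Cmod z < r -> Ccts (Cauchy_kernel z r).
Proof.
  intros H t. apply Ccontinuous_mult; [apply Ccts_circle_pt|].
  apply Ccontinuous_inv; [apply Cauchy_kernel_denom, H|].
  apply Ccontinuous_minus; [apply Ccts_circle_pt|apply Ccontinuous_const].
Qed.

(* With J(s) the integral of f(z + s (w - z)) w / (w - z), the derivative of J is
   the integral of an exact form, so J(0) = J(1). *)
Lemma Cauchy_formula (f f' : C -> C) (z : C) (r : R) :
  C1_disk f f' -> Cmod z < r < 1 ->
  CInt (fun t => f (circle_pt r t) * Cauchy_kernel z r t)%C = (f z * CInt (Cauchy_kernel z r))%C.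
Proof.
  intros Hf [Hz Hr]. assert (Z0 := Cmod_ge_0 z).
  assert (Hw : forall t, (circle_pt r t - z)%C <> 0%C) by (intros; apply Cauchy_kernel_denom, Hz).
  set (k := Cauchy_kernel z r).
  assert (Ck : Ccts k) by apply Ccts_Cauchy_kernel, Hz.
  set (J := fun s => CInt (fun t => f (z + RtoC s * (circle_pt r t - z)) * k t)%C).
  assert (E : J 0 = J 1).
  { apply has_Rderiv_zero_eq; [lra|]. intros s Hs.
    assert (Bs : Rabs (1 - s) * Cmod z + Rabs s * r < 1).
    { rewrite !Rabs_pos_eq by lra. nra. }
    assert (D := homotopy_deriv f f' k z r s Hf ltac:(unfold disk; lra) ltac:(lra) Ck Bs).
    assert (Hin : forall t, disk (z + RtoC s * (circle_pt r t - z))%C).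
    { intros t. apply segment_in_disk. rewrite Cmod_circle_pt by lra. exact Bs. }
    assert (Cc : Ccts (fun t => f' (z + RtoC s * (circle_pt r t - z)) * circle_pt r t)%C).
    { apply Ccts_mult; [|apply Ccts_circle_pt]. intros t.
      apply Ccontinuous_comp with (h := fun t => (z + RtoC s * (circle_pt r t - z))%C).
      - apply Hf, Hin.
      - apply Ccontinuous_plus; [apply Ccontinuous_const|].
        apply Ccontinuous_mult; [apply Ccontinuous_const|].
        apply Ccontinuous_minus; [apply Ccts_circle_pt|apply Ccontinuous_const]. }
    (* The factor w - z produced by the chain rule cancels the denominator of the kernel. *)
    rewrite (CInt_ext _ (fun t => f' (z + RtoC s * (circle_pt r t - z)) * circle_pt r t)%C) in D.
    2: { intros t. unfold k, Cauchy_kernel. field. apply Hw. }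
    assert (Z : CInt (fun t => f' (z + RtoC s * (circle_pt r t - z)) * circle_pt r t)%C = 0%C).
    { destruct (Req_dec s 0) as [->|Ns].
      - rewrite (CInt_ext _ (fun t => f' z * circle_pt r t)%C).
        2: { intros t. f_equal. f_equal. ring. }
        rewrite CInt_scal by apply Ccts_circle_pt.
        assert (E0 : CInt (fun t => Ci * circle_pt r t)%C = 0%C).
        { apply (CInt_deriv (circle_pt r)).
          - intros t. apply has_Rderiv_circle_pt.
          - apply Ccts_mult; [apply Ccts_const|apply Ccts_circle_pt].
          - apply circle_pt_2PI. }
        rewrite CInt_scal in E0 by apply Ccts_circle_pt.
        replace (CInt (circle_pt r)) with (RtoC 0); [ring|].
        transitivity (/ Ci * (Ci * CInt (circle_pt r)))%C.
        + rewrite E0. ring.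
        + field. apply Ci_neq_0.
      - assert (E0 : CInt (fun t => (Ci * RtoC s) * (f' (z + RtoC s * (circle_pt r t - z)) * circle_pt r t))%C = 0%C).
        { apply (CInt_deriv (fun t => f (z + RtoC s * (circle_pt r t - z))%C)).
          - intros t.
            assert (D0 := has_Rderiv_plus _ _ _ _ _ (has_Rderiv_const z t)
              (has_Rderiv_mult _ _ _ _ _ (has_Rderiv_const (RtoC s) t)
                (has_Rderiv_plus _ _ _ _ _ (has_Rderiv_circle_pt r t) (has_Rderiv_const (- z)%C t)))).
            assert (D1 := has_Rderiv_comp f _ _ _ _ (proj1 (Hf _ (Hin t))) D0).
            apply (has_Rderiv_eq _ _ _ _ D1). unfold Cminus. ring.
          - apply Ccts_mult; [apply Ccts_const|exact Cc].
          - rewrite circle_pt_2PI. reflexivity. }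
        rewrite CInt_scal in E0 by exact Cc.
        match goal with |- ?X = _ => transitivity (/ (Ci * RtoC s) * ((Ci * RtoC s) * X))%C end.
        + field. split; [apply RtoC_neq_0, Ns|apply Ci_neq_0].
        + rewrite E0. ring. }
    rewrite Z in D. exact D. }
  unfold J in E.
  rewrite (CInt_ext _ (fun t => f z * k t)%C) in E.
  2: { intros t. f_equal. f_equal. ring. }
  rewrite CInt_scal in E by exact Ck.
  rewrite E. apply CInt_ext. intros t. f_equal. f_equal. ring.
Qed.

(** * Fourier coefficients on circles and their dependence on the radius *)

(** The derivative in t of f(r e^(it)) e^(ikt) integrates to 0 over a period. The hypothesis on [k]
    says that it is an integer; a real [k] covers both signs at once. *)
Lemma CInt_by_parts (f f' : C -> C) (k r : R) :
  C1_disk f f' -> 0 <= r < 1 -> expi (k * (2 * PI)) = 1%C ->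
  CInt (fun t => f' (circle_pt r t) * circle_pt r t * expi (k * t))%C =
  (- RtoC k * CInt (fun t => f (circle_pt r t) * expi (k * t)))%C.
Proof.
  intros Hf Hr Hk.
  assert (C0 : Ccts (fun t => f (circle_pt r t) * expi (k * t))%C).
  { apply Ccts_mult; [|apply Ccts_expi].
    apply Ccts_circle; [eapply C1_disk_continuous, Hf|exact Hr]. }
  assert (C1 : Ccts (fun t => f' (circle_pt r t) * circle_pt r t * expi (k * t))%C).
  { apply Ccts_mult; [|apply Ccts_expi]. apply Ccts_mult; [|apply Ccts_circle_pt].
    apply Ccts_circle; [eapply C1_disk_continuous', Hf|exact Hr]. }
  assert (E : CInt (fun t => Ci * (f' (circle_pt r t) * circle_pt r t * expi (k * t))
     + (Ci * RtoC k) * (f (circle_pt r t) * expi (k * t)))%C = 0%C).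
  { apply (CInt_deriv (fun t => f (circle_pt r t) * expi (k * t))%C).
    - intros t.
      assert (D := has_Rderiv_mult _ _ _ _ _
        (has_Rderiv_comp f _ _ _ _ (proj1 (Hf _ (disk_circle_pt r t Hr))) (has_Rderiv_circle_pt r t))
        (has_Rderiv_expi k t)).
      apply (has_Rderiv_eq _ _ _ _ D). ring.
    - apply Ccts_plus; (apply Ccts_mult; [apply Ccts_const|assumption]).
    - rewrite circle_pt_2PI, Hk, Rmult_0_r, expi_0. reflexivity. }
  rewrite CInt_plus, !CInt_scal in E; try assumption;
    try (apply Ccts_mult; [apply Ccts_const|assumption]).
  set (X := CInt (fun t => f' (circle_pt r t) * circle_pt r t * expi (k * t))%C) in *.
  set (Y := CInt (fun t => f (circle_pt r t) * expi (k * t))%C) in *.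
  transitivity (/ Ci * (Ci * X + Ci * RtoC k * Y) - RtoC k * Y)%C.
  - field. apply Ci_neq_0.
  - rewrite E. ring.
Qed.

(** The radial derivative satisfies s d/ds f(s e^(it)) = w f'(w), and integration by parts turns the
    right side into -k times the coefficient. The coefficient c(s) thus solves s c' = -k c; the
    undivided form keeps s = 0. *)
Lemma circle_coef_deriv (f f' : C -> C) (k s : R) :
  C1_disk f f' -> 0 <= s < 1 -> expi (k * (2 * PI)) = 1%C ->
  exists l, has_Rderiv (fun s => CInt (fun t => f (circle_pt s t) * expi (k * t))%C) s l /\
    (RtoC s * l)%C = (- RtoC k * CInt (fun t => f (circle_pt s t) * expi (k * t)))%C.
Proof.
  intros Hf Hs Hk.
  (* The circle of radius s is the unit circle dilated by s about 0. *)
  assert (E0 : forall s t, (0 + RtoC s * (circle_pt 1 t - 0))%C = circle_pt s t).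
  { intros u t. rewrite !circle_pt_expi. ring. }
  assert (D := homotopy_deriv f f' (fun t => expi (k * t)) 0%C 1 s Hf
    ltac:(unfold disk; rewrite Cmod_0; lra) ltac:(lra) (Ccts_expi k)).
  rewrite Cmod_0, (Rabs_pos_eq s) in D by lra. specialize (D ltac:(lra)).
  eexists. split.
  - eapply has_Rderiv_ext; [|exact D]. intros u. apply CInt_ext. intros t. rewrite E0. reflexivity.
  - rewrite <- (CInt_by_parts f f' k s Hf Hs Hk), <- CInt_scal.
    + apply CInt_ext. intros t. rewrite E0, !circle_pt_expi. ring.
    + apply Ccts_mult; [|apply Ccts_expi].
      apply Ccts_mult; [|apply Ccts_minus; [apply Ccts_circle_pt|apply Ccts_const]].
      apply Ccts_ext with (fun t => f' (circle_pt s t)).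
      * intros t. rewrite E0. reflexivity.
      * apply Ccts_circle; [eapply C1_disk_continuous', Hf|exact Hs].
Qed.

(* This is 2 pi r^n times the n-th Taylor coefficient of f. *)
Definition circle_coef (f : C -> C) (r : R) (n : nat) : C :=
  CInt (fun t => f (circle_pt r t) * expi (- INR n * t))%C.

Lemma expi_neg_2PI (n : nat) : expi (- INR n * (2 * PI)) = 1%C.
Proof.
  replace (- INR n * (2 * PI)) with (- (INR n * (2 * PI))) by ring.
  rewrite expi_opp, expi_2PI. unfold Cconj, RtoC; simpl. f_equal. ring.
Qed.

(** The equation s c' = n c makes c(s) / s^n constant on ]0, 1[. *)
Lemma circle_coef_radius (f f' : C -> C) (n : nat) (r s : R) :
  C1_disk f f' -> 0 < r < 1 -> 0 < s < 1 ->
  (RtoC (s ^ n) * circle_coef f r n)%C = (RtoC (r ^ n) * circle_coef f s n)%C.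
Proof.
  intros Hf.
  set (h := fun s => (circle_coef f s n * RtoC (/ s ^ n))%C).
  assert (A : forall a b, 0 < a < b -> b < 1 -> h a = h b).
  { intros a b Hab Hb. apply has_Rderiv_zero_eq; [lra|]. intros u Hu.
    destruct (circle_coef_deriv f f' (- INR n) u Hf ltac:(lra) (expi_neg_2PI n)) as [l [D E]].
    assert (Pu : u ^ n <> 0) by (apply pow_nonzero; lra).
    assert (D2 : is_derive (fun s => / s ^ n) u (- (INR n / (u * u ^ n)))).
    { auto_derive; [exact Pu|].
      destruct n as [|n]. { simpl. field. lra. }
      change (Nat.pred (S n)) with n. rewrite <- tech_pow_Rmult in *.
      assert (u ^ n <> 0) by (apply pow_nonzero; lra).
      field. repeat split; solve [assumption | lra]. }
    assert (D3 := has_Rderiv_mult _ _ _ _ _ D (has_Rderiv_RtoC _ _ _ D2)).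
    apply (has_Rderiv_eq _ _ _ _ D3).
    fold (circle_coef f u n) in E |- *.
    transitivity ((RtoC u * l + - RtoC (INR n) * circle_coef f u n) * RtoC (/ (u * u ^ n)))%C.
    - rewrite RtoC_opp, RtoC_div, RtoC_inv, RtoC_inv, RtoC_mult by (try apply Rmult_integral_contrapositive; try split; lra).
      field. split; apply RtoC_neq_0; lra.
    - rewrite E, RtoC_opp. ring. }
  assert (B : 0 < r < 1 -> 0 < s < 1 -> h r = h s).
  { intros Hr Hs. destruct (Rtotal_order r s) as [L|[->|G]].
    - apply A; lra.
    - reflexivity.
    - symmetry. apply A; lra. }
  intros Hr Hs. specialize (B Hr Hs). unfold h in B.
  assert (r ^ n <> 0) by (apply pow_nonzero; lra).
  assert (s ^ n <> 0) by (apply pow_nonzero; lra).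
  rewrite !RtoC_inv in B by assumption.
  apply RtoC_neq_0 in H, H0.
  transitivity (RtoC (s ^ n) * RtoC (r ^ n) * (circle_coef f r n * / RtoC (r ^ n)))%C.
  { field. exact H. }
  rewrite B. field. exact H0.
Qed.

(** Here s c' = -(n+1) c, so c(s) s^(n+1) is constant on [0, r], and it is 0 at s = 0. *)
Lemma circle_coef_negative (f f' : C -> C) (n : nat) (r : R) :
  C1_disk f f' -> 0 < r < 1 ->
  CInt (fun t => f (circle_pt r t) * expi (INR (S n) * t))%C = 0%C.
Proof.
  intros Hf Hr.
  set (J := fun s => CInt (fun t => f (circle_pt s t) * expi (INR (S n) * t))%C).
  assert (E : (J 0 * RtoC (0 ^ S n))%C = (J r * RtoC (r ^ S n))%C).
  { apply (has_Rderiv_zero_eq (fun s => J s * RtoC (s ^ S n))%C); [lra|]. intros u Hu.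
    destruct (circle_coef_deriv f f' (INR (S n)) u Hf ltac:(lra) (expi_2PI (S n))) as [l [D E]].
    assert (D2 : is_derive (fun s => s ^ S n) u (INR (S n) * u ^ n)).
    { auto_derive; trivial. simpl. ring. }
    assert (D3 := has_Rderiv_mult _ _ _ _ _ D (has_Rderiv_RtoC _ _ _ D2)).
    apply (has_Rderiv_eq _ _ _ _ D3).
    fold (J u) in E |- *. rewrite <- tech_pow_Rmult, !RtoC_mult.
    transitivity ((RtoC u * l + RtoC (INR (S n)) * J u) * RtoC (u ^ n))%C; [ring|].
    rewrite E. ring. }
  rewrite pow_i in E by lia.
  assert (r ^ S n <> 0) by (apply pow_nonzero; lra). apply RtoC_neq_0 in H.
  fold (J r). transitivity (J r * RtoC (r ^ S n) * / RtoC (r ^ S n))%C.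
  - field. exact H.
  - rewrite <- E. ring.
Qed.

Lemma le_of_le_add_geom (x a b q : R) : 0 <= q < 1 ->
  (forall J : nat, x <= a + b * q ^ J) -> x <= a.
Proof.
  intros Hq H.
  assert (L : is_lim_seq (fun J => a + b * q ^ J) (Finite (a + b * 0))).
  { apply is_lim_seq_plus'; [apply is_lim_seq_const|].
    apply (is_lim_seq_scal_l _ b (Finite 0)). apply is_lim_seq_geom. rewrite Rabs_pos_eq; lra. }
  assert (Q := is_lim_seq_le _ _ (Finite x) _ H (is_lim_seq_const x) L). simpl in Q. lra.
Qed.

Lemma le_of_le_add_lin (x a b : R) :
  (forall e, 0 < e < 1 -> x <= a + b * e) -> x <= a.
Proof.
  intros H. apply (le_of_le_add_geom x a (b / 2) (1 / 2)); [lra|]. intros J.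
  assert (P : 0 < (1 / 2) ^ S J < 1).
  { split; [apply pow_lt; lra|]. apply pow_lt_1_compat; [lra|lia]. }
  specialize (H _ P). simpl in H. lra.
Qed.

Lemma CInt_expi_neg (n : nat) : CInt (fun t => expi (- INR (S n) * t)) = 0%C.
Proof.
  assert (E : CInt (fun t => Ci * RtoC (- INR (S n)) * expi (- INR (S n) * t))%C = 0%C).
  { apply (CInt_deriv (fun t => expi (- INR (S n) * t))).
    - intros t. apply has_Rderiv_expi.
    - apply Ccts_mult; [apply Ccts_const|apply Ccts_expi].
    - rewrite expi_neg_2PI, Rmult_0_r, expi_0. reflexivity. }
  rewrite CInt_scal in E by apply Ccts_expi.
  assert (N : RtoC (- INR (S n)) <> 0%C).
  { apply RtoC_neq_0. assert (H := lt_0_INR (S n) ltac:(lia)). lra. }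
  set (X := CInt (fun t => expi (- INR (S n) * t))) in *.
  transitivity (/ (Ci * RtoC (- INR (S n))) * (Ci * RtoC (- INR (S n)) * X))%C.
  - field. split; [exact N|apply Ci_neq_0].
  - rewrite E. ring.
Qed.

(** * Geometric expansion of the Cauchy kernel *)

Lemma Cmod_Cauchy_kernel (z : C) (r t : R) : Cmod z < r ->
  Cmod (Cauchy_kernel z r t) <= r / (r - Cmod z).
Proof.
  intros H. unfold Cauchy_kernel. assert (Z0 := Cmod_ge_0 z).
  rewrite Cmod_div by (apply Cauchy_kernel_denom, H). rewrite Cmod_circle_pt by lra.
  assert (T := Cmod_triangle_minus (circle_pt r t) z). rewrite Cmod_circle_pt in T by lra.
  apply Rmult_le_compat_l; [lra|]. apply Rinv_le_contravar; lra.
Qed.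

(** The integral of g (z/w)^J w/(w - z): the remainder after J terms when w/(w - z) is expanded in
    powers of z/w. *)
Definition kernel_tail (z : C) (r : R) (g : R -> C) (J : nat) : C :=
  CInt (fun t => g t * ((z / RtoC r) ^ J * expi (- INR J * t)) * Cauchy_kernel z r t)%C.

Lemma kernel_tail_0 (z : C) (r : R) (g : R -> C) :
  kernel_tail z r g 0 = CInt (fun t => g t * Cauchy_kernel z r t)%C.
Proof.
  apply CInt_ext. intros t. simpl.
  replace (- 0 * t) with 0 by ring. rewrite expi_0. ring.
Qed.

(** One step of the expansion, from w/(w - z) = 1 + (z/w) w/(w - z). *)
Lemma kernel_tail_S (z : C) (r : R) (g : R -> C) (J : nat) : Cmod z < r -> Ccts g ->
  kernel_tail z r g J =
  ((z / RtoC r) ^ J * CInt (fun t => g t * expi (- INR J * t)) + kernel_tail z r g (S J))%C.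
Proof.
  intros Hz Hg. assert (Z0 := Cmod_ge_0 z).
  assert (Ce : forall n, Ccts (fun t => g t * expi (- INR n * t))%C).
  { intros n. apply Ccts_mult; [exact Hg|apply Ccts_expi]. }
  rewrite <- CInt_scal by apply Ce. unfold kernel_tail. rewrite <- CInt_plus.
  - apply CInt_ext. intros t.
    assert (Ew : (z / RtoC r * expi (- t) * circle_pt r t)%C = z).
    { rewrite circle_pt_expi. transitivity (z * (expi t * expi (- t)))%C.
      - field. apply RtoC_neq_0. lra.
      - rewrite expi_inv. ring. }
    replace (- INR (S J) * t) with (- INR J * t + - t) by (rewrite S_INR; ring).
    rewrite expi_plus. simpl.
    set (e := expi (- INR J * t)). set (q := ((z / RtoC r) ^ J)%C).
    transitivity (g t * (q * e) + g t * (q * e) *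
      ((z / RtoC r * expi (- t) * circle_pt r t) / (circle_pt r t - z)))%C.
    + rewrite Ew. unfold Cauchy_kernel. field. apply Cauchy_kernel_denom, Hz.
    + unfold Cauchy_kernel, Cdiv. ring.
  - apply Ccts_mult; [apply Ccts_const|apply Ce].
  - apply Ccts_mult; [|apply Ccts_Cauchy_kernel, Hz]. apply Ccts_mult; [exact Hg|].
    apply Ccts_mult; [apply Ccts_const|apply Ccts_expi].
Qed.

Lemma Cmod_div_radius (z : C) (r : R) : 0 < r -> Cmod (z / RtoC r)%C = Cmod z / r.
Proof.
  intros Hr. rewrite Cmod_div, Cmod_R, Rabs_pos_eq; [reflexivity|lra|apply RtoC_neq_0; lra].
Qed.

Lemma ratio_bounds (a r : R) : 0 <= a < r -> 0 <= a / r < 1.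
Proof.
  intros H. split.
  - apply Rmult_le_pos; [lra|]. left. apply Rinv_0_lt_compat. lra.
  - apply Rmult_lt_reg_r with r; [lra|]. unfold Rdiv. rewrite Rmult_assoc, Rinv_l; lra.
Qed.

Lemma Cmod_kernel_tail (z : C) (r : R) (g : R -> C) (B : R) (J : nat) :
  Cmod z < r -> Ccts g -> (forall t, Cmod (g t) <= B) ->
  Cmod (kernel_tail z r g J) <= 2 * PI * (B * (r / (r - Cmod z))) * (Cmod z / r) ^ J.
Proof.
  intros Hz Hg HB. assert (Z0 := Cmod_ge_0 z).
  unfold kernel_tail. rewrite Rmult_assoc. apply Cmod_CInt_bound.
  - apply Ccts_mult; [|apply Ccts_Cauchy_kernel, Hz]. apply Ccts_mult; [exact Hg|].
    apply Ccts_mult; [apply Ccts_const|apply Ccts_expi].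
  - intros t. rewrite !Cmod_mult, Cmod_pow, Cmod_expi, Cmod_div_radius, Rmult_1_r by lra.
    assert (P : 0 <= (Cmod z / r) ^ J) by (apply pow_le, ratio_bounds; lra).
    assert (Cmod (g t) * Cmod (Cauchy_kernel z r t) <= B * (r / (r - Cmod z))).
    { apply Rmult_le_compat; [apply Cmod_ge_0|apply Cmod_ge_0|apply HB|apply Cmod_Cauchy_kernel, Hz]. }
    nra.
Qed.

(** With g = 1 every term of index at least 1 integrates to 0, so the tail from index 1 equals all
    later tails, which tend to 0. Only the term of index 0 remains. *)
Lemma CInt_Cauchy_kernel (z : C) (r : R) : Cmod z < r ->
  CInt (Cauchy_kernel z r) = RtoC (2 * PI).
Proof.
  intros Hz. assert (Z0 := Cmod_ge_0 z).
  set (g := fun _ : R => RtoC 1). assert (Hg : Ccts g) by apply Ccts_const.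
  assert (T1 : forall J, kernel_tail z r g 1 = kernel_tail z r g (S J)).
  { induction J as [|J IH]; [reflexivity|]. rewrite IH, kernel_tail_S by assumption.
    rewrite (CInt_ext _ (fun t => expi (- INR (S J) * t))) by (intros; unfold g; ring).
    rewrite CInt_expi_neg. ring. }
  assert (Z : Cmod (kernel_tail z r g 1) <= 0).
  { apply (le_of_le_add_geom _ _ (2 * PI * (1 * (r / (r - Cmod z))) * (Cmod z / r)) (Cmod z / r)).
    { apply ratio_bounds. lra. }
    intros J. rewrite (T1 J). eapply Rle_trans; [apply (Cmod_kernel_tail z r g 1); try assumption|].
    - intros t. unfold g. rewrite Cmod_1. lra.
    - simpl. lra. }
  assert (Z1 := Cmod_ge_0 (kernel_tail z r g 1)).
  assert (S0 := kernel_tail_S z r g 0 Hz Hg).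
  rewrite (Cmod_eq_0 (kernel_tail z r g 1)), kernel_tail_0 in S0 by lra.
  rewrite (CInt_ext _ (fun t => g t * Cauchy_kernel z r t)%C) by (intros; unfold g; ring).
  rewrite S0, (CInt_ext _ (fun _ => RtoC 1)).
  - rewrite CInt_const. simpl. ring.
  - intros t. unfold g. simpl. replace (- 0 * t) with 0 by ring. rewrite expi_0. ring.
Qed.

Lemma Cauchy_formula_disk (f f' : C -> C) (z : C) (r : R) :
  C1_disk f f' -> Cmod z < r < 1 ->
  CInt (fun t => f (circle_pt r t) * Cauchy_kernel z r t)%C = (RtoC (2 * PI) * f z)%C.
Proof.
  intros Hf Hz. rewrite (Cauchy_formula f f') by assumption.
  rewrite CInt_Cauchy_kernel by apply Hz. ring.
Qed.

Lemma circle_coef_0 (f f' : C -> C) (r : R) : C1_disk f f' -> 0 < r < 1 ->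
  circle_coef f r 0 = (RtoC (2 * PI) * f 0%C)%C.
Proof.
  intros Hf Hr. rewrite <- (Cauchy_formula_disk f f' 0%C r Hf) by (rewrite Cmod_0; lra).
  apply CInt_ext. intros t.
  assert (N := Cauchy_kernel_denom 0%C r t ltac:(rewrite Cmod_0; lra)).
  simpl. replace (- 0 * t) with 0 by ring. rewrite expi_0. unfold Cauchy_kernel.
  replace (circle_pt r t - 0)%C with (circle_pt r t) in * by ring. field. exact N.
Qed.

(** The Taylor series is dominated by K times the geometric series in |z|. The crude bound [B] only
    sends the remainder of the expansion to 0, and so is absent from the conclusion. *)
Lemma sup_bound_of_coefs (f f' : C -> C) (B K : R) (z : C) :
  C1_disk f f' -> (forall w, disk w -> Cmod (f w) <= B) -> 0 <= K ->
  (forall n r, 0 < r < 1 -> Cmod (circle_coef f r n) <= 2 * PI * K * r ^ n) ->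
  disk z -> Cmod (f z) <= K / (1 - Cmod z).
Proof.
  intros Hf HB HK H Hz. unfold disk in Hz.
  assert (Z0 := Cmod_ge_0 z). assert (P := PI_RGT_0).
  set (r := (1 + Cmod z) / 2). assert (Hr : Cmod z < r < 1) by (unfold r; lra).
  set (g := fun t => f (circle_pt r t)).
  assert (Hg : Ccts g) by (apply Ccts_circle; [eapply C1_disk_continuous, Hf|lra]).
  assert (HgB : forall t, Cmod (g t) <= B) by (intros; apply HB, disk_circle_pt; lra).
  apply Rmult_le_reg_l with (2 * PI); [lra|].
  replace (2 * PI * Cmod (f z)) with (Cmod (kernel_tail z r g 0)).
  2: { rewrite kernel_tail_0. unfold g. rewrite (Cauchy_formula_disk f f' z r Hf Hr).
       rewrite Cmod_mult, Cmod_R, Rabs_pos_eq by lra. reflexivity. }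
  assert (Q := ratio_bounds (Cmod z) r ltac:(lra)).
  apply (le_of_le_add_geom _ _ (2 * PI * (B * (r / (r - Cmod z)))) (Cmod z / r) Q).
  intros J.
  assert (S : Cmod (kernel_tail z r g 0) <=
    2 * PI * K * ((1 - Cmod z ^ J) / (1 - Cmod z)) + Cmod (kernel_tail z r g J)).
  { induction J as [|J IH].
    - simpl. apply Req_le. field. lra.
    - eapply Rle_trans; [exact IH|]. rewrite (kernel_tail_S z r g J) by (assumption || lra).
      assert (T := Cmod_triangle ((z / RtoC r) ^ J * circle_coef f r J)%C (kernel_tail z r g (S J))).
      rewrite Cmod_mult, Cmod_pow, Cmod_div_radius in T by lra.
      assert (T2 : (Cmod z / r) ^ J * Cmod (circle_coef f r J) <= 2 * PI * K * Cmod z ^ J).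
      { apply Rle_trans with ((Cmod z / r) ^ J * (2 * PI * K * r ^ J)).
        - apply Rmult_le_compat_l; [apply pow_le, Q|apply H; lra].
        - apply Req_le. unfold Rdiv. rewrite Rpow_mult_distr, pow_inv. field. apply pow_nonzero. lra. }
      replace ((1 - Cmod z ^ S J) / (1 - Cmod z)) with ((1 - Cmod z ^ J) / (1 - Cmod z) + Cmod z ^ J).
      2: { simpl. field. lra. }
      fold (circle_coef f r J). unfold g in *. change (CInt (fun t => f (circle_pt r t) * expi (- INR J * t))%C) with (circle_coef f r J). nra. }
  eapply Rle_trans; [exact S|].
  apply Rplus_le_compat; [|apply Cmod_kernel_tail; assumption || lra].
  rewrite Rmult_assoc. apply Rmult_le_compat_l; [lra|]. unfold Rdiv.
  apply Rmult_le_compat_l; [exact HK|].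
  assert (0 <= Cmod z ^ J) by (apply pow_le, Z0).
  assert (0 < / (1 - Cmod z)) by (apply Rinv_0_lt_compat; lra). nra.
Qed.

(** * Rules for derivatives and continuity on the disk *)

Lemma has_Cderiv_id (z : C) : has_Cderiv (fun w => w) z 1%C.
Proof.
  intros eps Heps. exists 1. split; [lra|]. intros h _.
  replace (z + h - z - 1 * h)%C with (RtoC 0) by ring. rewrite Cmod_0.
  assert (H := Cmod_ge_0 h). nra.
Qed.

Lemma has_Cderiv_minus (f g : C -> C) (z l m : C) :
  has_Cderiv f z l -> has_Cderiv g z m -> has_Cderiv (fun w => f w - g w)%C z (l - m)%C.
Proof.
  intros Hf Hg eps Heps.
  destruct (Hf (eps / 2) ltac:(lra)) as [d1 [P1 Q1]].
  destruct (Hg (eps / 2) ltac:(lra)) as [d2 [P2 Q2]].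
  exists (Rmin d1 d2). split; [apply Rmin_glb_lt; assumption|]. intros h Hh.
  specialize (Q1 h (Rlt_le_trans _ _ _ Hh (Rmin_l _ _))).
  specialize (Q2 h (Rlt_le_trans _ _ _ Hh (Rmin_r _ _))).
  replace (f (z + h) - g (z + h) - (f z - g z) - (l - m) * h)%C with
    ((f (z + h) - f z - l * h) - (g (z + h) - g z - m * h))%C by ring.
  eapply Rle_trans; [apply Cmod_minus_le|]. lra.
Qed.

Lemma has_Cderiv_comp (f g : C -> C) (z l m : C) :
  has_Cderiv f (g z) l -> has_Cderiv g z m -> has_Cderiv (fun w => f (g w)) z (m * l)%C.
Proof.
  intros Hf Hg eps Heps.
  assert (Lm := Cmod_ge_0 m). assert (Ll := Cmod_ge_0 l).
  set (e1 := eps / (2 * (1 + Cmod m))).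
  set (e2 := Rmin 1 (eps / (2 * (1 + Cmod l)))).
  assert (P1 : 0 < e1) by (apply Rdiv_lt_0_compat; lra).
  assert (P2 : 0 < e2).
  { apply Rmin_glb_lt; [lra|]. apply Rdiv_lt_0_compat; lra. }
  destruct (Hf e1 P1) as [d1 [D1 F]]. destruct (Hg e2 P2) as [d2 [D2 G]].
  exists (Rmin d2 (d1 / (1 + Cmod m))). split.
  { apply Rmin_glb_lt; [exact D2|]. apply Rdiv_lt_0_compat; lra. }
  intros h Hh.
  assert (S1 := Rlt_le_trans _ _ _ Hh (Rmin_l _ _)).
  assert (S2 := Rlt_le_trans _ _ _ Hh (Rmin_r _ _)).
  specialize (G h S1).
  assert (Ah := Cmod_ge_0 h).
  set (dg := (g (z + h) - g z)%C) in *.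
  assert (E21 : e2 <= 1) by apply Rmin_l.
  assert (E22 : (1 + Cmod l) * e2 <= eps / 2).
  { apply Rle_trans with ((1 + Cmod l) * (eps / (2 * (1 + Cmod l)))).
    - apply Rmult_le_compat_l; [lra|apply Rmin_r].
    - apply Req_le. field. lra. }
  assert (E1 : e1 * (1 + Cmod m) = eps / 2) by (unfold e1; field; lra).
  assert (B : Cmod dg <= (1 + Cmod m) * Cmod h).
  { replace dg with ((dg - m * h) + m * h)%C by ring.
    eapply Rle_trans. { apply Cmod_triangle. }
    rewrite Cmod_mult. nra. }
  assert (B1 : Cmod dg < d1).
  { eapply Rle_lt_trans; [exact B|].
    apply Rmult_lt_reg_r with (/ (1 + Cmod m)). { apply Rinv_0_lt_compat; lra. }
    replace ((1 + Cmod m) * Cmod h * / (1 + Cmod m)) with (Cmod h) by (field; lra).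
    exact S2. }
  specialize (F dg B1).
  replace (g z + dg)%C with (g (z + h)%C) in F by (unfold dg; ring).
  replace (f (g (z + h)) - f (g z) - m * l * h)%C with
    ((f (g (z + h)) - f (g z) - l * dg) + l * (dg - m * h))%C by ring.
  eapply Rle_trans. { apply Cmod_triangle. }
  rewrite Cmod_mult.
  assert (Cmod l * Cmod (dg - m * h)%C <= Cmod l * (e2 * Cmod h)).
  { apply Rmult_le_compat_l; assumption. }
  assert (e1 * Cmod dg <= e1 * ((1 + Cmod m) * Cmod h)).
  { apply Rmult_le_compat_l; [lra|assumption]. }
  nra.
Qed.

Lemma Ccontinuous_at_comp (f g : C -> C) (z : C) :
  Ccontinuous_at f (g z) -> Ccontinuous_at g z -> Ccontinuous_at (fun w => f (g w)) z.
Proof.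
  intros Hf Hg eps Heps. destruct (Hf eps Heps) as [d [Hd F]].
  destruct (Hg d Hd) as [d' [Hd' G]]. exists d'. split; [exact Hd'|].
  intros w Hw. apply F, G, Hw.
Qed.

Lemma Ccontinuous_at_const (c z : C) : Ccontinuous_at (fun _ => c) z.
Proof.
  intros eps Heps. exists 1. split; [lra|]. intros w _.
  replace (c - c)%C with (RtoC 0) by ring. rewrite Cmod_0. exact Heps.
Qed.

Lemma Ccontinuous_at_minus (f g : C -> C) (z : C) :
  Ccontinuous_at f z -> Ccontinuous_at g z -> Ccontinuous_at (fun w => f w - g w)%C z.
Proof.
  intros Hf Hg eps Heps.
  destruct (Hf (eps / 2) ltac:(lra)) as [d1 [P1 Q1]].
  destruct (Hg (eps / 2) ltac:(lra)) as [d2 [P2 Q2]].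
  exists (Rmin d1 d2). split; [apply Rmin_glb_lt; assumption|]. intros w Hw.
  specialize (Q1 w (Rlt_le_trans _ _ _ Hw (Rmin_l _ _))).
  specialize (Q2 w (Rlt_le_trans _ _ _ Hw (Rmin_r _ _))).
  replace (f w - g w - (f z - g z))%C with ((f w - f z) - (g w - g z))%C by ring.
  eapply Rle_lt_trans; [apply Cmod_minus_le|]. lra.
Qed.

Lemma Ccontinuous_at_mult (f g : C -> C) (z : C) :
  Ccontinuous_at f z -> Ccontinuous_at g z -> Ccontinuous_at (fun w => f w * g w)%C z.
Proof.
  intros Hf Hg eps Heps.
  assert (F0 := Cmod_ge_0 (f z)). assert (G0 := Cmod_ge_0 (g z)).
  set (M := 1 + Cmod (f z) + Cmod (g z)).
  assert (He : 0 < Rmin 1 (eps / M / 2)).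
  { apply Rmin_glb_lt; [lra|]. apply Rdiv_lt_0_compat; [|lra]. apply Rdiv_lt_0_compat; unfold M; lra. }
  destruct (Hf _ He) as [d1 [P1 Q1]]. destruct (Hg _ He) as [d2 [P2 Q2]].
  exists (Rmin d1 d2). split; [apply Rmin_glb_lt; assumption|]. intros w Hw.
  specialize (Q1 w (Rlt_le_trans _ _ _ Hw (Rmin_l _ _))).
  specialize (Q2 w (Rlt_le_trans _ _ _ Hw (Rmin_r _ _))).
  set (e := Rmin 1 (eps / M / 2)) in *.
  assert (E1 : e <= 1) by apply Rmin_l.
  assert (E2 : M * e <= eps / 2).
  { apply Rle_trans with (M * (eps / M / 2)).
    - apply Rmult_le_compat_l; [unfold M; lra|apply Rmin_r].
    - apply Req_le. field. unfold M. lra. }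
  replace (f w * g w - f z * g z)%C with
    ((f w - f z) * (g w - g z) + (f w - f z) * g z + f z * (g w - g z))%C by ring.
  set (a := (f w - f z)%C) in *. set (b := (g w - g z)%C) in *.
  assert (T1 := Cmod_triangle (a * b + a * g z) (f z * b)%C).
  assert (T2 := Cmod_triangle (a * b) (a * g z)%C).
  rewrite !Cmod_mult in *.
  assert (A0 := Cmod_ge_0 a). assert (B0 := Cmod_ge_0 b).
  assert (Cmod a * Cmod b <= e * 1) by (apply Rmult_le_compat; lra).
  assert (Cmod a * Cmod (g z) <= e * Cmod (g z)) by (apply Rmult_le_compat_r; lra).
  assert (Cmod (f z) * Cmod b <= Cmod (f z) * e) by (apply Rmult_le_compat_l; lra).
  unfold M in E2. nra.
Qed.

Lemma C1_disk_id : C1_disk (fun w => w) (fun _ => 1%C).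
Proof. intros z _. split; [apply has_Cderiv_id|apply Ccontinuous_at_const]. Qed.

Lemma C1_disk_minus (f f' g g' : C -> C) : C1_disk f f' -> C1_disk g g' ->
  C1_disk (fun w => f w - g w)%C (fun w => f' w - g' w)%C.
Proof.
  intros Hf Hg z Hz. destruct (Hf z Hz), (Hg z Hz).
  split; [apply has_Cderiv_minus|apply Ccontinuous_at_minus]; assumption.
Qed.

Lemma C1_disk_comp (f f' g g' : C -> C) : C1_disk f f' -> C1_disk g g' ->
  (forall z, disk z -> disk (g z)) ->
  C1_disk (fun w => f (g w)) (fun w => g' w * f' (g w))%C.
Proof.
  intros Hf Hg Hd z Hz. destruct (Hf _ (Hd z Hz)) as [F1 F2]. destruct (Hg z Hz) as [G1 G2].
  split; [apply has_Cderiv_comp; assumption|].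
  apply Ccontinuous_at_mult; [exact G2|].
  apply Ccontinuous_at_comp; [exact F2|]. eapply has_Cderiv_continuous, G1.
Qed.

(** * Coefficients of self-maps of the disk and of their powers *)

Lemma circle_coef_minus (f g : C -> C) (r : R) (n : nat) :
  continuous_on_disk f -> continuous_on_disk g -> 0 <= r < 1 ->
  circle_coef (fun w => f w - g w)%C r n = (circle_coef f r n - circle_coef g r n)%C.
Proof.
  intros Hf Hg Hr. unfold circle_coef. rewrite <- CInt_minus.
  - apply CInt_ext. intros t. ring.
  - apply Ccts_mult; [apply Ccts_circle; assumption|apply Ccts_expi].
  - apply Ccts_mult; [apply Ccts_circle; assumption|apply Ccts_expi].
Qed.

Lemma continuous_on_disk_id : continuous_on_disk (fun w => w).
Proof. eapply C1_disk_continuous, C1_disk_id. Qed.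

Lemma CInt_expi_diff (m n : nat) :
  CInt (fun t => expi (INR m * t) * expi (- INR n * t))%C =
  if Nat.eq_dec m n then RtoC (2 * PI) else 0%C.
Proof.
  destruct (Nat.eq_dec m n) as [->|N].
  - rewrite (CInt_ext _ (fun _ => RtoC 1)); [rewrite CInt_const; ring|].
    intros t. rewrite <- expi_plus. replace (INR n * t + - INR n * t) with 0 by ring. apply expi_0.
  - destruct (Nat.lt_total m n) as [L|[E|L]]; [|contradiction|].
    + rewrite (CInt_ext _ (fun t => expi (- INR (S (n - m - 1)) * t))); [apply CInt_expi_neg|].
      intros t. rewrite <- expi_plus. f_equal.
      replace (S (n - m - 1)) with (n - m)%nat by lia. rewrite minus_INR by lia. ring.
    + rewrite (CInt_ext _ (fun t => Cconj (expi (- INR (S (m - n - 1)) * t)))).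
      * rewrite CInt_conj by apply Ccts_expi. rewrite CInt_expi_neg.
        unfold Cconj, RtoC; simpl. f_equal. ring.
      * intros t. rewrite <- expi_plus, <- expi_opp. f_equal.
        replace (S (m - n - 1)) with (m - n)%nat by lia. rewrite minus_INR by lia. ring.
Qed.

Lemma circle_coef_pow (r : R) (m n : nat) :
  circle_coef (fun w => w ^ m)%C r n =
  if Nat.eq_dec m n then RtoC (2 * PI * r ^ n) else 0%C.
Proof.
  unfold circle_coef.
  rewrite (CInt_ext _ (fun t => RtoC (r ^ m) * (expi (INR m * t) * expi (- INR n * t)))%C).
  - rewrite CInt_scal by (apply Ccts_mult; apply Ccts_expi).
    rewrite CInt_expi_diff. destruct (Nat.eq_dec m n) as [->|N]; [|ring].
    rewrite (RtoC_mult (2 * PI)). ring.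
  - intros t. rewrite circle_pt_expi, Cpow_mult_l, <- RtoC_pow, expi_pow. ring.
Qed.

Lemma circle_coef_id (r : R) (n : nat) :
  circle_coef (fun w => w) r n = if Nat.eq_dec 1 n then RtoC (2 * PI * r ^ n) else 0%C.
Proof.
  rewrite <- circle_coef_pow. apply CInt_ext. intros t. rewrite Cpow_1_r. reflexivity.
Qed.

(* The function 1 - Re (e^(-it) phi(s e^(it))) of t is nonnegative, so its
   Fourier coefficients are bounded by its mean; letting s tend to 1 gives a
   bound that is linear, not merely square-root, in phi - id. *)
Lemma self_map_coef_bound (phi phi' : C -> C) (n : nat) (r : R) :
  C1_disk phi phi' -> (forall z, disk z -> disk (phi z)) -> 0 < r < 1 ->
  Cmod (circle_coef (fun w => phi w - w)%C r n) <=
  2 * PI * (2 * (Cmod (phi 0%C) + Cmod (circle_coef (fun w => phi w - w)%C (1 / 2) 1) / PI)) * r ^ n.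
Proof.
  intros Hphi Hself Hr. assert (P := PI_RGT_0).
  set (d := fun w => (phi w - w)%C).
  assert (Hd : C1_disk d (fun w => phi' w - 1)%C) by (apply C1_disk_minus; [exact Hphi|apply C1_disk_id]).
  (* [b] is |phi'(0) - 1|: the coefficient of index 1 at radius 1/2 is 2 pi (1/2) (phi'(0) - 1). *)
  set (a := Cmod (phi 0%C)). set (b := Cmod (circle_coef d (1 / 2) 1) / PI).
  assert (a0 : 0 <= a) by apply Cmod_ge_0.
  assert (b0 : 0 <= b).
  { apply Rmult_le_pos; [apply Cmod_ge_0|]. left. apply Rinv_0_lt_compat, P. }
  assert (E1 : forall s, 0 < s < 1 -> Cmod (circle_coef d s 1) = 2 * PI * b * s).
  { intros s Hs. assert (E := circle_coef_radius d _ 1 s (1 / 2) Hd Hs ltac:(lra)).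
    apply (f_equal Cmod) in E. rewrite !Cmod_mult, !Cmod_R, !pow_1, !Rabs_pos_eq in E by lra.
    unfold b. apply Rmult_eq_reg_l with (1 / 2); [|lra]. rewrite E. field. lra. }
  assert (rn : 0 < r ^ n) by (apply pow_lt; lra).
  assert (Cphi := C1_disk_continuous _ _ Hphi).
  destruct n as [|[|k]].
  - rewrite (circle_coef_0 d _ r Hd Hr). unfold d. rewrite Cmod_mult, Cmod_R, Rabs_pos_eq by lra.
    replace (phi 0 - 0)%C with (phi 0%C) by ring. fold a. simpl. nra.
  - rewrite E1 by exact Hr. rewrite pow_1. 
    assert (0 <= PI * a * r) by (apply Rmult_le_pos; [apply Rmult_le_pos|]; lra).
    assert (0 <= PI * b * r) by (apply Rmult_le_pos; [apply Rmult_le_pos|]; lra). nra.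
  - set (n := S (S k)) in *.
    set (c := Cmod (circle_coef d r n)).
    assert (c0 : 0 <= c) by apply Cmod_ge_0.
    assert (Key : forall s, 0 < s < 1 -> Cmod (circle_coef d s n) <= 2 * PI * (2 * (1 - s) + 2 * b + a)).
    { intros s Hs.
      set (X := fun t => (phi (circle_pt s t) * expi (- INR 1 * t))%C).
      assert (CX : Ccts X).
      { apply Ccts_mult; [apply Ccts_circle; [exact Cphi|lra]|apply Ccts_expi]. }
      assert (MX : forall t, Cmod (X t) <= 1).
      { intros t. unfold X. rewrite Cmod_mult, Cmod_expi, Rmult_1_r. left. apply Hself, disk_circle_pt. lra. }
      set (u := fun t => 1 - Re (X t)).
      assert (u0 : forall t, 0 <= u t).
      { intros t. unfold u. assert (R1 := re_le_Cmod (X t)). assert (M1 := MX t).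
        assert (A1 := Rle_abs (Re (X t))). lra. }
      (* The mean of [u] involves only the coefficient of index 1 of [phi], which is 2 pi s up to an
         error of at most 2 pi b s. *)
      assert (Iu : RInt u 0 (2 * PI) <= 2 * PI * ((1 - s) + b)).
      { assert (E : circle_coef phi s 1 = (RtoC (2 * PI * s) + circle_coef d s 1)%C).
        { unfold d. rewrite circle_coef_minus, circle_coef_id by (try apply continuous_on_disk_id; assumption || lra).
          simpl. rewrite Rmult_1_r. ring. }
        unfold u. rewrite (RInt_minus (V := R_CompleteNormedModule) (fun _ => 1) (fun t => Re (X t))).
        2: apply ex_RInt_const. 2: apply (ex_RInt_Re X _ _ CX).
        rewrite RInt_const.
        change (RInt (fun t => Re (X t)) 0 (2 * PI)) with (Re (circle_coef phi s 1)). rewrite E.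
        change (Re (RtoC (2 * PI * s) + circle_coef d s 1)%C) with (2 * PI * s + Re (circle_coef d s 1)).
        assert (A1 := re_le_Cmod (circle_coef d s 1)). rewrite E1 in A1 by exact Hs.
        assert (A2 := Rle_abs (- Re (circle_coef d s 1))). rewrite Rabs_Ropp in A2.
        change ((2 * PI - 0) * 1 - (2 * PI * s + Re (circle_coef d s 1)) <= 2 * PI * (1 - s + b)).
        assert (2 * PI * b * s <= 2 * PI * b * 1).
        { apply Rmult_le_compat_l; [|lra]. apply Rmult_le_pos; [apply Rmult_le_pos|]; lra. }
        lra. }
      set (U := fun t => (RtoC (u t) * expi (- INR (S k) * t))%C).
      assert (CU : Ccts (fun t => RtoC (u t))).
      { intros t. apply Ccontinuous_RtoC. unfold u.
        apply (continuous_minus (V := R_NormedModule) (fun _ => 1)); [apply continuous_const|apply CX]. }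
      assert (B1 : Cmod (CInt U) <= 2 * PI * ((1 - s) + b)).
      { eapply Rle_trans; [|exact Iu]. eapply Rle_trans.
        - apply Cmod_CInt. apply Ccts_mult; [exact CU|apply Ccts_expi].
        - apply Req_le, RInt_ext. intros t _. unfold U.
          rewrite Cmod_mult, Cmod_expi, Cmod_R, Rabs_pos_eq, Rmult_1_r by apply u0. reflexivity. }
      (* The coefficient of index n of [phi] is that of index n - 1 = k + 1 of [X]. Since X = 2 Re X
         - conj X and Re X = 1 - u, it splits into a coefficient of [u], bounded by the mean of [u],
         and the conjugate of a coefficient of [X] of negative index. The constant 2 contributes
         nothing at index k + 1. *)
      assert (E2 : circle_coef phi s n =
        (- (RtoC 2 * CInt U) - Cconj (CInt (fun t => X t * expi (INR (S k) * t))))%C).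
      { assert (CE : Ccts (fun t => X t * expi (INR (S k) * t))%C).
        { apply Ccts_mult; [exact CX|apply Ccts_expi]. }
        assert (CU' : Ccts U) by (apply Ccts_mult; [exact CU|apply Ccts_expi]).
        transitivity (RtoC 2 * CInt (fun t => expi (- INR (S k) * t)) - RtoC 2 * CInt U
          - Cconj (CInt (fun t => X t * expi (INR (S k) * t))))%C.
        - rewrite <- CInt_conj by exact CE. rewrite <- !CInt_scal by (exact CU' || apply Ccts_expi).
          rewrite <- !CInt_minus.
          + apply CInt_ext. intros t. unfold U.
            rewrite Cmult_conj, <- expi_opp.
            replace (- (INR (S k) * t)) with (- INR (S k) * t) by ring.
            assert (ER : Cconj (X t) = (RtoC 2 * RtoC (Re (X t)) - X t)%C).
            { destruct (X t) as [x y]. unfold Cconj, Cmult, Cminus, Cplus, Copp, RtoC; simpl. f_equal; ring. }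
            rewrite ER. unfold u. rewrite RtoC_minus.
            replace (- INR n * t) with (- INR 1 * t + - INR (S k) * t).
            2: { unfold n. rewrite (S_INR (S k)). simpl (INR 1). ring. }
            rewrite expi_plus. unfold X. ring.
          + apply Ccts_minus; (apply Ccts_mult; [apply Ccts_const|]); [apply Ccts_expi|exact CU'].
          + apply Ccts_conj, CE.
          + apply Ccts_mult; [apply Ccts_const|apply Ccts_expi].
          + apply Ccts_mult; [apply Ccts_const|exact CU'].
        - rewrite CInt_expi_neg. ring. }
      assert (B2 : Cmod (CInt (fun t => X t * expi (INR (S k) * t))%C) <= 2 * PI * a).
      { rewrite (CInt_ext _ (fun t => phi (circle_pt s t) * expi (INR k * t))%C).
        2: { intros t. unfold X. rewrite <- Cmult_assoc, <- expi_plus. f_equal. f_equal.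
             rewrite (S_INR k). change (INR 1) with 1. ring. }
        (* Multiplying [X] by e^(i(k+1)t) leaves phi e^(ikt): its integral is 2 pi phi(0) if k = 0
           and vanishes otherwise. *)
        destruct k as [|k'].
        - apply Req_le. rewrite (CInt_ext _ (fun t => phi (circle_pt s t) * expi (- INR 0 * t))%C).
          + fold (circle_coef phi s 0). rewrite (circle_coef_0 phi phi' s Hphi Hs).
            rewrite Cmod_mult, Cmod_R, Rabs_pos_eq by lra. reflexivity.
          + intros t. simpl. f_equal. f_equal. ring.
        - rewrite (circle_coef_negative phi phi') by assumption. rewrite Cmod_0.
          apply Rmult_le_pos; [apply Rmult_le_pos|]; lra. }
      unfold d. rewrite circle_coef_minus, circle_coef_id by (try apply continuous_on_disk_id; assumption || lra).
      change (if Nat.eq_dec 1 n then RtoC (2 * PI * s ^ n) else 0%C) with (RtoC 0).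
      replace (circle_coef phi s n - 0)%C with (circle_coef phi s n) by ring. rewrite E2.
      eapply Rle_trans; [apply Cmod_minus_le|].
      rewrite Cmod_opp, Cmod_mult, Cmod_conj, Cmod_R, Rabs_pos_eq by lra. lra. }
    (* The estimate is carried from the radius s = 1 - e back to r. Bernoulli's inequality (1 - e)^n
       >= 1 - n e makes the loss linear in e: 4 pi r^n comes from 1 - s in [Key], and c n from
       Bernoulli. *)
    apply le_of_le_add_lin with (b := 4 * PI * r ^ n + c * INR n). intros e He.
    assert (E := circle_coef_radius d _ n r (1 - e) Hd Hr ltac:(lra)).
    apply (f_equal Cmod) in E. rewrite !Cmod_mult, !Cmod_R in E.
    assert (pe : 0 < (1 - e) ^ n) by (apply pow_lt; lra).
    rewrite !Rabs_pos_eq in E by lra. fold c in E.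
    specialize (Key (1 - e) ltac:(lra)).
    assert (Bern : 1 - INR n * e <= (1 - e) ^ n).
    { clear - He. induction n as [|n IH]; [simpl; lra|].
      rewrite S_INR, <- tech_pow_Rmult. assert (N := pos_INR n).
      assert ((1 - e) * (1 - INR n * e) <= (1 - e) * (1 - e) ^ n) by (apply Rmult_le_compat_l; lra).
      nra. }
    assert (A1 : c * (1 - INR n * e) <= c * (1 - e) ^ n) by (apply Rmult_le_compat_l; lra).
    assert (A2 : r ^ n * Cmod (circle_coef d (1 - e) n) <= r ^ n * (2 * PI * (2 * e + 2 * b + a))).
    { apply Rmult_le_compat_l; [lra|]. replace (2 * e) with (2 * (1 - (1 - e))) by ring. exact Key. }
    assert (0 <= PI * a * r ^ n) by (apply Rmult_le_pos; [apply Rmult_le_pos|]; lra).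
    nra.
Qed.

Lemma circle_pt_reduce (r t : R) :
  exists s, 0 <= s <= 2 * PI /\ circle_pt r s = circle_pt r t.
Proof.
  assert (P := two_PI_pos).
  set (k := Int_part (t / (2 * PI))).
  destruct (base_Int_part (t / (2 * PI))) as [K1 K2]. fold k in K1, K2.
  exists (t - IZR k * (2 * PI)).
  assert (T : t = t / (2 * PI) * (2 * PI)) by (field; lra).
  split.
  - split.
    + assert (IZR k * (2 * PI) <= t / (2 * PI) * (2 * PI)) by (apply Rmult_le_compat_r; lra). lra.
    + assert (t / (2 * PI) * (2 * PI) <= (IZR k + 1) * (2 * PI)) by (apply Rmult_le_compat_r; lra). lra.
  - rewrite !circle_pt_expi. f_equal.
    unfold Rminus. rewrite expi_plus.
    replace (expi (- (IZR k * (2 * PI)))) with (RtoC 1); [ring|].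
    destruct k as [|p|p]; symmetry.
    + rewrite Rmult_0_l, Ropp_0. apply expi_0.
    + rewrite <- (positive_nat_Z p), <- INR_IZR_INZ, Ropp_mult_distr_l. apply expi_neg_2PI.
    + rewrite <- Pos2Z.opp_pos, opp_IZR, <- (positive_nat_Z p), <- INR_IZR_INZ.
      rewrite Ropp_mult_distr_l, Ropp_involutive. apply expi_2PI.
Qed.

(** Lets the locally uniform continuity of the semigroup, stated for compact sets in the covering
    sense, be applied on a circle. *)
Lemma compact_circle (r : R) : compact_set (fun z => exists t, z = circle_pt r t).
Proof.
  intros I U HU Hcov.
  assert (L : forall x : R, exists q : posreal * I,
     forall s, Rabs (s - x) < fst q -> U (snd q) (circle_pt r s)).
  { intros x. destruct (Hcov (circle_pt r x) (ex_intro _ x eq_refl)) as [i Hi].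
    destruct (HU i _ Hi) as [e He].
    assert (Cx := Ccts_circle_pt r x). rewrite Ccontinuous_eps in Cx.
    destruct (Cx e (cond_pos e)) as [d Hd].
    exists (d, i). intros s Hs. apply He. specialize (Hd s Hs).
    assert (M := Rmax_Cmod (circle_pt r s - circle_pt r x)%C).
    split.
    - change (Rabs (Re (circle_pt r s - circle_pt r x)%C) < e).
      eapply Rle_lt_trans; [apply re_le_Cmod|exact Hd].
    - change (Rabs (Im (circle_pt r s - circle_pt r x)%C) < e).
      eapply Rle_lt_trans; [apply im_le_Cmod|exact Hd]. }
  destruct (functional_choice _ L) as [q Hq].
  (* The covering theorem for boxes in dimension 1, where a point is a pair [(x, tt)]; its
     conclusion is doubly negated. *)
  assert (F := compactness_list 1 (0, tt) (2 * PI, tt) (fun x => fst (q (fst x)))).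
  apply NNPP in F. destruct F as [l Hl].
  exists (map (fun x => snd (q (fst x))) l).
  intros z [t ->]. destruct (circle_pt_reduce r t) as [s [Hs <-]].
  destruct (Hl (s, tt)) as [x [Hx [_ Hc]]]; [simpl; tauto|].
  exists (snd (q (fst x))). split.
  - apply (in_map (fun x => snd (q (fst x)))), Hx.
  - apply Hq. destruct x as [x []]. simpl in Hc |- *. tauto.
Qed.

(** The left side is a polynomial in z and d with nonnegative coefficients, hence is dominated by
    its value at |z| and |z| x. *)
Lemma binomial_majorant (z d : C) (x : R) (n : nat) :
  0 <= x -> Cmod d <= Cmod z * x ->
  Cmod ((z + d) ^ S n - z ^ S n - RtoC (INR (S n)) * (z ^ n * d))%C <=
  Cmod z ^ S n * ((1 + x) ^ S n - 1 - INR (S n) * x).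
Proof.
  intros Hx Hd. assert (Z0 := Cmod_ge_0 z).
  induction n as [|n IH].
  - simpl. replace ((z + d) * 1 - z * 1 - 1 * (1 * d))%C with (RtoC 0) by ring.
    rewrite Cmod_0. apply Req_le. ring.
  - replace ((z + d) ^ S (S n) - z ^ S (S n) - RtoC (INR (S (S n))) * (z ^ S n * d))%C with
      (((z + d) ^ S n - z ^ S n - RtoC (INR (S n)) * (z ^ n * d)) * (z + d)
       + RtoC (INR (S n)) * (z ^ n * (d * d)))%C.
    2: { rewrite (S_INR (S n)), RtoC_plus, !Cpow_S. ring. }
    eapply Rle_trans; [apply Cmod_triangle|].
    rewrite !Cmod_mult, Cmod_pow, Cmod_R, Rabs_pos_eq by apply pos_INR.
    set (E := Cmod ((z + d) ^ S n - z ^ S n - RtoC (INR (S n)) * (z ^ n * d))%C) in *.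
    assert (E0 : 0 <= E) by apply Cmod_ge_0.
    assert (T : Cmod (z + d)%C <= Cmod z * (1 + x)).
    { eapply Rle_trans; [apply Cmod_triangle|]. lra. }
    assert (D0 := Cmod_ge_0 d). assert (T0 := Cmod_ge_0 (z + d)%C).
    assert (D2 : Cmod d * Cmod d <= (Cmod z * x) * (Cmod z * x)) by (apply Rmult_le_compat; assumption).
    assert (A1 : E * Cmod (z + d)%C <=
      (Cmod z ^ S n * ((1 + x) ^ S n - 1 - INR (S n) * x)) * (Cmod z * (1 + x))).
    { apply Rmult_le_compat; assumption. }
    assert (A2 : INR (S n) * (Cmod z ^ n * (Cmod d * Cmod d)) <=
      INR (S n) * (Cmod z ^ n * ((Cmod z * x) * (Cmod z * x)))).
    { apply Rmult_le_compat_l; [apply pos_INR|]. apply Rmult_le_compat_l; [apply pow_le, Z0|exact D2]. }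
    eapply Rle_trans; [apply Rplus_le_compat; [exact A1|exact A2]|].
    apply Req_le. rewrite (S_INR (S n)), <- !tech_pow_Rmult. ring.
Qed.

(** A polynomial form of (1 + x)^n <= exp y <= 1 + y + y^2 for y = n x in [0, 1]. *)
Lemma pow_one_plus_le (x : R) (n : nat) : 0 <= x -> INR n * x <= 1 ->
  (1 + x) ^ n <= 1 + INR n * x + (INR n * x) ^ 2.
Proof.
  intros Hx. induction n as [|n IH]; intros H.
  - simpl. lra.
  - assert (N := pos_INR n). rewrite S_INR in *.
    specialize (IH ltac:(nra)). rewrite <- tech_pow_Rmult.
    apply Rle_trans with ((1 + x) * (1 + INR n * x + (INR n * x) ^ 2)).
    { apply Rmult_le_compat_l; lra. }
    assert (H1 : INR n * x * (INR n * x ^ 2) <= 1 * (INR n * x ^ 2)).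
    { apply Rmult_le_compat_r; [|nra]. apply Rmult_le_pos; [exact N|apply pow2_ge_0]. }
    assert (0 <= x ^ 2) by apply pow2_ge_0.
    assert (0 <= INR n * x ^ 2) by (apply Rmult_le_pos; assumption). simpl in *. nra.
Qed.

Lemma circle_coef_bound (f : C -> C) (r B : R) (n : nat) :
  continuous_on_disk f -> 0 <= r < 1 -> (forall t, Cmod (f (circle_pt r t)) <= B) ->
  Cmod (circle_coef f r n) <= 2 * PI * B.
Proof.
  intros Hf Hr HB. apply Cmod_CInt_bound.
  - apply Ccts_mult; [apply Ccts_circle; assumption|apply Ccts_expi].
  - intros t. rewrite Cmod_mult, Cmod_expi, Rmult_1_r. apply HB.
Qed.

Lemma continuous_on_disk_pow (f : C -> C) (m : nat) :
  continuous_on_disk f -> continuous_on_disk (fun z => f z ^ m)%C.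
Proof.
  intros H z Hz. induction m as [|m IH].
  - apply (Ccontinuous_at_const 1%C).
  - apply (Ccontinuous_at_mult f (fun z => f z ^ m)%C); [apply H, Hz|exact IH].
Qed.

Lemma continuous_on_disk_minus (f g : C -> C) : continuous_on_disk f -> continuous_on_disk g ->
  continuous_on_disk (fun z => f z - g z)%C.
Proof. intros H K z Hz. apply Ccontinuous_at_minus; [apply H, Hz|apply K, Hz]. Qed.

(** The lower bound is relative to (1/2)^M, hence absolute for Taylor coefficients. The closeness
    required on |z| = 1/2 makes delta so small that the exponent, of order 1/delta, exceeds [n0]. *)
Lemma self_map_pow_coef (phi phi' : C -> C) (n0 : nat) :
  C1_disk phi phi' -> (forall z, disk z -> disk (phi z)) ->
  (exists z, disk z /\ phi z <> z) ->
  (forall t, Cmod (phi (circle_pt (1 / 2) t) - circle_pt (1 / 2) t)%C <= / (512 * 3 * (INR n0 + 3))) ->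
  exists M m, (n0 <= M)%nat /\ (1 <= M)%nat /\ (m = M \/ m = S M) /\
    2 * PI / 4096 * (1 / 2) ^ M <= Cmod (circle_coef (fun z => phi z ^ m - z ^ m)%C (1 / 2) M).
Proof.
  intros Hphi Hself [z1 [Hz1 Nz1]] Hsmall. assert (P := PI_RGT_0).
  set (e := / (512 * 3 * (INR n0 + 3))) in *. assert (N0 := pos_INR n0).
  set (d := fun w => (phi w - w)%C).
  assert (Hd : C1_disk d (fun w => phi' w - 1)%C) by (apply C1_disk_minus; [exact Hphi|apply C1_disk_id]).
  assert (Cd := C1_disk_continuous _ _ Hd). assert (Cphi := C1_disk_continuous _ _ Hphi).
  set (a := Cmod (phi 0%C)). set (b := Cmod (circle_coef d (1 / 2) 1) / PI).
  assert (a0 : 0 <= a) by apply Cmod_ge_0.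
  assert (b0 : 0 <= b).
  { apply Rmult_le_pos; [apply Cmod_ge_0|]. left. apply Rinv_0_lt_compat, P. }
  assert (Hcoef : forall n r, 0 < r < 1 -> Cmod (circle_coef d r n) <= 2 * PI * (2 * (a + b)) * r ^ n).
  { intros n r Hr. exact (self_map_coef_bound phi phi' n r Hphi Hself Hr). }
  assert (Hdz : forall z, disk z -> Cmod (d z) <= 2 * (a + b) / (1 - Cmod z)).
  { intros z Hz. apply (sup_bound_of_coefs d _ 2 (2 * (a + b)) z Hd); [|lra|exact Hcoef|exact Hz].
    intros w Hw. unfold d. eapply Rle_trans; [apply Cmod_minus_le|].
    assert (W := Hself w Hw). unfold disk in W, Hw. lra. }
  assert (Ea : Cmod (circle_coef d (1 / 2) 0) = 2 * PI * a).
  { rewrite (circle_coef_0 d _ _ Hd) by lra. unfold d. rewrite Cmod_mult, Cmod_R, Rabs_pos_eq by lra.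
    replace (phi 0 - 0)%C with (phi 0%C) by ring. reflexivity. }
  assert (Eb : Cmod (circle_coef d (1 / 2) 1) = PI * b) by (unfold b; field; lra).
  assert (La : a <= e).
  { apply Rmult_le_reg_l with (2 * PI); [lra|]. rewrite <- Ea.
    apply circle_coef_bound; [exact Cd|lra|exact Hsmall]. }
  assert (Lb : b <= 2 * e).
  { apply Rmult_le_reg_l with PI; [lra|]. rewrite <- Eb.
    replace (PI * (2 * e)) with (2 * PI * e) by ring.
    apply circle_coef_bound; [exact Cd|lra|exact Hsmall]. }
  set (del := a + b) in *.
  (* If delta were 0, the bound [Hdz] would make phi - id vanish on the whole disk. *)
  assert (dpos : 0 < del).
  { destruct (Rle_lt_dec del 0) as [D|D]; [|exact D]. exfalso. apply Nz1.
    assert (Z := Hdz z1 Hz1). replace del with 0 in Z by (unfold del in *; lra).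
    replace (2 * 0 / (1 - Cmod z1)) with 0 in Z by (unfold Rdiv; ring).
    assert (Z' : d z1 = 0%C) by (apply Cmod_eq_0; assert (Q := Cmod_ge_0 (d z1)); lra).
    unfold d in Z'. transitivity (phi z1 - z1 + z1)%C; [ring|]. rewrite Z'. ring. }
  (* The target value of N delta. The linear term will be at least 2 pi (1/2)^N kap/4 = 2 pi (1/2)^N
     / 2048, and the remainder at most 2 pi (1/2)^N (8 kap)^2 = 2 pi (1/2)^N / 4096, half of it. *)
  set (kap := / 512).
  assert (Hdel : del * (INR n0 + 3) <= kap).
  { apply Rle_trans with ((3 * e) * (INR n0 + 3)).
    - apply Rmult_le_compat_r; [lra|]. unfold del. lra.
    - apply Req_le. unfold e, kap. field. lra. }
  assert (kd : INR n0 + 3 <= kap / del).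
  { apply Rmult_le_reg_r with del; [exact dpos|]. unfold Rdiv. rewrite Rmult_assoc, Rinv_l; lra. }
  (* N is the integer part of kap/delta. As kap/delta >= n0 + 3 >= 3, rounding down loses at most
     half and leaves N > n0 + 2. *)
  destruct (nfloor_ex (kap / del)) as [N [HN1 HN2]]; [lra|].
  assert (HNn : (n0 + 2 < N)%nat).
  { apply INR_lt. rewrite plus_INR. simpl (INR 2). lra. }
  destruct N as [|n]; [lia|].
  assert (kdE : kap / del * del = kap) by (field; lra).
  assert (U1 : INR (S n) * del <= kap).
  { rewrite <- kdE. apply Rmult_le_compat_r; lra. }
  assert (U2 : kap / 2 <= INR (S n) * del).
  { assert ((kap / del) / 2 <= INR (S n)) by lra.
    replace (kap / 2) with (kap / del / 2 * del) by (field; lra).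
    apply Rmult_le_compat_r; lra. }
  (* At |z| = 1/2 the bound 2 delta / (1 - |z|) is 4 delta = |z| (8 delta), the form that
     [binomial_majorant] expects. *)
  assert (Hd2 : forall t, Cmod (d (circle_pt (1 / 2) t)) <= Cmod (circle_pt (1 / 2) t) * (8 * del)).
  { intros t. eapply Rle_trans; [apply Hdz, disk_circle_pt; lra|].
    rewrite Cmod_circle_pt by lra. apply Req_le. field. }
  assert (Hrem : forall M, exists r, Cmod r <= 2 * PI * ((1 / 2) ^ S n / 4096) /\
    circle_coef (fun z => phi z ^ S n - z ^ S n)%C (1 / 2) M =
    (RtoC (INR (S n)) * CInt (fun t => circle_pt (1 / 2) t ^ n * d (circle_pt (1 / 2) t) * expi (- INR M * t)) + r)%C).
  { intros M.
    exists (circle_coef (fun z => phi z ^ S n - z ^ S n - RtoC (INR (S n)) * (z ^ n * d z))%C (1 / 2) M).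
    assert (C1 : continuous_on_disk (fun z => phi z ^ S n - z ^ S n)%C).
    { apply continuous_on_disk_minus; apply continuous_on_disk_pow; [exact Cphi|apply continuous_on_disk_id]. }
    assert (C2 : continuous_on_disk (fun z => z ^ n * d z)%C).
    { intros z Hz. apply (Ccontinuous_at_mult (fun z => z ^ n)%C d); [|apply Cd, Hz].
      apply (continuous_on_disk_pow (fun z => z)); [apply continuous_on_disk_id|exact Hz]. }
    assert (C3 : continuous_on_disk (fun z => RtoC (INR (S n)) * (z ^ n * d z))%C).
    { intros z Hz. apply Ccontinuous_at_mult; [apply Ccontinuous_at_const|apply C2, Hz]. }
    split.
    - apply circle_coef_bound; [apply continuous_on_disk_minus; assumption|lra|].
      intros t. set (w := circle_pt (1 / 2) t).
      replace (phi w) with (w + d w)%C by (unfold d; ring).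
      eapply Rle_trans; [apply (binomial_majorant w (d w) (8 * del) n); [lra|apply Hd2]|].
      unfold w. rewrite Cmod_circle_pt by lra. unfold Rdiv at 3.
      apply Rmult_le_compat_l; [apply pow_le; lra|].
      assert (B := pow_one_plus_le (8 * del) (S n) ltac:(lra) ltac:(unfold kap in *; lra)).
      assert ((INR (S n) * (8 * del)) ^ 2 <= (8 * kap) ^ 2).
      { apply pow_incr. split; [|lra]. apply Rmult_le_pos; [apply pos_INR|lra]. }
      unfold kap in *. lra.
    - rewrite (circle_coef_minus _ _ _ M C1 C3) by lra.
      replace (circle_coef (fun z => RtoC (INR (S n)) * (z ^ n * d z))%C (1 / 2) M) with
        (CInt (fun t => RtoC (INR (S n)) * (circle_pt (1 / 2) t ^ n * d (circle_pt (1 / 2) t) * expi (- INR M * t)))%C)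
        by (apply CInt_ext; intros; ring).
      rewrite CInt_scal.
      + ring.
      + apply Ccts_mult; [|apply Ccts_expi].
        apply (Ccts_circle (fun z => z ^ n * d z)%C); [exact C2|lra]. }
  (* Multiplication by z^n shifts indices: the coefficients of index n and n + 1 of z^n d come from
     d(0) = phi(0) and d'(0) = phi'(0) - 1. *)
  assert (Hmain : forall M, M = n \/ M = S n ->
    CInt (fun t => circle_pt (1 / 2) t ^ n * d (circle_pt (1 / 2) t) * expi (- INR M * t))%C =
    (RtoC ((1 / 2) ^ n) * circle_coef d (1 / 2) (M - n))%C).
  { intros M HM. unfold circle_coef. rewrite <- CInt_scal.
    - apply CInt_ext. intros t.
      replace (circle_pt (1 / 2) t ^ n)%C with (RtoC ((1 / 2) ^ n) * expi (INR n * t))%C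
        by (rewrite circle_pt_expi, Cpow_mult_l, expi_pow, <- RtoC_pow; reflexivity).
      replace (- INR M * t) with (- INR n * t + - INR (M - n) * t).
      2: { rewrite minus_INR by lia. ring. }
      rewrite expi_plus. replace (- INR n * t) with (- (INR n * t)) by ring.
      transitivity ((expi (INR n * t) * expi (- (INR n * t))) *
        (RtoC ((1 / 2) ^ n) * (d (circle_pt (1 / 2) t) * expi (- INR (M - n) * t))))%C; [ring|].
      rewrite expi_inv. ring.
    - apply Ccts_mult; [apply Ccts_circle; [exact Cd|lra]|apply Ccts_expi]. }
  assert (Pn : 0 < (1 / 2) ^ n) by (apply pow_lt; lra).
  (* If |phi'(0) - 1| carries half of delta, the coefficient of index N is used; otherwise |phi(0)|
     does, and the index is N - 1. *)
  destruct (Rle_lt_dec (del / 2) b) as [Cb|Cb].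
  - exists (S n), (S n). split; [lia|]. split; [lia|]. split; [left; reflexivity|].
    destruct (Hrem (S n)) as [r [Br ->]]. rewrite Hmain by (right; reflexivity).
    replace (S n - n)%nat with 1%nat by lia.
    assert (T := Cmod_reverse_triangle (RtoC (INR (S n)) * (RtoC ((1 / 2) ^ n) * circle_coef d (1 / 2) 1))%C r).
    rewrite !Cmod_mult, !Cmod_R, Eb in T.
    rewrite (Rabs_pos_eq (INR (S n))), Rabs_pos_eq in T by (apply pos_INR || lra).
    rewrite <- tech_pow_Rmult in *.
    assert (Q : INR (S n) * (del / 2) <= INR (S n) * b) by (apply Rmult_le_compat_l; [apply pos_INR|exact Cb]).
    assert (Q2 : PI * (1 / 2) ^ n * (kap / 4) <= PI * (1 / 2) ^ n * (INR (S n) * b)).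
    { apply Rmult_le_compat_l; [|lra]. apply Rmult_le_pos; lra. }
    unfold kap in *. lra.
  - exists n, (S n). split; [lia|]. split; [lia|]. split; [right; reflexivity|].
    destruct (Hrem n) as [r [Br ->]]. rewrite Hmain by (left; reflexivity).
    replace (n - n)%nat with 0%nat by lia.
    assert (T := Cmod_reverse_triangle (RtoC (INR (S n)) * (RtoC ((1 / 2) ^ n) * circle_coef d (1 / 2) 0))%C r).
    rewrite !Cmod_mult, !Cmod_R, Ea in T.
    rewrite (Rabs_pos_eq (INR (S n))), Rabs_pos_eq in T by (apply pos_INR || lra).
    rewrite <- tech_pow_Rmult in *.
    assert (Ca : del / 2 <= a) by (unfold del in *; lra).
    assert (Q : INR (S n) * (del / 2) <= INR (S n) * a) by (apply Rmult_le_compat_l; [apply pos_INR|exact Ca]).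
    assert (Q2 : PI * (1 / 2) ^ n * (kap / 4) <= PI * (1 / 2) ^ n * (INR (S n) * a)).
    { apply Rmult_le_compat_l; [|lra]. apply Rmult_le_pos; lra. }
    assert (0 < PI * (1 / 2) ^ n) by (apply Rmult_lt_0_compat; lra).
    unfold kap in *. lra.
Qed.

Lemma semigroup_pow_coef (phi : R -> C -> C) (t0 : R) (n0 : nat) :
  analytic_semigroup phi -> nontrivial phi ->
  (forall t, 0 <= t -> exists phi', C1_disk (phi t) phi') -> 0 < t0 ->
  exists t M m, 0 < t < t0 /\ (n0 <= M)%nat /\ (1 <= M)%nat /\ (m = M \/ m = S M) /\
    2 * PI / 4096 * (1 / 2) ^ M <= Cmod (circle_coef (fun z => phi t z ^ m - z ^ m)%C (1 / 2) M).
Proof.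
  intros Hs [t1 [z1 [Ht1 [Hz1 N1]]]] HC1 Ht0.
  assert (N0 := pos_INR n0).
  assert (He : 0 < / (512 * 3 * (INR n0 + 3))) by (apply Rinv_0_lt_compat; lra).
  destruct (semigroup_cont _ Hs _ (compact_circle (1 / 2))) with (eps := mkposreal _ He) as [del Hdel].
  { intros z [t ->]. apply disk_circle_pt. lra. }
  assert (Hd := cond_pos del).
  (* If phi_t were the identity for all small t > 0, then so would phi_(t1) be, as an iterate of
     phi_(t1/(k+1)) for k large. *)
  assert (Ex : exists t z, 0 < t < Rmin t0 del /\ disk z /\ phi t z <> z).
  { apply NNPP. intros H. apply N1.
    assert (Hid : forall t, 0 < t < Rmin t0 del -> forall z, disk z -> phi t z = z).
    { intros t Ht z Hz. apply NNPP. intros Nz. apply H. exists t, z. tauto. }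
    assert (mp : 0 < Rmin t0 del) by (apply Rmin_glb_lt; assumption).
    destruct (Req_dec t1 0) as [->|Nt].
    { apply (semigroup_id _ Hs), Hz1. }
    destruct (nfloor_ex (t1 / Rmin t0 del)) as [k [_ Hk]].
    { apply Rmult_le_pos; [lra|]. left. apply Rinv_0_lt_compat, mp. }
    rewrite <- S_INR in Hk.
    assert (Sk : 0 < INR (S k)) by (apply lt_0_INR; lia).
    set (u := t1 / INR (S k)).
    assert (Hu : 0 < u < Rmin t0 del).
    { split; [apply Rdiv_lt_0_compat; lra|].
      apply Rmult_lt_reg_r with (INR (S k)); [exact Sk|]. unfold u, Rdiv.
      rewrite Rmult_assoc, Rinv_l, Rmult_1_r by lra.
      apply Rmult_lt_reg_r with (/ Rmin t0 del); [apply Rinv_0_lt_compat, mp|].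
      replace (Rmin t0 del * INR (S k) * / Rmin t0 del) with (INR (S k)) by (field; lra). exact Hk. }
    assert (It : forall j, phi (INR j * u) z1 = z1).
    { induction j as [|j IH].
      - simpl. rewrite Rmult_0_l. apply (semigroup_id _ Hs), Hz1.
      - rewrite S_INR. replace ((INR j + 1) * u) with (u + INR j * u) by ring.
        rewrite (semigroup_comp _ Hs); [|lra| |exact Hz1].
        + rewrite IH. apply Hid; assumption.
        + apply Rmult_le_pos; [apply pos_INR|lra]. }
    rewrite <- (It (S k)) at 2. f_equal. unfold u. field. lra. }
  destruct Ex as [t [z [Ht [Hz Nz]]]].
  assert (Tt := Rmin_l t0 del). assert (Td := Rmin_r t0 del).
  destruct (HC1 t ltac:(lra)) as [phi' Hphi].
  destruct (self_map_pow_coef (phi t) phi' n0 Hphi) as [M [m Hm]].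
  - intros w Hw. apply (semigroup_self_map _ Hs); [lra|exact Hw].
  - exists z. tauto.
  - intros s. left. specialize (Hdel t ltac:(lra) (circle_pt (1 / 2) s) (ex_intro _ s eq_refl)).
    rewrite (semigroup_id _ Hs) in Hdel by (apply disk_circle_pt; lra). exact Hdel.
  - exists t, M, m. split; [lra|exact Hm].
Qed.

(** * Integral means and the norm of H(p,infty,alpha) *)

Lemma circle_sup_attained (f : C -> C) (r : R) : continuous_on_disk f -> 0 <= r < 1 ->
  exists t0, forall t, Cmod (f (circle_pt r t)) <= Cmod (f (circle_pt r t0)).
Proof.
  intros Hf Hr. assert (P := two_PI_pos).
  destruct (continuity_ab_maj (fun t => Cmod (f (circle_pt r t))) 0 (2 * PI)) as [t0 [H _]].
  - lra.
  - intros t _. apply continuity_pt_filterlim. apply (continuous_Cmod (fun t => f (circle_pt r t))).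
    apply (Ccts_circle f r Hf Hr).
  - exists t0. intros t. destruct (circle_pt_reduce r t) as [s [Hs <-]]. apply H, Hs.
Qed.

Lemma rpow_nonneg (x q : R) : 0 <= rpow x q.
Proof.
  unfold rpow. destruct (Req_EM_T x 0); [lra|]. left. apply exp_pos.
Qed.

Lemma rpow_pos (x q : R) : 0 < x -> rpow x q = Rpower x q.
Proof. intros H. unfold rpow. destruct (Req_EM_T x 0); [lra|reflexivity]. Qed.

Lemma rpow_0 (q : R) : rpow 0 q = 0.
Proof. unfold rpow. destruct (Req_EM_T 0 0); [reflexivity|lra]. Qed.

Lemma rpow_le (x y q : R) : 0 < q -> 0 <= x <= y -> rpow x q <= rpow y q.
Proof.
  intros Hq [Hx Hy]. destruct (Req_dec x 0) as [->|N].
  - rewrite rpow_0. apply rpow_nonneg.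
  - rewrite !rpow_pos by lra. apply Rle_Rpower_l; lra.
Qed.

Lemma rpow_rpow_inv (x q : R) : 0 < q -> 0 <= x -> rpow (rpow x q) (/ q) = x.
Proof.
  intros Hq Hx. destruct (Req_dec x 0) as [->|N].
  - rewrite !rpow_0. reflexivity.
  - rewrite (rpow_pos x) by lra. rewrite rpow_pos by apply exp_pos.
    rewrite Rpower_mult, Rinv_r, Rpower_1; lra.
Qed.

Lemma ln_ge_one_minus_inv (y : R) : 0 < y -> 1 - / y <= ln y.
Proof.
  intros Hy. assert (Hi : 0 < / y) by (apply Rinv_0_lt_compat, Hy).
  assert (E := exp_ineq1_le (ln (/ y))). rewrite exp_ln in E by exact Hi.
  rewrite ln_Rinv in E by exact Hy. lra.
Qed.

(* From y^q = y exp((q-1) ln y) and y ln y >= y - 1. *)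
Lemma rpow_Bernoulli (y q : R) : 1 <= q -> 0 <= y -> 1 + q * (y - 1) <= rpow y q.
Proof.
  intros Hq Hy. destruct (Req_dec y 0) as [->|N].
  - rewrite rpow_0. lra.
  - rewrite rpow_pos by lra.
    replace q with (1 + (q - 1)) at 2 by ring.
    rewrite Rpower_plus, Rpower_1 by lra. unfold Rpower.
    assert (E := exp_ineq1_le ((q - 1) * ln y)).
    assert (L := ln_ge_one_minus_inv y ltac:(lra)).
    assert (E1 : y * (1 + (q - 1) * ln y) <= y * exp ((q - 1) * ln y)) by (apply Rmult_le_compat_l; lra).
    assert (E2 : y * (1 - / y) <= y * ln y) by (apply Rmult_le_compat_l; lra).
    assert (E3 : y * (1 - / y) = y - 1) by (field; lra).
    assert (E4 : (q - 1) * (y - 1) <= (q - 1) * (y * ln y)) by (apply Rmult_le_compat_l; lra).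
    lra.
Qed.

(** Convexity of x^q: the graph lies above its tangent at [a]. This is Bernoulli's inequality for
    x/a. *)
Lemma rpow_tangent (x a q : R) : 1 <= q -> 0 <= x -> 0 < a ->
  Rpower a q + q * Rpower a q / a * (x - a) <= rpow x q.
Proof.
  intros Hq Hx Ha.
  assert (B := rpow_Bernoulli (x / a) q Hq ltac:(apply Rmult_le_pos; [exact Hx|left; apply Rinv_0_lt_compat, Ha])).
  assert (Pa : 0 < Rpower a q) by apply exp_pos.
  replace (rpow x q) with (Rpower a q * rpow (x / a) q).
  - apply Rle_trans with (Rpower a q * (1 + q * (x / a - 1))).
    + apply Req_le. field. lra.
    + apply Rmult_le_compat_l; lra.
  - destruct (Req_dec x 0) as [->|N].
    + unfold Rdiv. rewrite Rmult_0_l, !rpow_0. ring.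
    + assert (0 < x / a) by (apply Rdiv_lt_0_compat; lra).
      rewrite !rpow_pos by lra. rewrite Rpower_mult_distr by assumption.
      f_equal. field. lra.
Qed.

Lemma continuous_rpow (x : R -> R) (q t : R) : 1 <= q -> (forall s, 0 <= x s) ->
  continuous x t -> continuous (fun s => rpow (x s) q) t.
Proof.
  intros Hq Hx Hc. destruct (Req_dec (x t) 0) as [E|N].
  - apply filterlim_locally. intros eps.
    assert (He : 0 < Rmin 1 eps) by (apply Rmin_glb_lt; [lra|apply cond_pos]).
    assert (L := Hc _ (locally_ball (x t) (mkposreal _ He))).
    generalize L. unfold filtermap. apply filter_imp. intros s Hs.
    change (Rabs (x s - x t) < Rmin 1 eps) in Hs.
    change (Rabs (rpow (x s) q - rpow (x t) q) < eps).
    rewrite E in *. rewrite rpow_0, Rminus_0_r, Rabs_pos_eq by apply rpow_nonneg.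
    rewrite Rminus_0_r, Rabs_pos_eq in Hs by apply Hx.
    assert (A1 := Rmin_l 1 eps). assert (A2 := Rmin_r 1 eps). specialize (Hx s).
    destruct (Req_dec (x s) 0) as [->|N]; [rewrite rpow_0; lra|].
    rewrite rpow_pos by lra.
    (* Near a zero of [x] one has x <= 1, and q >= 1 then gives x^q <= x. *)
    apply Rle_lt_trans with (x s); [|lra].
    rewrite <- (Rpower_1 (x s)) at 2 by lra. unfold Rpower.
    assert (L2 : ln (x s) <= 0). { rewrite <- ln_1. apply ln_le; lra. }
    destruct (Req_dec (q * ln (x s)) (1 * ln (x s))) as [->|N2]; [lra|].
    left. apply exp_increasing. nra.
  - assert (Pt : 0 < x t) by (specialize (Hx t); lra).
    apply continuous_ext_loc with (fun s => Rpower (x s) q).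
    + assert (L := Hc _ (locally_ball (x t) (mkposreal _ Pt))).
      generalize L. unfold filtermap. apply filter_imp. intros s Hs.
      change (Rabs (x s - x t) < x t) in Hs. apply Rabs_def2 in Hs.
      symmetry. apply rpow_pos. lra.
    + apply (continuous_comp x (fun y => Rpower y q)); [exact Hc|].
      apply (ex_derive_continuous (K := R_AbsRing) (V := R_NormedModule)).
      unfold Rpower. auto_derive. exact Pt.
Qed.

Lemma continuous_rpow_circle (g : C -> C) (r q : R) :
  1 <= q -> continuous_on_disk g -> 0 <= r < 1 ->
  forall t, continuous (fun t => rpow (Cmod (g (circle_pt r t))) q / (2 * PI)) t.
Proof.
  intros Hq Hg Hr t.
  apply (continuous_mult (K := R_AbsRing) (fun t => rpow (Cmod (g (circle_pt r t))) q) (fun _ => / (2 * PI)));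
    [|apply continuous_const].
  apply (continuous_rpow (fun t => Cmod (g (circle_pt r t)))); [exact Hq|intros; apply Cmod_ge_0|].
  apply (continuous_Cmod (fun t => g (circle_pt r t))), (Ccts_circle g r Hg Hr).
Qed.

Lemma RInt_le_cts (f g : R -> R) :
  (forall t, continuous f t) -> (forall t, continuous g t) -> (forall t, f t <= g t) ->
  RInt f 0 (2 * PI) <= RInt g 0 (2 * PI).
Proof.
  intros Hf Hg H. assert (P := two_PI_pos).
  apply RInt_le; [lra|apply ex_RInt_cts, Hf|apply ex_RInt_cts, Hg|intros; apply H].
Qed.

Lemma RInt_const_2PI (c : R) : RInt (fun _ => c) 0 (2 * PI) = 2 * PI * c.
Proof. rewrite RInt_const. unfold scal; simpl. unfold mult; simpl. ring. Qed.

(** Jensen's inequality for finite p, by integrating the tangent of x^q at the mean; it reduces all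
    exponents to the L^1 mean, which dominates Fourier coefficients. *)
Lemma mean_le_Mp (p : Rbar) (r : R) (g : C -> C) :
  Rbar_le 1 p -> continuous_on_disk g -> 0 <= r < 1 ->
  RInt (fun t => Cmod (g (circle_pt r t))) 0 (2 * PI) <= 2 * PI * Mp p r g.
Proof.
  intros Hp Hg Hr. assert (P := two_PI_pos).
  set (x := fun t => Cmod (g (circle_pt r t))).
  assert (Cx : forall t, continuous x t).
  { intros t. apply (continuous_Cmod (fun t => g (circle_pt r t))), (Ccts_circle g r Hg Hr). }
  assert (x0 : forall t, 0 <= x t) by (intros; apply Cmod_ge_0).
  destruct p as [q| |]; simpl in Hp; [| |contradiction].
  - unfold Mp. fold (x).
    set (a := RInt x 0 (2 * PI) / (2 * PI)).
    assert (a0 : 0 <= a).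
    { apply Rmult_le_pos; [|left; apply Rinv_0_lt_compat, P].
      apply RInt_ge_0; [lra|apply ex_RInt_cts, Cx|intros; apply x0]. }
    replace (RInt x 0 (2 * PI)) with (2 * PI * a) by (unfold a; field; lra).
    apply Rmult_le_compat_l; [lra|].
    destruct (Req_dec a 0) as [->|Na]; [apply rpow_nonneg|].
    assert (Pa : 0 < Rpower a q) by apply exp_pos.
    rewrite <- (rpow_rpow_inv a q) at 1 by lra.
    apply rpow_le; [apply Rinv_0_lt_compat; lra|]. split; [apply rpow_nonneg|].
    rewrite rpow_pos by lra.
    set (c := q * Rpower a q / a).
    assert (Ca : forall t, continuous (fun t => c / (2 * PI) * x t) t).
    { intros t. apply (continuous_mult (K := R_AbsRing) (fun _ => c / (2 * PI)) x); [apply continuous_const|apply Cx]. }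
    (* The average of the tangent line at [a] is exactly a^q, because [a] is the mean of [x]. *)
    apply Rle_trans with (RInt (fun t => (Rpower a q - c * a) / (2 * PI) + c / (2 * PI) * x t) 0 (2 * PI)).
    + apply Req_le.
      rewrite (RInt_plus (V := R_CompleteNormedModule) (fun _ => (Rpower a q - c * a) / (2 * PI)) (fun t => c / (2 * PI) * x t)).
      * rewrite RInt_const_2PI.
        rewrite (RInt_scal (V := R_CompleteNormedModule) x); [|apply ex_RInt_cts, Cx].
        unfold plus, scal; simpl. unfold mult; simpl.
        replace (RInt x 0 (2 * PI)) with (2 * PI * a) by (unfold a; field; lra). field. lra.
      * apply ex_RInt_const.
      * apply ex_RInt_cts, Ca.
    + apply RInt_le_cts.
      * intros t. apply (continuous_plus (V := R_NormedModule)); [apply continuous_const|apply Ca].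
      * apply continuous_rpow_circle; assumption.
      * intros t. assert (T := rpow_tangent (x t) a q Hp (x0 t) ltac:(lra)). fold c in T.
        replace ((Rpower a q - c * a) / (2 * PI) + c / (2 * PI) * x t) with
          ((Rpower a q + c * (x t - a)) / (2 * PI)) by (field; lra).
        apply Rmult_le_compat_r; [left; apply Rinv_0_lt_compat, P|exact T].
  - unfold Mp. destruct (circle_sup_attained g r Hg Hr) as [t0 Ht0].
    set (E := fun y => exists theta, y = Cmod (g (circle_pt r theta))).
    destruct (Lub_Rbar_correct E) as [U L].
    assert (B : Lub_Rbar E = Finite (x t0)).
    { apply Rbar_le_antisym.
      - apply L. intros y [s ->]. apply Ht0.
      - apply U. exists t0. reflexivity. }
    rewrite B. simpl. rewrite <- RInt_const_2PI. apply RInt_le_cts.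
    + exact Cx.
    + intros; apply continuous_const.
    + intros t. apply Ht0.
Qed.

Lemma Mp_le (p : Rbar) (r B : R) (g : C -> C) :
  Rbar_le 1 p -> continuous_on_disk g -> 0 <= r < 1 ->
  (forall t, Cmod (g (circle_pt r t)) <= B) -> Mp p r g <= B.
Proof.
  intros Hp Hg Hr HB. assert (P := two_PI_pos).
  assert (B0 : 0 <= B). { eapply Rle_trans; [apply Cmod_ge_0|apply (HB 0)]. }
  destruct p as [q| |]; simpl in Hp; [| |contradiction].
  - unfold Mp. rewrite <- (rpow_rpow_inv B q) by lra.
    apply rpow_le; [apply Rinv_0_lt_compat; lra|]. split.
    + apply RInt_ge_0; [lra|apply ex_RInt_cts, continuous_rpow_circle; assumption|].
      intros t _. apply Rmult_le_pos; [apply rpow_nonneg|left; apply Rinv_0_lt_compat, P].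
    + apply Rle_trans with (RInt (fun _ => rpow B q / (2 * PI)) 0 (2 * PI)).
      * apply RInt_le_cts; [apply continuous_rpow_circle; assumption|intros; apply continuous_const|].
        intros t. apply Rmult_le_compat_r; [left; apply Rinv_0_lt_compat, P|].
        apply rpow_le; [lra|]. split; [apply Cmod_ge_0|apply HB].
      * rewrite RInt_const_2PI. apply Req_le. field. lra.
  - unfold Mp. set (E := fun y => exists theta, y = Cmod (g (circle_pt r theta))).
    destruct (Lub_Rbar_correct E) as [_ L].
    assert (LB : Rbar_le (Lub_Rbar E) B).
    { apply L. intros y [s ->]. apply HB. }
    destruct (Lub_Rbar E); simpl in *; lra.
Qed.

Lemma Hnorm_ge (p : Rbar) (alpha r : R) (g : C -> C) : 0 <= r < 1 ->
  Rbar_le (Rpower (1 - r) alpha * Mp p r g) (Hnorm p alpha g).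
Proof.
  intros Hr. apply (Lub_Rbar_correct (fun y => exists r, 0 <= r < 1 /\ y = Rpower (1 - r) alpha * Mp p r g)).
  exists r. split; [exact Hr|reflexivity].
Qed.

(** The space for p = infinity is contained in that for every p >= 1, since the circle carries total
    mass 1; a pointwise growth bound therefore suffices for membership. *)
Lemma Hspace_of_growth (p : Rbar) (alpha B : R) (g : C -> C) :
  Rbar_le 1 p -> analytic_on_disk g ->
  (forall z, disk z -> Rpower (1 - Cmod z) alpha * Cmod (g z) <= B) -> Hspace p alpha g.
Proof.
  intros Hp Hg HB. split; [exact Hg|].
  apply Rbar_le_lt_trans with (Finite B); [|exact I].
  apply (Lub_Rbar_correct (fun y => exists r, 0 <= r < 1 /\ y = Rpower (1 - r) alpha * Mp p r g)).
  intros y [r [Hr ->]]. simpl.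
  assert (W : 0 < Rpower (1 - r) alpha) by apply exp_pos.
  apply Rle_trans with (Rpower (1 - r) alpha * (B / Rpower (1 - r) alpha)).
  - apply Rmult_le_compat_l; [lra|]. apply Mp_le; [exact Hp| |exact Hr|].
    + intros z Hz. apply analytic_continuous; assumption.
    + intros t. assert (Q := HB _ (disk_circle_pt r t Hr)). rewrite Cmod_circle_pt in Q by lra.
      apply Rmult_le_reg_l with (Rpower (1 - r) alpha); [exact W|].
      replace (Rpower (1 - r) alpha * (B / Rpower (1 - r) alpha)) with B by (field; lra). exact Q.
  - apply Req_le. field. lra.
Qed.

Lemma one_plus_inv_pow_le (M : nat) : (1 <= M)%nat -> (1 + / INR M) ^ M <= 3.
Proof.
  intros HM. assert (PM : 0 < INR M) by (apply lt_0_INR; lia).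
  apply Rle_trans with (exp (/ INR M) ^ M).
  - apply pow_incr. assert (0 < / INR M) by (apply Rinv_0_lt_compat, PM).
    split; [lra|apply exp_ineq1_le].
  - rewrite <- Rpower_pow by apply exp_pos. unfold Rpower. rewrite ln_exp. replace (INR M * / INR M) with 1 by (field; lra). apply exp_le_3.
Qed.

(* M^(alpha-1), the size of the coefficients of F. *)
Definition weight (alpha : R) (M : nat) : R := Rpower (INR M) alpha / INR M.

(** Stated for a primitive [G] of [g], because T_t f - f occurs as the derivative of F o phi_t - F.
    Integration by parts bounds M times the coefficient of [G] by the L^1 mean of [g] at radius r.
    With r = M/(M+1) the weight (1 - r)^(-alpha) = (M+1)^alpha is at most 2^alpha M^alpha, and
    passing to radius 1/2 costs r^(-M) = (1 + 1/M)^M <= 3. *)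
Lemma coef_le_Hnorm (p : Rbar) (alpha eps : R) (G g : C -> C) (M : nat) :
  Rbar_le 1 p -> 0 < alpha -> C1_disk G g -> (1 <= M)%nat ->
  Rbar_le (Hnorm p alpha g) eps ->
  Cmod (circle_coef G (1 / 2) M) <= 2 * PI * (1 / 2) ^ M * weight alpha M * (3 * Rpower 2 alpha * eps).
Proof.
  intros Hp Ha HG HM Hn. assert (P := two_PI_pos). assert (P' := PI_RGT_0).
  assert (PM : 0 < INR M) by (apply lt_0_INR; lia).
  assert (PM1 : 1 <= INR M) by (apply (le_INR 1); exact HM).
  set (r := INR M / (INR M + 1)).
  assert (Er : 1 - r = / (INR M + 1)) by (unfold r; field; lra).
  assert (Hr : 0 < r < 1).
  { split; [apply Rdiv_lt_0_compat; lra|].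
    assert (0 < / (INR M + 1)) by (apply Rinv_0_lt_compat; lra). lra. }
  assert (Cg := C1_disk_continuous' _ _ HG).
  assert (Cc : Ccts (fun t => g (circle_pt r t) * circle_pt r t * expi (- INR M * t))%C).
  { apply Ccts_mult; [|apply Ccts_expi]. apply Ccts_mult; [|apply Ccts_circle_pt].
    apply Ccts_circle; [exact Cg|lra]. }
  assert (E1 : INR M * Cmod (circle_coef G r M) <= r * (2 * PI * Mp p r g)).
  { assert (E := CInt_by_parts G g (- INR M) r HG ltac:(lra) (expi_neg_2PI M)).
    fold (circle_coef G r M) in E. apply (f_equal Cmod) in E.
    rewrite <- RtoC_opp, Ropp_involutive, Cmod_mult, Cmod_R, (Rabs_pos_eq (INR M)) in E by lra. rewrite <- E.
    eapply Rle_trans; [apply Cmod_CInt, Cc|].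
    apply Rle_trans with (r * RInt (fun t => Cmod (g (circle_pt r t))) 0 (2 * PI)).
    - assert (Cx : forall t, continuous (fun t => Cmod (g (circle_pt r t))) t).
      { intros t. apply (continuous_Cmod (fun t => g (circle_pt r t))), (Ccts_circle g r Cg ltac:(lra)). }
      apply Req_le. 
      rewrite <- (RInt_scal (V := R_CompleteNormedModule) (fun t => Cmod (g (circle_pt r t)))) by (apply ex_RInt_cts, Cx).
      apply RInt_ext. intros t _. rewrite !Cmod_mult, Cmod_expi, Cmod_circle_pt, Rmult_1_r by lra.
      apply Rmult_comm.
    - apply Rmult_le_compat_l; [lra|]. apply mean_le_Mp; [exact Hp|exact Cg|lra]. }
  assert (E2 : Rpower (1 - r) alpha * Mp p r g <= eps).
  { assert (Q := Rbar_le_trans _ _ _ (Hnorm_ge p alpha r g ltac:(lra)) Hn). exact Q. }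
  assert (E3 : Mp p r g <= Rpower (INR M + 1) alpha * eps).
  { assert (W : Rpower (INR M + 1) alpha * Rpower (1 - r) alpha = 1).
    { rewrite Er, Rpower_mult_distr, Rinv_r by (try apply Rinv_0_lt_compat; lra).
      unfold Rpower. rewrite ln_1, Rmult_0_r. apply exp_0. }
    replace (Mp p r g) with (Rpower (INR M + 1) alpha * (Rpower (1 - r) alpha * Mp p r g)).
    - apply Rmult_le_compat_l; [left; apply exp_pos|exact E2].
    - rewrite <- Rmult_assoc, W. ring. }
  assert (M0 : 0 <= Mp p r g).
  { apply Rmult_le_reg_l with (2 * PI); [exact P|]. rewrite Rmult_0_r.
    eapply Rle_trans; [|apply mean_le_Mp; [exact Hp|exact Cg|lra]].
    apply RInt_ge_0; [lra| |intros; apply Cmod_ge_0]. apply ex_RInt_cts. intros t.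
    apply (continuous_Cmod (fun t => g (circle_pt r t))), (Ccts_circle g r Cg ltac:(lra)). }
  assert (e0 : 0 <= eps).
  { eapply Rle_trans; [|exact E2]. apply Rmult_le_pos; [left; apply exp_pos|exact M0]. }
  assert (E4 : Rpower (INR M + 1) alpha <= Rpower 2 alpha * Rpower (INR M) alpha).
  { rewrite Rpower_mult_distr by lra. apply Rle_Rpower_l; lra. }
  assert (W0 : 0 < Rpower (INR M) alpha) by apply exp_pos.
  assert (V0 : 0 < Rpower 2 alpha) by apply exp_pos.
  assert (E5 : Cmod (circle_coef G r M) <= 2 * PI * weight alpha M * (Rpower 2 alpha * eps)).
  { apply Rmult_le_reg_l with (INR M); [exact PM|].
    eapply Rle_trans; [exact E1|].
    apply Rle_trans with (1 * (2 * PI * (Rpower 2 alpha * Rpower (INR M) alpha * eps))).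
    - apply Rmult_le_compat; [lra| |lra|].
      + apply Rmult_le_pos; lra.
      + apply Rmult_le_compat_l; [lra|]. eapply Rle_trans; [exact E3|].
        apply Rmult_le_compat_r; assumption.
    - apply Req_le. unfold weight. field. lra. }
  assert (ER := circle_coef_radius G g M r (1 / 2) HG Hr ltac:(lra)).
  apply (f_equal Cmod) in ER. rewrite !Cmod_mult, !Cmod_R in ER.
  assert (rM : 0 < r ^ M) by (apply pow_lt; lra).
  assert (hM : 0 < (1 / 2) ^ M) by (apply pow_lt; lra).
  rewrite !Rabs_pos_eq in ER by lra.
  assert (E6 : 1 <= 3 * r ^ M).
  { apply Rle_trans with ((1 + / INR M) ^ M * r ^ M).
    - rewrite <- Rpow_mult_distr. replace ((1 + / INR M) * r) with 1 by (unfold r; field; lra).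
      rewrite pow1. lra.
    - apply Rmult_le_compat_r; [lra|apply one_plus_inv_pow_le, HM]. }
  set (X := Cmod (circle_coef G (1 / 2) M)) in *.
  assert (X0 : 0 <= X) by apply Cmod_ge_0.
  apply Rle_trans with (3 * (r ^ M * X)).
  { assert (1 * X <= 3 * r ^ M * X) by (apply Rmult_le_compat_r; assumption). lra. }
  rewrite <- ER.
  assert ((1 / 2) ^ M * Cmod (circle_coef G r M) <= (1 / 2) ^ M * (2 * PI * weight alpha M * (Rpower 2 alpha * eps))).
  { apply Rmult_le_compat_l; lra. }
  lra.
Qed.

(** * Lacunary series *)

Definition CSeries (a : nat -> C) : C := (Series (fun k => Re (a k)), Series (fun k => Im (a k))).

Definition Csummable (a : nat -> C) : Prop := ex_series (fun k => Cmod (a k)).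

Lemma ex_series_le_R (a b : nat -> R) :
  (forall k, Rabs (a k) <= b k) -> ex_series b -> ex_series a.
Proof. intros H. apply (ex_series_le (V := R_CompleteNormedModule)). exact H. Qed.

Lemma ex_series_Rmult (c : R) (a : nat -> R) : ex_series a -> ex_series (fun k => c * a k).
Proof. exact (ex_series_scal_l (K := R_AbsRing) (V := R_NormedModule) c a). Qed.

Lemma Csummable_Re (a : nat -> C) : Csummable a -> ex_series (fun k => Rabs (Re (a k))).
Proof.
  apply ex_series_le_R. intros k. rewrite Rabs_Rabsolu. apply re_le_Cmod.
Qed.

Lemma Csummable_Im (a : nat -> C) : Csummable a -> ex_series (fun k => Rabs (Im (a k))).
Proof.
  apply ex_series_le_R. intros k. rewrite Rabs_Rabsolu. apply im_le_Cmod.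
Qed.

Lemma Csummable_le (a : nat -> C) (b : nat -> R) :
  (forall k, Cmod (a k) <= b k) -> ex_series b -> Csummable a.
Proof.
  intros H. apply ex_series_le_R. intros k. rewrite Rabs_pos_eq by apply Cmod_ge_0. apply H.
Qed.

(** The factor 2 is the price of estimating real and imaginary parts separately. *)
Lemma Cmod_CSeries_le (a : nat -> C) (b : nat -> R) :
  (forall k, Cmod (a k) <= b k) -> ex_series b -> Cmod (CSeries a) <= 2 * Series b.
Proof.
  intros H Hb. assert (Ha := Csummable_le a b H Hb).
  eapply Rle_trans; [apply Cmod_le_abs|]. unfold CSeries; simpl.
  assert (A1 : Rabs (Series (fun k => Re (a k))) <= Series b).
  { eapply Rle_trans; [apply Series_Rabs, Csummable_Re, Ha|].
    apply Series_le; [|exact Hb]. intros k. split; [apply Rabs_pos|].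
    eapply Rle_trans; [apply re_le_Cmod|apply H]. }
  assert (A2 : Rabs (Series (fun k => Im (a k))) <= Series b).
  { eapply Rle_trans; [apply Series_Rabs, Csummable_Im, Ha|].
    apply Series_le; [|exact Hb]. intros k. split; [apply Rabs_pos|].
    eapply Rle_trans; [apply im_le_Cmod|apply H]. }
  lra.
Qed.

Lemma CSeries_ext (a b : nat -> C) : (forall k, a k = b k) -> CSeries a = CSeries b.
Proof.
  intros H. unfold CSeries. f_equal; apply Series_ext; intros k; rewrite H; reflexivity.
Qed.

Lemma CSeries_minus (a b : nat -> C) : Csummable a -> Csummable b ->
  CSeries (fun k => a k - b k)%C = (CSeries a - CSeries b)%C.
Proof.
  intros Ha Hb. unfold CSeries, Cminus, Cplus, Copp; simpl. f_equal.
  - apply Series_minus; apply ex_series_Rabs, Csummable_Re; assumption.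
  - apply Series_minus; apply ex_series_Rabs, Csummable_Im; assumption.
Qed.

Lemma Csummable_minus (a b : nat -> C) : Csummable a -> Csummable b ->
  Csummable (fun k => a k - b k)%C.
Proof.
  intros Ha Hb. apply Csummable_le with (fun k => Cmod (a k) + Cmod (b k)).
  - intros k. apply Cmod_minus_le.
  - apply (ex_series_plus (V := R_NormedModule)); assumption.
Qed.

Lemma Csummable_scal_r (a : nat -> C) (c : C) : Csummable a -> Csummable (fun k => a k * c)%C.
Proof.
  intros H. apply Csummable_le with (fun k => Cmod c * Cmod (a k)).
  - intros k. rewrite Cmod_mult. apply Req_le, Rmult_comm.
  - apply ex_series_Rmult. exact H.
Qed.

Lemma CSeries_scal_r (a : nat -> C) (c : C) : Csummable a ->
  CSeries (fun k => a k * c)%C = (CSeries a * c)%C.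
Proof.
  intros H. destruct c as [x y].
  assert (HR := ex_series_Rabs _ (Csummable_Re a H)). assert (HI := ex_series_Rabs _ (Csummable_Im a H)).
  unfold Re, Im in HR, HI.
  assert (S : forall u (f : nat -> R), ex_series f -> ex_series (fun k => f k * u)).
  { intros u f Hf. apply (ex_series_scal_r u f Hf). }
  unfold CSeries, Cmult, Re, Im; simpl. f_equal.
  - rewrite (Series_minus (fun k => fst (a k) * x) (fun k => snd (a k) * y)), !Series_scal_r; auto.
  - rewrite (Series_plus (fun k => fst (a k) * y) (fun k => snd (a k) * x)), !Series_scal_r; auto.
Qed.

Fixpoint Csum (a : nat -> C) (n : nat) : C :=
  match n with O => 0%C | S n => (Csum a n + a n)%C end.

Lemma CSeries_split (a : nat -> C) (n : nat) : Csummable a ->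
  CSeries a = (Csum a n + CSeries (fun k => a (n + k)%nat))%C.
Proof.
  intros H. induction n as [|n IH].
  - simpl. rewrite Cplus_0_l. reflexivity.
  - rewrite IH. simpl. rewrite <- Cplus_assoc. f_equal.
    assert (E : CSeries (fun k => a (n + k)%nat) =
      (a (n + 0)%nat + CSeries (fun k => a (n + S k)%nat))%C).
    { unfold CSeries, Cplus; simpl. f_equal.
      - apply (Series_incr_1 (fun k => Re (a (n + k)%nat))).
        apply (ex_series_incr_n (V := R_NormedModule) (fun k => Re (a k)) n), ex_series_Rabs, Csummable_Re, H.
      - apply (Series_incr_1 (fun k => Im (a (n + k)%nat))).
        apply (ex_series_incr_n (V := R_NormedModule) (fun k => Im (a k)) n), ex_series_Rabs, Csummable_Im, H. }
    rewrite E, Nat.add_0_r. f_equal. apply CSeries_ext. intros k. f_equal. lia.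
Qed.

(** The second-order Taylor remainder of z^n, with the exponent n - 2 written as a quotient to avoid
    truncated subtraction, and n^2 as a convenient constant for the induction. *)
Lemma pow_increment_bound (z h : C) (rho : R) (n : nat) :
  0 < rho -> Cmod z <= rho -> Cmod (z + h)%C <= rho ->
  Cmod ((z + h) ^ n - z ^ n - RtoC (INR n) * z ^ pred n * h)%C <=
  INR n ^ 2 * rho ^ n / rho ^ 2 * Cmod h ^ 2.
Proof.
  intros Hr Hz Hzh. destruct n as [|n].
  - simpl. replace (1 - 1 - 0 * 1 * h)%C with (RtoC 0) by ring. rewrite Cmod_0. apply Req_le. field. lra.
  - simpl pred. assert (H0 := Cmod_ge_0 h). assert (Z0 := Cmod_ge_0 z).
    induction n as [|n IH].
    + replace ((z + h) ^ 1 - z ^ 1 - RtoC (INR 1) * z ^ 0 * h)%C with (RtoC 0) by (simpl; ring).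
      rewrite Cmod_0. apply Rmult_le_pos; [|apply pow2_ge_0].
      apply Rmult_le_pos; [|left; apply Rinv_0_lt_compat, pow_lt, Hr].
      apply Rmult_le_pos; [apply pow2_ge_0|apply pow_le; lra].
    + replace ((z + h) ^ S (S n) - z ^ S (S n) - RtoC (INR (S (S n))) * z ^ S n * h)%C with
        (((z + h) ^ S n - z ^ S n - RtoC (INR (S n)) * z ^ n * h) * (z + h)
         + RtoC (INR (S n)) * z ^ n * (h * h))%C.
      2: { rewrite (S_INR (S n)), RtoC_plus, !Cpow_S. ring. }
      eapply Rle_trans; [apply Cmod_triangle|].
      rewrite !Cmod_mult, Cmod_pow, Cmod_R, Rabs_pos_eq by apply pos_INR.
      set (E := Cmod ((z + h) ^ S n - z ^ S n - RtoC (INR (S n)) * z ^ n * h)) in *.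
      assert (N1 := pos_INR (S n)).
      assert (A1 : E * Cmod (z + h)%C <= (INR (S n) ^ 2 * rho ^ S n / rho ^ 2 * Cmod h ^ 2) * rho).
      { apply Rmult_le_compat; [apply Cmod_ge_0|apply Cmod_ge_0|exact IH|exact Hzh]. }
      assert (A2 : INR (S n) * Cmod z ^ n * (Cmod h * Cmod h) <= INR (S n) * rho ^ n * (Cmod h * Cmod h)).
      { apply Rmult_le_compat_r; [nra|]. apply Rmult_le_compat_l; [exact N1|].
        apply pow_incr. lra. }
      eapply Rle_trans; [apply Rplus_le_compat; [exact A1|exact A2]|].
      rewrite (S_INR (S n)). set (x := INR (S n)) in *.
      replace (x ^ 2 * rho ^ S n / rho ^ 2 * Cmod h ^ 2 * rho + x * rho ^ n * (Cmod h * Cmod h)) with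
        ((x ^ 2 + x) * (rho ^ n * Cmod h ^ 2)) by (simpl; field; lra).
      replace ((x + 1) ^ 2 * rho ^ S (S n) / rho ^ 2 * Cmod h ^ 2) with
        ((x + 1) ^ 2 * (rho ^ n * Cmod h ^ 2)) by (simpl; field; lra).
      apply Rmult_le_compat_r; [|simpl; nra].
      apply Rmult_le_pos; [apply pow_le; lra|apply pow2_ge_0].
Qed.

Lemma pow_pred_le (x : R) (n : nat) : 0 < x < 1 -> x ^ pred n <= x ^ n / x.
Proof.
  intros Hx. destruct n as [|n]; simpl.
  - rewrite <- Rinv_1 at 1. unfold Rdiv. rewrite Rmult_1_l. apply Rinv_le_contravar; lra.
  - apply Req_le. field. lra.
Qed.

Lemma term_bound (c : R) (z : C) (rho : R) (n : nat) : 0 < rho -> Cmod z <= rho ->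
  Cmod (RtoC c * z ^ n)%C <= Rabs c * rho ^ n.
Proof.
  intros Hr Hz. rewrite Cmod_mult, Cmod_R, Cmod_pow.
  apply Rmult_le_compat_l; [apply Rabs_pos|]. apply pow_incr. split; [apply Cmod_ge_0|exact Hz].
Qed.

(** The exponent [d] counts how many differentiations the series can afford. The base is m + 1 so
    that the condition weakens as [d] decreases, also where m = 0. *)
Definition power_summable (c : nat -> R) (m : nat -> nat) (d : nat) : Prop :=
  forall rho, 0 < rho < 1 -> ex_series (fun k => Rabs (c k) * (INR (m k) + 1) ^ d * rho ^ m k).

Lemma power_summable_S (c : nat -> R) (m : nat -> nat) (d : nat) :
  power_summable c m (S d) -> power_summable c m d.
Proof.
  intros H rho Hr. refine (ex_series_le_R _ _ _ (H rho Hr)). intros k.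
  assert (N := pos_INR (m k)).
  rewrite !Rabs_mult, Rabs_Rabsolu, (Rabs_pos_eq ((INR (m k) + 1) ^ d)), (Rabs_pos_eq (rho ^ m k)) by (apply pow_le; lra).
  apply Rmult_le_compat_r; [apply pow_le; lra|]. apply Rmult_le_compat_l; [apply Rabs_pos|].
  rewrite <- tech_pow_Rmult. assert (0 <= (INR (m k) + 1) ^ d) by (apply pow_le; lra). nra.
Qed.

Lemma power_summable_deriv (c : nat -> R) (m : nat -> nat) (d : nat) :
  power_summable c m (S d) -> power_summable (fun k => c k * INR (m k)) (fun k => pred (m k)) d.
Proof.
  intros H rho Hr.
  refine (ex_series_le_R _ _ _ (ex_series_Rmult (/ rho) _ (H rho Hr))). intros k.
  assert (N := pos_INR (m k)). assert (N' := pos_INR (pred (m k))).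
  rewrite !Rabs_mult, !Rabs_Rabsolu, (Rabs_pos_eq (INR (m k))) by exact N.
  rewrite (Rabs_pos_eq (_ ^ d)), (Rabs_pos_eq (rho ^ _)) by (apply pow_le; lra).
  assert (Q := pow_pred_le rho (m k) Hr).
  assert (L : INR (pred (m k)) <= INR (m k)) by (apply le_INR; lia).
  assert (D : (INR (pred (m k)) + 1) ^ d <= (INR (m k) + 1) ^ d) by (apply pow_incr; lra).
  assert (D0 : 0 <= (INR (pred (m k)) + 1) ^ d) by (apply pow_le; lra).
  assert (P0 : 0 <= rho ^ pred (m k)) by (apply pow_le; lra).
  assert (C0 := Rabs_pos (c k)).
  assert (Q1 : INR (m k) * (INR (pred (m k)) + 1) ^ d <= (INR (m k) + 1) * (INR (m k) + 1) ^ d).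
  { apply Rmult_le_compat; lra. }
  rewrite <- tech_pow_Rmult.
  replace (Rabs (c k) * INR (m k) * (INR (pred (m k)) + 1) ^ d * rho ^ pred (m k)) with
    (Rabs (c k) * (INR (m k) * (INR (pred (m k)) + 1) ^ d) * rho ^ pred (m k)) by ring.
  apply Rle_trans with (Rabs (c k) * ((INR (m k) + 1) * (INR (m k) + 1) ^ d) * (rho ^ m k / rho)).
  - apply Rmult_le_compat; [|exact P0| |exact Q].
    + apply Rmult_le_pos; [exact C0|]. apply Rmult_le_pos; assumption.
    + apply Rmult_le_compat_l; assumption.
  - apply Req_le. field. lra.
Qed.

Lemma power_summable_Csummable (c : nat -> R) (m : nat -> nat) (d : nat) (z : C) :
  power_summable c m d -> disk z -> Csummable (fun k => RtoC (c k) * z ^ m k)%C.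
Proof.
  intros H Hz. unfold disk in Hz. assert (Z0 := Cmod_ge_0 z).
  assert (H0 : power_summable c m 0).
  { clear - H. induction d as [|d IH]; [exact H|]. apply IH, power_summable_S, H. }
  specialize (H0 ((1 + Cmod z) / 2) ltac:(lra)).
  refine (Csummable_le _ _ _ H0). intros k. simpl. rewrite Rmult_1_r.
  apply term_bound; lra.
Qed.

Definition Cpower_series (c : nat -> R) (m : nat -> nat) (z : C) : C :=
  CSeries (fun k => RtoC (c k) * z ^ m k)%C.

(** By [pow_increment_bound] the linearisation error of the k-th term is at most |h|^2 a_k on the
    disk of radius rho, and the a_k are summable. *)
Lemma Cpower_series_deriv (c : nat -> R) (m : nat -> nat) (z : C) :
  power_summable c m 2 -> disk z ->
  has_Cderiv (Cpower_series c m) z (Cpower_series (fun k => c k * INR (m k)) (fun k => pred (m k)) z).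
Proof.
  intros H Hz eps Heps. assert (Hz' := Hz). unfold disk in Hz'. assert (Z0 := Cmod_ge_0 z).
  set (rho := (1 + Cmod z) / 2). assert (Hr : 0 < rho < 1) by (unfold rho; lra).
  assert (Hr2 : 0 < rho ^ 2) by (apply pow_lt; lra).
  set (a := fun k => / rho ^ 2 * (Rabs (c k) * (INR (m k) + 1) ^ 2 * rho ^ m k)).
  assert (Ha : ex_series a).
  { apply ex_series_Rmult. apply H, Hr. }
  assert (a0 : forall k, 0 <= a k).
  { intros k. apply Rmult_le_pos; [left; apply Rinv_0_lt_compat, Hr2|].
    apply Rmult_le_pos; [|apply pow_le; lra]. apply Rmult_le_pos; [apply Rabs_pos|apply pow2_ge_0]. }
  assert (S0 : 0 <= Series a).
  { replace 0 with (Series (fun _ : nat => 0 * 0)).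
    - apply Series_le; [|exact Ha]. intros k. split; [lra|]. rewrite Rmult_0_l. apply a0.
    - rewrite Series_scal_l. ring. }
  set (del := Rmin (rho - Cmod z) (eps / (2 * Series a + 1))).
  exists del. split.
  { apply Rmin_glb_lt; [unfold rho; lra|]. apply Rdiv_lt_0_compat; lra. }
  intros h Hh.
  assert (H1 := Rlt_le_trans _ _ _ Hh (Rmin_l _ _)).
  assert (H2 := Rlt_le_trans _ _ _ Hh (Rmin_r _ _)).
  assert (Hzh : Cmod (z + h)%C <= rho).
  { eapply Rle_trans; [apply Cmod_triangle|]. lra. }
  assert (Dzh : disk (z + h)%C) by (unfold disk; lra).
  assert (Sz := power_summable_Csummable _ _ _ _ H Hz).
  assert (Szh := power_summable_Csummable _ _ _ _ H Dzh).
  assert (Sd := power_summable_Csummable _ _ _ _ (power_summable_deriv _ _ _ H) Hz).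
  unfold Cpower_series.
  rewrite <- CSeries_scal_r by exact Sd.
  rewrite <- CSeries_minus by assumption.
  rewrite <- CSeries_minus; [|apply Csummable_minus; assumption|apply Csummable_scal_r, Sd].
  apply Rle_trans with (2 * Series (fun k => Cmod h ^ 2 * a k)).
  - apply Cmod_CSeries_le.
    + intros k.
      replace (RtoC (c k) * (z + h) ^ m k - RtoC (c k) * z ^ m k - RtoC (c k * INR (m k)) * z ^ pred (m k) * h)%C
        with (RtoC (c k) * ((z + h) ^ m k - z ^ m k - RtoC (INR (m k)) * z ^ pred (m k) * h))%C
        by (rewrite RtoC_mult; ring).
      rewrite Cmod_mult, Cmod_R.
      apply Rle_trans with (Rabs (c k) * (INR (m k) ^ 2 * rho ^ m k / rho ^ 2 * Cmod h ^ 2)).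
      * apply Rmult_le_compat_l; [apply Rabs_pos|]. apply pow_increment_bound; unfold rho in *; lra.
      * unfold a. assert (N := pos_INR (m k)).
        apply Rle_trans with (Cmod h ^ 2 * (/ rho ^ 2 * (Rabs (c k) * INR (m k) ^ 2 * rho ^ m k))).
        { apply Req_le. field. lra. }
        apply Rmult_le_compat_l; [apply pow2_ge_0|].
        apply Rmult_le_compat_l; [left; apply Rinv_0_lt_compat, Hr2|].
        apply Rmult_le_compat_r; [apply pow_le; lra|].
        apply Rmult_le_compat_l; [apply Rabs_pos|]. apply pow_incr. lra.
    + apply ex_series_Rmult. exact Ha.
  - rewrite Series_scal_l. assert (h0 := Cmod_ge_0 h).
    assert (Q : (2 * Series a + 1) * Cmod h <= eps).
    { apply Rle_trans with ((2 * Series a + 1) * (eps / (2 * Series a + 1))).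
      - apply Rmult_le_compat_l; lra.
      - apply Req_le. field. lra. }
    assert ((2 * Series a + 1) * Cmod h * Cmod h <= eps * Cmod h) by (apply Rmult_le_compat_r; assumption).
    simpl. nra.
Qed.

(** Order 3, because the series is differentiated twice and [Cpower_series_deriv] asks for order 2
    each time. *)
Lemma Cpower_series_C1 (c : nat -> R) (m : nat -> nat) :
  power_summable c m 3 ->
  C1_disk (Cpower_series c m) (Cpower_series (fun k => c k * INR (m k)) (fun k => pred (m k))) /\
  analytic_on_disk (Cpower_series (fun k => c k * INR (m k)) (fun k => pred (m k))).
Proof.
  intros H.
  assert (D : forall z, disk z -> exists l,
    has_Cderiv (Cpower_series (fun k => c k * INR (m k)) (fun k => pred (m k))) z l).
  { intros z Hz. eexists. apply Cpower_series_deriv; [|exact Hz]. apply power_summable_deriv, H. }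
  split.
  - intros z Hz. split.
    + apply Cpower_series_deriv; [apply power_summable_S, H|exact Hz].
    + destruct (D z Hz) as [l Hl]. eapply has_Cderiv_continuous, Hl.
  - apply analytic_has_Cderiv, D.
Qed.

(** * Growth estimates for sums over sparse exponents *)

Lemma exp_le_compat (x y : R) : x <= y -> exp x <= exp y.
Proof. intros [H| ->]; [left; apply exp_increasing, H|apply Rle_refl]. Qed.

(** From ln y <= y at y = x d / b, which gives C = (b/d)^b. *)
Lemma Rpower_le_exp (b d : R) : 0 < b -> 0 < d ->
  exists C, 0 < C /\ forall x, 0 < x -> Rpower x b <= C * exp (d * x).
Proof.
  intros Hb Hd. exists (exp (b * ln (b / d))). split; [apply exp_pos|].
  intros x Hx. unfold Rpower. rewrite <- exp_plus.
  assert (L : ln x <= ln (b / d) + x * d / b).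
  { assert (Hq : 0 < b / d) by (apply Rdiv_lt_0_compat; assumption).
    assert (Hs : 0 < x / (b / d)) by (apply Rdiv_lt_0_compat; assumption).
    assert (E := exp_ineq1_le (ln (x / (b / d)))). rewrite exp_ln in E by exact Hs.
    rewrite ln_div in E by assumption.
    replace (x * d / b) with (x / (b / d)) by (field; lra). lra. }
  apply exp_le_compat.
  apply Rle_trans with (b * (ln (b / d) + x * d / b)).
  - apply Rmult_le_compat_l; lra.
  - apply Req_le. field. lra.
Qed.

(** [K] is uniform over the sequences [L]. This lets the gliding hump fix a threshold before the
    later exponents are chosen. *)
Lemma Rpower_pow_tail (b rho eta : R) : 0 < b -> 0 < rho < 1 -> 0 < eta ->
  exists K, forall L : nat -> nat, (forall j, (K + j <= L j)%nat /\ (1 <= L j)%nat) ->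
    ex_series (fun j => Rpower (INR (L j)) b * rho ^ L j) /\
    Series (fun j => Rpower (INR (L j)) b * rho ^ L j) <= eta.
Proof.
  intros Hb Hr He.
  assert (lr : ln rho < 0) by (rewrite <- ln_1; apply ln_increasing; lra).
  destruct (Rpower_le_exp b (- ln rho / 2) Hb ltac:(lra)) as [C [HC H]].
  set (tau := exp (ln rho / 2)).
  assert (Ht : 0 < tau < 1).
  { split; [apply exp_pos|]. rewrite <- exp_0. apply exp_increasing. lra. }
  assert (Hpow : forall n, exp (INR n * (ln rho / 2)) = tau ^ n).
  { intros n. unfold tau. rewrite <- Rpower_pow by apply exp_pos. unfold Rpower. rewrite ln_exp. reflexivity. }
  (* Half of the exponential decay absorbs the power: tau is the square root of rho, and n^b <= C
     tau^(-n). *)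
  assert (Hterm : forall n, (1 <= n)%nat -> Rpower (INR n) b * rho ^ n <= C * tau ^ n).
  { intros n Hn. assert (Pn : 0 < INR n) by (apply lt_0_INR; lia).
    rewrite <- (Rpower_pow n rho) by lra. unfold Rpower at 2.
    apply Rle_trans with (C * exp (- ln rho / 2 * INR n) * exp (INR n * ln rho)).
    - apply Rmult_le_compat_r; [left; apply exp_pos|apply H, Pn].
    - rewrite Rmult_assoc, <- exp_plus, <- Hpow. apply Req_le. f_equal. f_equal. field. }
  assert (Lim := is_lim_seq_geom tau ltac:(rewrite Rabs_pos_eq; lra)).
  apply is_lim_seq_spec in Lim.
  assert (He' : 0 < eta * (1 - tau) / C).
  { apply Rdiv_lt_0_compat; [|exact HC]. apply Rmult_lt_0_compat; lra. }
  destruct (Lim (mkposreal _ He')) as [K HK]. specialize (HK K (Nat.le_refl K)).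
  simpl in HK. rewrite Rminus_0_r, Rabs_pos_eq in HK by (apply pow_le; lra).
  exists K. intros L HL.
  set (g := fun j => (C * tau ^ K) * tau ^ j).
  assert (Eg : ex_series g).
  { apply ex_series_Rmult, ex_series_geom. rewrite Rabs_pos_eq; lra. }
  assert (Hg : forall j, 0 <= Rpower (INR (L j)) b * rho ^ L j <= g j).
  { intros j. destruct (HL j) as [H1 H2]. split.
    - apply Rmult_le_pos; [left; apply exp_pos|apply pow_le; lra].
    - eapply Rle_trans; [apply Hterm, H2|]. unfold g. rewrite Rmult_assoc, <- pow_add.
      apply Rmult_le_compat_l; [lra|].
      replace (L j) with (K + j + (L j - (K + j)))%nat by lia. rewrite (pow_add tau (K + j)).
      rewrite <- (Rmult_1_r (tau ^ (K + j))) at 2.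
      apply Rmult_le_compat_l; [apply pow_le; lra|].
      rewrite <- (pow1 (L j - (K + j))). apply pow_incr. lra. }
  split.
  - refine (ex_series_le_R _ g _ Eg). intros j. rewrite Rabs_pos_eq by apply Hg. apply Hg.
  - eapply Rle_trans; [apply Series_le; [apply Hg|exact Eg]|].
    unfold g. rewrite Series_scal_l, Series_geom by (rewrite Rabs_pos_eq; lra).
    apply Rmult_le_reg_r with ((1 - tau) / C).
    { apply Rdiv_lt_0_compat; lra. }
    replace (C * tau ^ K * / (1 - tau) * ((1 - tau) / C)) with (tau ^ K) by (field; lra).
    unfold Rdiv in *. lra.
Qed.

Lemma Series_le_bound (a : nat -> R) (B : R) :
  (forall n, sum_n a n <= B) -> ex_series a -> Series a <= B.
Proof.
  intros H Ha. apply Series_correct in Ha.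
  assert (Q := is_lim_seq_le (sum_n a) (fun _ => B) (Series a) B H Ha (is_lim_seq_const B)).
  exact Q.
Qed.

(* The terms telescope: s/((1+s)(1+2s)) = 1/(1+s) - 1/(1+2s). *)
Lemma doubling_sum (s : nat -> R) (n : nat) :
  (forall k, 0 < s k) -> (forall k, 2 * s k <= s (S k)) ->
  sum_n (fun k => s k / ((1 + s k) * (1 + 2 * s k))) n <= 1 - / (1 + s (S n)).
Proof.
  intros Hp Hd.
  assert (T : forall k, s k / ((1 + s k) * (1 + 2 * s k)) <= / (1 + s k) - / (1 + s (S k))).
  { intros k. specialize (Hp k) as P. specialize (Hd k) as D.
    apply Rle_trans with (/ (1 + s k) - / (1 + 2 * s k)).
    - apply Req_le. field. lra.
    - assert (/ (1 + s (S k)) <= / (1 + 2 * s k)) by (apply Rinv_le_contravar; lra). lra. }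
  induction n as [|n IH].
  - rewrite sum_O. eapply Rle_trans; [apply T|].
    assert (/ (1 + s 0%nat) <= / 1) by (apply Rinv_le_contravar; specialize (Hp 0%nat); lra). lra.
  - rewrite sum_Sn. unfold plus; simpl. specialize (T (S n)). lra.
Qed.

(** Brings the terms into the telescoping form of [doubling_sum]. With s = x^alpha it amounts to (1
    + s)(1 + 2 s) = O(e^x), which follows from s <= C e^(x/2). *)
Lemma lacunary_growth (alpha : R) : 0 < alpha ->
  exists B, 0 < B /\ forall x, 0 < x ->
    Rpower x alpha * exp (- x) <= B * (Rpower x alpha / ((1 + Rpower x alpha) * (1 + 2 * Rpower x alpha))).
Proof.
  intros Ha. destruct (Rpower_le_exp alpha (1 / 2) Ha ltac:(lra)) as [C [HC H]].
  exists (1 + 3 * C + 2 * C ^ 2). split; [assert (0 <= C ^ 2) by apply pow2_ge_0; lra|].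
  intros x Hx. set (s := Rpower x alpha). assert (Ps : 0 < s) by apply exp_pos.
  assert (Hs : s <= C * exp (1 / 2 * x)) by (apply H, Hx).
  set (e := exp (1 / 2 * x)) in *.
  assert (E2 : exp x = e * e). { unfold e. rewrite <- exp_plus. f_equal. field. }
  assert (E1 : 1 <= e) by (assert (E := exp_ineq1_le (1 / 2 * x)); unfold e; lra).
  rewrite exp_Ropp, E2.
  apply Rmult_le_reg_r with (e * e * ((1 + s) * (1 + 2 * s))).
  { repeat apply Rmult_lt_0_compat; lra. }
  replace (s * / (e * e) * (e * e * ((1 + s) * (1 + 2 * s)))) with (s * ((1 + s) * (1 + 2 * s))) by (field; lra).
  replace ((1 + 3 * C + 2 * C ^ 2) * (s / ((1 + s) * (1 + 2 * s))) * (e * e * ((1 + s) * (1 + 2 * s))))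
    with (s * ((1 + 3 * C + 2 * C ^ 2) * (e * e))) by (field; lra).
  apply Rmult_le_compat_l; [lra|].
  assert (Q1 : s * s <= (C * e) * (C * e)) by (apply Rmult_le_compat; lra).
  assert (Q2 : C * e <= C * (e * e)) by (apply Rmult_le_compat_l; [lra|nra]).
  assert (Q3 : 1 <= e * e) by nra.
  simpl. lra.
Qed.

(** With x_k = M_k (1 - r) the weighted terms are at most a constant times x_k^alpha exp(-x_k), and
    the x_k^alpha at least double from one k to the next; the telescoping sum bounds the total
    uniformly in [r] and [M]. *)
Lemma lacunary_sum_bound (alpha : R) : 0 < alpha ->
  exists B, forall (M : nat -> nat) (r : R), 0 <= r < 1 ->
    (forall k, (k <= M k)%nat /\ (1 <= M k)%nat) ->
    (forall k, 2 * Rpower (INR (M k)) alpha <= Rpower (INR (M (S k))) alpha) ->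
    ex_series (fun k => Rpower (INR (M k)) alpha * r ^ pred (M k)) /\
    Rpower (1 - r) alpha * Series (fun k => Rpower (INR (M k)) alpha * r ^ pred (M k)) <= B.
Proof.
  intros Ha. destruct (lacunary_growth alpha Ha) as [B [HB H]].
  exists (exp 1 * B). intros M r Hr HM Hd.
  assert (E1 : 0 < exp 1) by apply exp_pos.
  assert (Ps : forall k, 0 < INR (M k)) by (intros k; apply lt_0_INR; destruct (HM k); lia).
  set (s := fun k => Rpower (INR (M k) * (1 - r)) alpha).
  assert (Es : forall k, s k = Rpower (INR (M k)) alpha * Rpower (1 - r) alpha).
  { intros k. unfold s. rewrite <- Rpower_mult_distr by (try apply Ps; lra). reflexivity. }
  assert (W : 0 < Rpower (1 - r) alpha) by apply exp_pos.
  assert (s0 : forall k, 0 < s k) by (intros; apply exp_pos).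
  assert (sd : forall k, 2 * s k <= s (S k)).
  { intros k. rewrite !Es, <- Rmult_assoc. apply Rmult_le_compat_r; [lra|apply Hd]. }
  (* Convergence for fixed r by comparison at the radius (1 + r)/2, which is positive even if r = 0;
     dividing by it accounts for the exponent M - 1. *)
  assert (Sm : ex_series (fun k => Rpower (INR (M k)) alpha * r ^ pred (M k))).
  { destruct (Rpower_pow_tail alpha ((1 + r) / 2) 1 Ha ltac:(lra) ltac:(lra)) as [K HK].
    apply (ex_series_incr_n (V := R_NormedModule) _ K).
    destruct (HK (fun j => M (K + j)%nat)) as [X _].
    { intros j. apply HM. }
    refine (ex_series_le_R _ _ _ (ex_series_Rmult (/ ((1 + r) / 2)) _ X)).
    intros j. set (n := M (K + j)%nat). set (q := (1 + r) / 2). assert (Hq : 0 < q < 1) by (unfold q; lra).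
    assert (Rn : 0 < Rpower (INR n) alpha) by apply exp_pos.
    assert (r0 : 0 <= r ^ pred n) by (apply pow_le; lra).
    rewrite Rabs_pos_eq by (apply Rmult_le_pos; lra).
    replace (/ q * (Rpower (INR n) alpha * q ^ n)) with (Rpower (INR n) alpha * (q ^ n / q)) by (field; lra).
    apply Rmult_le_compat_l; [lra|]. eapply Rle_trans; [|apply pow_pred_le, Hq].
    apply pow_incr. unfold q. lra. }
  split; [exact Sm|].
  rewrite <- Series_scal_l. apply Series_le_bound.
  2: { apply ex_series_Rmult. exact Sm. }
  intros n.
  apply Rle_trans with (sum_n (fun k => (exp 1 * B) * (s k / ((1 + s k) * (1 + 2 * s k)))) n).
  - apply sum_n_m_le. intros k.
    (* From r <= exp(-(1 - r)); the factor [exp 1] covers the missing power, since exp(1 - r) <=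
       e. *)
    assert (D : r ^ pred (M k) <= exp 1 * exp (- (INR (M k) * (1 - r)))).
    { destruct (HM k) as [_ Hk]. destruct (M k) as [|j]; [lia|]. simpl pred.
      apply Rle_trans with (exp (- (1 - r)) ^ j).
      - apply pow_incr. assert (E := exp_ineq1_le (- (1 - r))). lra.
      - rewrite <- Rpower_pow by apply exp_pos. unfold Rpower. rewrite ln_exp, <- exp_plus.
        apply exp_le_compat. rewrite S_INR. lra. }
    assert (G := H (INR (M k) * (1 - r)) ltac:(apply Rmult_lt_0_compat; [apply Ps|lra])).
    fold (s k) in G.
    replace (Rpower (1 - r) alpha * (Rpower (INR (M k)) alpha * r ^ pred (M k))) with (s k * r ^ pred (M k))
      by (rewrite Es; ring).
    apply Rle_trans with (s k * (exp 1 * exp (- (INR (M k) * (1 - r))))).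
    + apply Rmult_le_compat_l; [left; apply s0|exact D].
    + replace (s k * (exp 1 * exp (- (INR (M k) * (1 - r))))) with (exp 1 * (s k * exp (- (INR (M k) * (1 - r))))) by ring.
      rewrite Rmult_assoc. apply Rmult_le_compat_l; [lra|exact G].
  - assert (DS := doubling_sum s n s0 sd).
    assert (0 < / (1 + s (S n))) by (apply Rinv_0_lt_compat; specialize (s0 (S n)); lra).
    rewrite (sum_n_mult_l (K := R_Ring)). unfold mult; simpl.
    rewrite <- (Rmult_1_r (exp 1 * B)) at 2. apply Rmult_le_compat_l; [nra|].
    eapply Rle_trans; [exact DS|lra].
Qed.

(** * The gliding hump *)

Lemma Csum_ext (a b : nat -> C) (n : nat) :
  (forall i, (i < n)%nat -> a i = b i) -> Csum a n = Csum b n.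
Proof.
  induction n as [|n IH]; intros H; simpl; [reflexivity|].
  rewrite IH, H by (intros; try apply H; lia). reflexivity.
Qed.

(** Greedy choice of factors: the k-th one is 1 exactly if the sum over the earlier terms in row k
    falls below the threshold. The recursion builds whole prefixes because each decision looks at
    all earlier ones. *)
Fixpoint sign_prefix (L : nat -> nat -> C) (thr : nat -> R) (k : nat) : nat -> R :=
  match k with
  | O => fun _ => 0
  | S k => fun i =>
      if Nat.eq_dec i k then
        if Rlt_dec (Cmod (Csum (fun j => RtoC (sign_prefix L thr k j) * L k j)%C k)) (thr k)
        then 1 else 0
      else sign_prefix L thr k i
  end.

Lemma sign_prefix_stable (L : nat -> nat -> C) (thr : nat -> R) (k i : nat) :
  (i < k)%nat -> sign_prefix L thr k i = sign_prefix L thr (S i) i.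
Proof.
  induction k as [|k IH]; intros H; [lia|].
  destruct (Nat.eq_dec i k) as [->|N]; [reflexivity|].
  rewrite <- IH by lia. simpl. destruct (Nat.eq_dec i k); [contradiction|reflexivity].
Qed.

(** The row sums without and with the diagonal term differ by at least 2 thr, so one of the two has
    modulus at least thr. Later choices do not affect row k, which stops at its diagonal. *)
Lemma choose_signs (L : nat -> nat -> C) (thr : nat -> R) :
  (forall k, 2 * thr k <= Cmod (L k k)) ->
  exists eps : nat -> R, (forall k, 0 <= eps k <= 1) /\
    forall k, thr k <= Cmod (Csum (fun i => RtoC (eps i) * L k i)%C (S k)).
Proof.
  intros H. exists (fun i => sign_prefix L thr (S i) i). split.
  - intros k. simpl. destruct (Nat.eq_dec k k) as [_|N]; [|contradiction].
    destruct (Rlt_dec _ _); lra.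
  - intros k. cbn [Csum].
    rewrite (Csum_ext _ (fun j => RtoC (sign_prefix L thr k j) * L k j)%C).
    2: { intros i Hi. rewrite <- (sign_prefix_stable L thr k i Hi). reflexivity. }
    set (S0 := Csum (fun j => RtoC (sign_prefix L thr k j) * L k j)%C k).
    simpl. destruct (Nat.eq_dec k k) as [_|N]; [|contradiction].
    fold S0. destruct (Rlt_dec (Cmod S0) (thr k)) as [Hlt|Hge].
    + rewrite Cplus_comm, Cmult_1_l. specialize (H k).
      assert (T := Cmod_reverse_triangle (L k k) S0). lra.
    + rewrite Cmult_0_l, Cplus_0_r. lra.
Qed.

Lemma weight_pos (alpha : R) (M : nat) : (1 <= M)%nat -> 0 < weight alpha M.
Proof.
  intros H. apply Rdiv_lt_0_compat; [apply exp_pos|apply lt_0_INR; lia].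
Qed.

Lemma weight_le (alpha : R) (M : nat) : (1 <= M)%nat -> weight alpha M <= Rpower (INR M) alpha.
Proof.
  intros H. assert (H1 : 1 <= INR M) by (apply (le_INR 1), H).
  unfold weight, Rdiv. rewrite <- (Rmult_1_r (Rpower (INR M) alpha)) at 2.
  apply Rmult_le_compat_l; [left; apply exp_pos|].
  rewrite <- Rinv_1. apply Rinv_le_contravar; lra.
Qed.

(** The order of choices matters: the time t_k and exponent M_k first, then the radius rho that
    contains the image of |z| = 1/2 under phi_(t_k), and only then M_(k+1), large enough for the
    whole later tail at rho to be negligible. The factor [A] enforces lacunarity. *)
Lemma hump_sequence (phi : R -> C -> C) (alpha : R) (A : nat) :
  analytic_semigroup phi -> nontrivial phi -> 0 < alpha -> (1 <= A)%nat ->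
  (forall t, 0 <= t -> exists phi', C1_disk (phi t) phi') ->
  exists (t : nat -> R) (M m : nat -> nat),
    (forall k, 0 < t k < / (INR k + 1)) /\
    (forall k, (k <= M k)%nat /\ (1 <= M k)%nat) /\
    (forall k, m k = M k \/ m k = S (M k)) /\
    (forall k, (A * M k <= M (S k))%nat) /\
    (forall k, 2 * PI / 4096 * (1 / 2) ^ M k <=
      Cmod (circle_coef (fun z => phi (t k) z ^ m k - z ^ m k)%C (1 / 2) (M k))) /\
    forall k, exists rho, 1 / 2 <= rho < 1 /\
      (forall s, Cmod (phi (t k) (circle_pt (1 / 2) s)) <= rho) /\
      ex_series (fun j => Rpower (INR (M (S k + j)%nat)) alpha * rho ^ M (S k + j)%nat) /\
      Series (fun j => Rpower (INR (M (S k + j)%nat)) alpha * rho ^ M (S k + j)%nat) <=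
      (1 / 2) ^ M k * weight alpha (M k) / 65536.
Proof.
  intros Hs Hn Ha HA HC1.
  assert (Hpick : forall n : nat, exists x : R * (nat * nat),
    0 < fst x < / (INR n + 1) /\ (n <= fst (snd x))%nat /\ (1 <= fst (snd x))%nat /\
    (snd (snd x) = fst (snd x) \/ snd (snd x) = S (fst (snd x))) /\
    2 * PI / 4096 * (1 / 2) ^ fst (snd x) <=
      Cmod (circle_coef (fun z => phi (fst x) z ^ snd (snd x) - z ^ snd (snd x))%C (1 / 2) (fst (snd x)))).
  { intros n. assert (N := pos_INR n).
    destruct (semigroup_pow_coef phi (/ (INR n + 1)) n Hs Hn HC1) as [t [M [m H]]].
    - apply Rinv_0_lt_compat. lra.
    - exists (t, (M, m)). exact H. }
  destruct (functional_choice _ Hpick) as [pick Pk].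
  (* Stated for every triple so that choice yields a function; triples with t <= 0 or M = 0 get the
     dummy value 0. *)
  assert (Htail : forall x : R * (nat * nat), exists K : nat,
    0 < fst x -> (1 <= fst (snd x))%nat -> exists rho, 1 / 2 <= rho < 1 /\
      (forall s, Cmod (phi (fst x) (circle_pt (1 / 2) s)) <= rho) /\
      forall L : nat -> nat, (forall j, (K + j <= L j)%nat /\ (1 <= L j)%nat) ->
      ex_series (fun j => Rpower (INR (L j)) alpha * rho ^ L j) /\
      Series (fun j => Rpower (INR (L j)) alpha * rho ^ L j) <=
      (1 / 2) ^ fst (snd x) * weight alpha (fst (snd x)) / 65536).
  { intros [t [M m]]. simpl. destruct (Rlt_dec 0 t) as [Ht|Ht]; [|exists O; intros; contradiction].
    destruct (le_lt_dec 1 M) as [HM|HM]; [|exists O; intros; lia].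
    destruct (HC1 t ltac:(lra)) as [phi' Hphi].
    destruct (circle_sup_attained (phi t) (1 / 2) (C1_disk_continuous _ _ Hphi) ltac:(lra)) as [s0 Hs0].
    assert (D := semigroup_self_map _ Hs t (circle_pt (1 / 2) s0) ltac:(lra) (disk_circle_pt (1 / 2) s0 ltac:(lra))).
    unfold disk in D.
    set (rho := Rmax (1 / 2) (Cmod (phi t (circle_pt (1 / 2) s0)))).
    assert (Hr : 1 / 2 <= rho < 1).
    { split; [apply Rmax_l|apply Rmax_lub_lt; lra]. }
    assert (He : 0 < (1 / 2) ^ M * weight alpha M / 65536).
    { apply Rdiv_lt_0_compat; [|lra]. apply Rmult_lt_0_compat; [apply pow_lt; lra|apply weight_pos, HM]. }
    destruct (Rpower_pow_tail alpha rho _ Ha ltac:(lra) He) as [K HK].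
    exists K. intros _ _. exists rho. split; [exact Hr|]. split; [|exact HK].
    intros s. eapply Rle_trans; [apply Hs0|apply Rmax_r]. }
  destruct (functional_choice _ Htail) as [Kf HKf].
  (* As [pick n] has exponent at least n and time below 1/(n+1), this single index secures the
     lacunary ratio, the tail threshold and the decay of the times. *)
  set (x := fix x (k : nat) : R * (nat * nat) :=
    match k with
    | O => pick O
    | S k => pick (A * fst (snd (x k)) + Kf (x k) + 1)%nat
    end).
  assert (x_pick : forall k, exists n, x k = pick n) by (intros [|k]; eexists; reflexivity).
  assert (x_S : forall k, (A * fst (snd (x k)) + Kf (x k) + 1 <= fst (snd (x (S k))))%nat).
  { intros k. apply Pk. }
  assert (x_ge1 : forall k, (1 <= fst (snd (x k)))%nat).
  { intros k. destruct (x_pick k) as [n ->]. apply Pk. }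
  assert (x_incr : forall k, (fst (snd (x k)) + 1 <= fst (snd (x (S k))))%nat).
  { intros k. specialize (x_S k). nia. }
  assert (x_ge : forall k, (k <= fst (snd (x k)))%nat).
  { induction k as [|k IH]; [lia|]. specialize (x_incr k). lia. }
  assert (x_time : forall k, 0 < fst (x k) < / (INR k + 1)).
  { intros [|k]; [apply (Pk O)|].
    destruct (Pk (A * fst (snd (x k)) + Kf (x k) + 1)%nat) as [[H1 H2] _].
    split; [exact H1|]. eapply Rlt_le_trans; [exact H2|].
    assert (N := pos_INR (S k)). apply Rinv_le_contravar; [lra|].
    apply Rplus_le_compat_r, le_INR. specialize (x_ge k).
    set (y := fst (snd (x k))) in *. nia. }
  exists (fun k => fst (x k)), (fun k => fst (snd (x k))), (fun k => snd (snd (x k))).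
  split; [exact x_time|]. split; [intros k; split; [apply x_ge|apply x_ge1]|].
  split; [|split; [|split]].
  - intros k. destruct (x_pick k) as [n ->]. apply Pk.
  - intros k. specialize (x_S k). lia.
  - intros k. destruct (x_pick k) as [n ->]. apply Pk.
  - intros k.
    assert (T0 : 0 < fst (x k)) by (destruct (x_pick k) as [n ->]; apply Pk).
    destruct (HKf (x k) T0 (x_ge1 k)) as [rho [Hr [Hphi HL]]].
    exists rho. split; [exact Hr|]. split; [exact Hphi|].
    apply (HL (fun j => fst (snd (x (S k + j)%nat)))). intros j. split; [|apply x_ge1].
    induction j as [|j IH].
    + rewrite !Nat.add_0_r. specialize (x_S k). lia.
    + specialize (x_incr (S k + j)%nat). replace (S k + S j)%nat with (S (S k + j)) by lia. lia.
Qed.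

(** * The function on which the semigroup is not continuous *)

Lemma has_Cderiv_const (c z : C) : has_Cderiv (fun _ => c) z 0%C.
Proof.
  intros eps Heps. exists 1. split; [lra|]. intros h _.
  replace (c - c - 0 * h)%C with (RtoC 0) by ring. rewrite Cmod_0.
  assert (H := Cmod_ge_0 h). nra.
Qed.

Lemma Hspace_one (p : Rbar) (alpha : R) : Rbar_le 1 p -> 0 < alpha ->
  Hspace p alpha (fun _ => 1%C).
Proof.
  intros Hp Ha. apply Hspace_of_growth with (B := 1); [exact Hp| |].
  - apply analytic_has_Cderiv. intros z _. eexists. apply has_Cderiv_const.
  - intros z Hz. unfold disk in Hz. assert (Z0 := Cmod_ge_0 z). rewrite Cmod_1, Rmult_1_r.
    replace 1 with (Rpower 1 alpha) at 2.
    + apply Rle_Rpower_l; lra.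
    + unfold Rpower. rewrite ln_1, Rmult_0_r. apply exp_0.
Qed.

(* Applying T_t to the constant 1 shows that phi_t' is itself analytic. *)
Lemma bounded_semigroup_C1 (phi : R -> C -> C) (p : Rbar) (alpha t : R) :
  Rbar_le 1 p -> 0 < alpha -> analytic_semigroup phi -> 0 <= t ->
  bounded_op p alpha (wcomp phi t) -> C1_disk (phi t) (C_derive (phi t)).
Proof.
  intros Hp Ha Hs Ht [Hb _]. destruct (Hb _ (Hspace_one p alpha Hp Ha)) as [Hd _].
  intros z Hz. split.
  - apply analytic_C_derive; [apply (semigroup_analytic _ Hs), Ht|exact Hz].
  - assert (Cz := analytic_continuous _ z Hd Hz). intros eps He.
    destruct (Cz eps He) as [d [D H]]. exists d. split; [exact D|]. intros w Hw.
    specialize (H w Hw). unfold wcomp in H. rewrite !Cmult_1_r in H. exact H.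
Qed.

Lemma continuous_on_disk_Csum (c : nat -> R) (m : nat -> nat) (n : nat) :
  continuous_on_disk (fun z => Csum (fun i => RtoC (c i) * z ^ m i)%C n).
Proof.
  induction n as [|n IH]; intros z Hz.
  - apply (Ccontinuous_at_const 0%C).
  - simpl. assert (H : continuous_on_disk (fun z => RtoC (- c n) * z ^ m n)%C).
    { intros w Hw. apply Ccontinuous_at_mult; [apply Ccontinuous_at_const|].
      apply (continuous_on_disk_pow (fun w => w)); [apply continuous_on_disk_id|exact Hw]. }
    assert (Q := continuous_on_disk_minus _ _ IH H z Hz). intros eps He.
    destruct (Q eps He) as [d [D Hd]]. exists d. split; [exact D|]. intros w Hw.
    specialize (Hd w Hw). rewrite RtoC_opp in Hd.
    match type of Hd with Cmod ?a < _ => match goal with |- Cmod ?b < _ =>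
      replace b with a by ring end end.
    exact Hd.
Qed.

Lemma continuous_on_disk_comp (f g : C -> C) : continuous_on_disk f -> continuous_on_disk g ->
  (forall z, disk z -> disk (g z)) -> continuous_on_disk (fun z => f (g z)).
Proof.
  intros Hf Hg Hd z Hz. apply Ccontinuous_at_comp; [apply Hf, Hd, Hz|apply Hg, Hz].
Qed.

Lemma circle_coef_Csum (phi : C -> C) (c : nat -> R) (m : nat -> nat) (n M : nat) (r : R) :
  continuous_on_disk phi -> 0 <= r < 1 ->
  circle_coef (fun z => Csum (fun i => RtoC (c i) * phi z ^ m i) n
    - Csum (fun i => RtoC (c i) * z ^ m i) n)%C r M =
  Csum (fun i => RtoC (c i) * circle_coef (fun z => phi z ^ m i - z ^ m i) r M)%C n.
Proof.
  intros Hphi Hr.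
  assert (Hd : forall i, Ccts (fun t => (phi (circle_pt r t) ^ m i - circle_pt r t ^ m i) * expi (- INR M * t))%C).
  { intros i. apply Ccts_mult; [|apply Ccts_expi].
    apply Ccts_minus; apply Ccts_pow; [apply Ccts_circle; assumption|apply Ccts_circle_pt]. }
  unfold circle_coef.
  assert (H : Ccts (fun t => (Csum (fun i => RtoC (c i) * phi (circle_pt r t) ^ m i) n
    - Csum (fun i => RtoC (c i) * circle_pt r t ^ m i) n) * expi (- INR M * t))%C /\
    CInt (fun t => (Csum (fun i => RtoC (c i) * phi (circle_pt r t) ^ m i) n
    - Csum (fun i => RtoC (c i) * circle_pt r t ^ m i) n) * expi (- INR M * t))%C =
    Csum (fun i => RtoC (c i) * CInt (fun t => (phi (circle_pt r t) ^ m i - circle_pt r t ^ m i) * expi (- INR M * t)))%C n).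
  { induction n as [|n [IH1 IH2]].
    - simpl. split.
      + apply Ccts_ext with (fun _ => RtoC 0); [intros; ring|apply Ccts_const].
      + rewrite (CInt_ext _ (fun _ => RtoC 0)) by (intros; ring). rewrite CInt_const. ring.
    - set (u := fun t => (RtoC (c n) * ((phi (circle_pt r t) ^ m n - circle_pt r t ^ m n) * expi (- INR M * t)))%C).
      assert (Cu : Ccts u) by (apply Ccts_mult; [apply Ccts_const|apply Hd]).
      cbn [Csum].
      assert (E : forall t, ((Csum (fun i => RtoC (c i) * phi (circle_pt r t) ^ m i) n
          - Csum (fun i => RtoC (c i) * circle_pt r t ^ m i) n) * expi (- INR M * t) + u t)%C =
        ((Csum (fun i => RtoC (c i) * phi (circle_pt r t) ^ m i) n + RtoC (c n) * phi (circle_pt r t) ^ m n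
          - (Csum (fun i => RtoC (c i) * circle_pt r t ^ m i) n + RtoC (c n) * circle_pt r t ^ m n))
          * expi (- INR M * t))%C).
      { intros t. unfold u. ring. }
      split.
      + eapply Ccts_ext; [exact E|]. apply Ccts_plus; assumption.
      + rewrite <- (CInt_ext _ _ E), CInt_plus by assumption. rewrite IH2. f_equal.
        unfold u. apply CInt_scal, Hd. }
  apply H.
Qed.

Lemma exists_not_cont_subspace (p : Rbar) (alpha : R) (phi : R -> C -> C) :
  Rbar_le 1 p -> 0 < alpha -> analytic_semigroup phi -> nontrivial phi ->
  (forall t, 0 <= t -> bounded_op p alpha (wcomp phi t)) ->
  exists f, Hspace p alpha f /\ ~ cont_subspace phi p alpha f.
Proof.
  intros Hp Ha Hs Hn Hb. assert (PP := PI_RGT_0).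
  assert (HC1 : forall t, 0 <= t -> C1_disk (phi t) (C_derive (phi t))).
  { intros t Ht. apply (bounded_semigroup_C1 phi p alpha); auto. }
  (* The ratio A >= 2^(1/alpha) makes M_k^alpha, rather than M_k, double at each step. *)
  assert (HA : exists A, (1 <= A)%nat /\ 2 <= Rpower (INR A) alpha).
  { assert (E : 0 < Rpower 2 (/ alpha)) by apply exp_pos.
    destruct (nfloor_ex (Rpower 2 (/ alpha)) ltac:(lra)) as [n [_ Hn2]].
    exists (S n). split; [lia|]. rewrite S_INR.
    replace 2 with (Rpower (Rpower 2 (/ alpha)) alpha) at 1.
    - apply Rle_Rpower_l; lra.
    - rewrite Rpower_mult, Rinv_l, Rpower_1; lra. }
  destruct HA as [A [HA1 HA2]].
  destruct (hump_sequence phi alpha A Hs Hn Ha HA1) as [t [M [m [Ht [HM [Hm [HAM [Hlam Htail]]]]]]]].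
  { intros s Hs0. exists (C_derive (phi s)). apply HC1, Hs0. }
  assert (PM : forall k, 0 < INR (M k)) by (intros k; apply lt_0_INR; destruct (HM k); lia).
  assert (Hw : forall k, 0 < weight alpha (M k)) by (intros; apply weight_pos, HM).
  assert (Hdouble : forall k, 2 * Rpower (INR (M k)) alpha <= Rpower (INR (M (S k))) alpha).
  { intros k. apply Rle_trans with (Rpower (INR A) alpha * Rpower (INR (M k)) alpha).
    - apply Rmult_le_compat_r; [left; apply exp_pos|exact HA2].
    - assert (0 < INR A) by (apply lt_0_INR; lia).
      rewrite Rpower_mult_distr by (try apply PM; lra). rewrite <- mult_INR.
      apply Rle_Rpower_l; [lra|]. split; [apply lt_0_INR; destruct (HM k); nia|apply le_INR, HAM]. }
  (* Row k collects the contributions of the monomials of [F] to the coefficient of index M_k at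
     time t_k. The threshold is half the lower bound known for the diagonal. *)
  destruct (choose_signs
    (fun k i => RtoC (weight alpha (M i)) * circle_coef (fun z => phi (t k) z ^ m i - z ^ m i) (1 / 2) (M k))%C
    (fun k => PI / 4096 * (1 / 2) ^ M k * weight alpha (M k))) as [eps [He Hthr]].
  { intros k. rewrite Cmod_mult, Cmod_R, Rabs_pos_eq by (left; apply Hw).
    apply Rle_trans with (weight alpha (M k) * (2 * PI / 4096 * (1 / 2) ^ M k)); [lra|].
    apply Rmult_le_compat_l; [left; apply Hw|apply Hlam]. }
  set (c := fun k => eps k * weight alpha (M k)).
  assert (Hc : forall k, Rabs (c k) <= weight alpha (M k)).
  { intros k. unfold c. specialize (He k). specialize (Hw k).
    rewrite Rabs_pos_eq by (apply Rmult_le_pos; lra).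
    assert (eps k * weight alpha (M k) <= 1 * weight alpha (M k)) by (apply Rmult_le_compat_r; lra). lra. }
  assert (Hc' : forall k, Rabs (c k) <= Rpower (INR (M k)) alpha).
  { intros k. eapply Rle_trans; [apply Hc|apply weight_le, HM]. }
  assert (Hmle : forall k, (M k <= m k <= S (M k))%nat) by (intros k; destruct (Hm k); lia).
  assert (Hpow : forall k x, 0 <= x <= 1 -> x ^ m k <= x ^ M k).
  { intros k x Hx. destruct (Hm k) as [->| ->]; [apply Rle_refl|].
    assert (0 <= x ^ M k) by (apply pow_le; lra). simpl. nra. }
  (* Since m <= M + 1 and M >= 1, (m + 1)^3 <= 27 M^3, which raises the power of M to alpha + 3. *)
  assert (Hsum : power_summable c m 3).
  { intros rho Hr.
    destruct (Rpower_pow_tail (alpha + 3) rho 1 ltac:(lra) Hr ltac:(lra)) as [K HK].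
    destruct (HK (fun j => M (K + j)%nat)) as [X _]; [intros; apply HM|].
    apply (ex_series_incr_n (V := R_NormedModule)
      (fun k => Rpower (INR (M k)) (alpha + 3) * rho ^ M k) K) in X.
    refine (ex_series_le_R _ _ _ (ex_series_Rmult 27 _ X)). intros k.
    assert (N := pos_INR (m k)).
    rewrite !Rabs_mult, Rabs_Rabsolu, (Rabs_pos_eq (_ ^ 3)), (Rabs_pos_eq (rho ^ _)) by (apply pow_le; lra).
    assert (L : INR (m k) + 1 <= 3 * INR (M k)).
    { apply Rle_trans with (INR (S (M k)) + 1).
      - apply Rplus_le_compat_r, le_INR, Hmle.
      - rewrite S_INR. assert (1 <= INR (M k)) by (apply (le_INR 1), HM). lra. }
    assert (L3 : (INR (m k) + 1) ^ 3 <= 27 * Rpower (INR (M k)) 3).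
    { replace (Rpower (INR (M k)) 3) with (INR (M k) ^ 3)
        by (rewrite <- (Rpower_pow 3) by apply PM; f_equal; simpl; ring).
      apply Rle_trans with ((3 * INR (M k)) ^ 3); [apply pow_incr; lra|]. simpl. lra. }
    rewrite Rpower_plus.
    apply Rle_trans with (Rpower (INR (M k)) alpha * (27 * Rpower (INR (M k)) 3) * rho ^ M k); [|lra].
    apply Rmult_le_compat; [|apply pow_le; lra| |apply Hpow; lra].
    - apply Rmult_le_pos; [apply Rabs_pos|apply pow_le; lra].
    - apply Rmult_le_compat; [apply Rabs_pos|apply pow_le; lra|apply Hc'|exact L3]. }
  destruct (Cpower_series_C1 c m Hsum) as [HF Hfan].
  set (F := Cpower_series c m) in *.
  set (f := Cpower_series (fun k => c k * INR (m k)) (fun k => pred (m k))) in *.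
  (* The coefficients of [f] are at most 2 M^alpha, because m <= 2 M; the factor 4 is this 2 times
     the 2 of [Cmod_CSeries_le]. *)
  assert (HfH : Hspace p alpha f).
  { destruct (lacunary_sum_bound alpha Ha) as [B HB].
    apply Hspace_of_growth with (B := 4 * B); [exact Hp|exact Hfan|].
    intros z Hz. unfold disk in Hz. assert (Z0 := Cmod_ge_0 z).
    destruct (HB M (Cmod z) ltac:(lra) HM Hdouble) as [S1 S2].
    assert (Q : Cmod (f z) <= 2 * Series (fun k => 2 * (Rpower (INR (M k)) alpha * Cmod z ^ pred (M k)))).
    { apply Cmod_CSeries_le; [|apply ex_series_Rmult, S1].
      intros k. rewrite Cmod_mult, Cmod_R, Cmod_pow, Rabs_mult, (Rabs_pos_eq (INR _)) by apply pos_INR.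
      rewrite <- Rmult_assoc. apply Rmult_le_compat.
      - apply Rmult_le_pos; [apply Rabs_pos|apply pos_INR].
      - apply pow_le, Z0.
      - apply Rle_trans with (weight alpha (M k) * (2 * INR (M k))).
        + apply Rmult_le_compat; [apply Rabs_pos|apply pos_INR|apply Hc|].
          apply Rle_trans with (INR (S (M k))); [apply le_INR, Hmle|].
          rewrite S_INR. assert (1 <= INR (M k)) by (apply (le_INR 1), HM). lra.
        + apply Req_le. unfold weight. field. apply Rgt_not_eq, PM.
      - destruct (HM k) as [_ H1]. destruct (Hm k) as [->| ->]; [apply Rle_refl|].
        destruct (M k) as [|j]; [lia|]. simpl.
        assert (0 <= Cmod z ^ j) by (apply pow_le, Z0). nra. }
    rewrite Series_scal_l in Q.
    assert (W : 0 < Rpower (1 - Cmod z) alpha) by apply exp_pos.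
    apply Rle_trans with (Rpower (1 - Cmod z) alpha * (2 * (2 * Series (fun k => Rpower (INR (M k)) alpha * Cmod z ^ pred (M k))))).
    - apply Rmult_le_compat_l; lra.
    - lra. }
  exists f. split; [exact HfH|]. intros [_ Hcont].
  assert (V : 0 < Rpower 2 alpha) by apply exp_pos.
  (* Chosen so that a norm below [e0] would force the M_k-th coefficient of F o phi - F to be at
     most 2 pi (1/2)^M weight / 32768. *)
  set (e0 := / (3 * Rpower 2 alpha * 32768)).
  assert (e0pos : 0 < e0) by (apply Rinv_0_lt_compat; lra).
  destruct (Hcont (mkposreal e0 e0pos)) as [d Hd].
  assert (Hk : exists k, t k < d).
  { destruct (nfloor_ex (/ d)) as [k [_ Hk]]; [left; apply Rinv_0_lt_compat, cond_pos|].
    exists k. eapply Rlt_trans; [apply Ht|].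
    rewrite <- (Rinv_inv d). apply Rinv_lt_contravar; [|exact Hk].
    assert (N := pos_INR k). apply Rmult_lt_0_compat; [apply Rinv_0_lt_compat, cond_pos|lra]. }
  destruct Hk as [k Hk]. destruct (Ht k) as [Hk0 _].
  assert (Hnorm : Rbar_lt (Hnorm p alpha (fun z => (wcomp phi (t k) f z - f z)%C)) e0).
  { apply Hd; [|exact Hk0]. change (Rabs (t k - 0) < d). rewrite Rminus_0_r, Rabs_pos_eq; lra. }
  assert (Hphi := HC1 (t k) ltac:(lra)).
  assert (Hself : forall z, disk z -> disk (phi (t k) z)).
  { intros z Hz. apply (semigroup_self_map _ Hs); [lra|exact Hz]. }
  (* The chain rule produces the derivative of F o phi_t - F in exactly the form
     [wcomp phi (t k) f z - f z]. *)
  assert (HG := C1_disk_minus _ _ _ _ (C1_disk_comp F f (phi (t k)) _ HF Hphi Hself) HF).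
  destruct (HM k) as [_ HMk].
  assert (Up := coef_le_Hnorm p alpha e0 _ _ (M k) Hp Ha HG HMk (Rbar_lt_le _ _ Hnorm)).
  replace (3 * Rpower 2 alpha * e0) with (/ 32768) in Up by (unfold e0; field; lra).
  set (Pk := fun z => Csum (fun i => RtoC (c i) * z ^ m i)%C (S k)).
  set (Qk := fun z => (F z - Pk z)%C).
  assert (CF := C1_disk_continuous _ _ HF). assert (Cphi := C1_disk_continuous _ _ Hphi).
  assert (CP : continuous_on_disk Pk) by apply continuous_on_disk_Csum.
  assert (CQ : continuous_on_disk Qk) by (apply continuous_on_disk_minus; assumption).
  assert (EQ : circle_coef (fun z => Qk (phi (t k) z) - Qk z)%C (1 / 2) (M k) =
    (circle_coef (fun z => F (phi (t k) z) - F z)%C (1 / 2) (M k)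
     - circle_coef (fun z => Pk (phi (t k) z) - Pk z)%C (1 / 2) (M k))%C).
  { rewrite <- circle_coef_minus; [|apply continuous_on_disk_minus|apply continuous_on_disk_minus|lra];
      try assumption; try (apply continuous_on_disk_comp; assumption).
    apply CInt_ext. intros s. unfold Qk. ring. }
  assert (EP : circle_coef (fun z => Pk (phi (t k) z) - Pk z)%C (1 / 2) (M k) =
    Csum (fun i => RtoC (eps i) * (RtoC (weight alpha (M i)) *
      circle_coef (fun z => phi (t k) z ^ m i - z ^ m i) (1 / 2) (M k)))%C (S k)).
  { unfold Pk. rewrite (circle_coef_Csum (phi (t k)) c m (S k) (M k) (1 / 2) Cphi ltac:(lra)).
    apply Csum_ext. intros i _. unfold c. rewrite RtoC_mult. ring. }
  destruct (Htail k) as [rho [Hr [Hrphi [Ser1 Ser2]]]].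
  set (eta := (1 / 2) ^ M k * weight alpha (M k) / 65536) in *.
  (* The disk of radius rho contains both the circle |z| = 1/2 and its image under phi_(t_k), so a
     single estimate of the tail serves Q o phi and Q. *)
  assert (BQ : forall w, Cmod w <= rho -> Cmod (Qk w) <= 2 * eta).
  { intros w Hw0. assert (Dw : disk w) by (unfold disk; lra).
    unfold Qk, F, Cpower_series.
    rewrite (CSeries_split _ (S k) (power_summable_Csummable c m 3 w Hsum Dw)).
    fold (Pk w).
    match goal with |- Cmod (?a + ?b - ?a')%C <= _ => replace (a + b - a')%C with b by (unfold Pk; ring) end.
    apply Rle_trans with (2 * Series (fun j => Rpower (INR (M (S k + j)%nat)) alpha * rho ^ M (S k + j)%nat)); [|lra].
    apply Cmod_CSeries_le; [|exact Ser1]. intros j.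
    eapply Rle_trans; [apply (term_bound _ _ rho); lra|].
    apply Rmult_le_compat; [apply Rabs_pos|apply pow_le; lra|apply Hc'|apply Hpow; lra]. }
  assert (BQ2 : Cmod (circle_coef (fun z => Qk (phi (t k) z) - Qk z)%C (1 / 2) (M k)) <= 2 * PI * (4 * eta)).
  { apply circle_coef_bound; [|lra|].
    - apply continuous_on_disk_minus; [|exact CQ]. apply continuous_on_disk_comp; assumption.
    - intros s. eapply Rle_trans; [apply Cmod_minus_le|].
      assert (B1 := BQ _ (Hrphi s)). assert (B2 := BQ (circle_pt (1 / 2) s)).
      rewrite Cmod_circle_pt in B2 by lra. specialize (B2 ltac:(lra)). lra. }
  specialize (Hthr k). rewrite <- EP in Hthr.
  assert (T : Cmod (circle_coef (fun z => Pk (phi (t k) z) - Pk z)%C (1 / 2) (M k)) <=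
    Cmod (circle_coef (fun z => F (phi (t k) z) - F z)%C (1 / 2) (M k)) + 2 * PI * (4 * eta)).
  { eapply Rle_trans; [|apply Rplus_le_compat_l, BQ2]. rewrite EQ.
    match goal with |- Cmod ?a <= Cmod ?b + _ => assert (X := Cmod_minus_le b (b - a)%C);
      replace (b - (b - a))%C with a in X by ring; exact X end. }
  specialize (Hw k).
  assert (h0 : 0 < (1 / 2) ^ M k) by (apply pow_lt; lra).
  assert (0 < PI * ((1 / 2) ^ M k * weight alpha (M k))).
  { apply Rmult_lt_0_compat; [exact PP|]. apply Rmult_lt_0_compat; assumption. }
  (* In units of 2 pi (1/2)^M weight, the partial sum contributes at least 1/8192 = 4/32768, whereas
     the small norm allows 1/32768 and the tail 4/65536 = 2/32768. *)
  unfold eta in *. lra.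
Qed.

Theorem theorem16 (p : Rbar) (alpha : R)
    (hp : Rbar_le 1 p) (halpha : 0 < alpha)
    (phi : R -> C -> C)
    (hphi : analytic_semigroup phi) (hnt : nontrivial phi) :
  ~ strongly_continuous phi p alpha /\
  ((forall t, 0 <= t -> bounded_op p alpha (wcomp phi t)) ->
   (exists M : R, forall t, 0 <= t <= 1 ->
      Rbar_le (op_norm p alpha (wcomp phi t)) M) ->
   proper_subset (cont_subspace phi p alpha) (Hspace p alpha)).
Proof.
  split.
  - intros [Hb Hc].
    destruct (exists_not_cont_subspace p alpha phi hp halpha hphi hnt Hb) as [f [Hf Nf]].
    apply Nf, Hc, Hf.
  - intros Hb _. split.
    + intros f [Hf _]. exact Hf.
    + exact (exists_not_cont_subspace p alpha phi hp halpha hphi hnt Hb).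
Qed.
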